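(* Let $\mathfrak{g}$ be a finite-dimensional simple Lie algebra over $\mathbb{C}$ with a $\mathbb{Z}_n$-grading, and let $\mathfrak{h}_0,\mathfrak{b}_0,\Delta_0,\Sigma_+,\preccurlyeq_0$ be as in the context. An antichain $\mathcal{A}\subseteq\Sigma_+$ (with respect to $\preccurlyeq_0$) is a $k$-nilpotent positively-graded $\mathfrak{b}_0$-module subalgebra antichain if and only if the following three properties hold: (i) For any $(\mu_1,j_1),\dots,(\mu_{k+1},j_{k+1})\in\mathcal{A}$, $(\mu_1,j_1)+\dots+(\mu_{k+1},j_{k+1})\not\preccurlyeq_0(\lambda,j_1+\dots+j_{k+1})$ for any highest weight $\lambda$ of $\mathfrak{g}_{j_1+\dots+j_{k+1}}$. (ii) For any $(\mu_1,j_1),\dots,(\mu_m,j_m)\in\mathcal{A}$ with $j_1+\dots+j_m\equiv 0$, $(\mu_1,j_1)+\dots+(\mu_m,j_m)\not\preccurlyeq_0(\theta,0)$ for any highest root $\theta$ of $\mathfrak{g}_0$. (iii) If $(\mu_1,j_1),(\mu_2,j_2)\in\mathcal{A}$ and $(\mu_1,j_1)+(\mu_2,j_2)\preccurlyeq_0(\nu,j_1+j_2)$ for some $(\nu,j_1+j_2)\in\Sigma_+$, then there exists $(\alpha,j_1+j_2)\in\mathcal{A}$ with $(\alpha,j_1+j_2)\preccurlyeq_0(\nu,j_1+j_2)$.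
   Context: $\mathfrak{g}=\bigoplus_{i\in\mathbb{Z}_n}\mathfrak{g}_i$; $\mathfrak{h}$ is a Cartan subalgebra of $\mathfrak{g}$ with $\mathfrak{h}_0=\mathfrak{h}\cap\mathfrak{g}_0$ a Cartan subalgebra of the reductive algebra $\mathfrak{g}_0$; $\mathfrak{b}_0\supseteq\mathfrak{h}_0$ is a Borel subalgebra of $\mathfrak{g}_0$ with corresponding simple roots $\Delta_0$; $Q_0^+$ is the $\mathbb{Z}_{\ge0}$-span of $\Delta_0$. $P_0$ is the integral weight lattice of $\mathfrak{h}_0$, $\mathcal{P}_0=P_0\times\mathbb{Z}_n$ with componentwise addition and partial order $(\mu_1,j_1)\preccurlyeq_0(\mu_2,j_2)$ iff $j_1=j_2$ and $\mu_2-\mu_1\in Q_0^+$; an antichain is a set of pairwise incomparable elements. For $j\ne0$, $R_j$ is the set of $\mathfrak{h}_0$-weights of $\mathfrak{g}_j$, and $\Sigma_+=\{(\mu,j):j\not\equiv0,\ \mu\in R_j,\ \mu\ne0\}$. Highest weights of $\mathfrak{g}_j$ are the highest weights (w.r.t. $\mathfrak{b}_0$) of the irreducible $\mathfrak{g}_0$-submodules of $\mathfrak{g}_j$; highest roots of $\mathfrak{g}_0$ are the highest roots of its simple ideals. $\mathfrak{g}_+=\bigoplus_{i\ne0}\mathfrak{g}_i$. A $k$-nilpotent positively-graded $\mathfrak{b}_0$-module subalgebra is a subset $\mathfrak{i}\subseteq\mathfrak{g}_+$ with $[\mathfrak{i},\mathfrak{i}]\subseteq\mathfrak{i}$, $[\mathfrak{b}_0,\mathfrak{i}]\subseteq\mathfrak{i}$,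 $(\operatorname{ad}\mathfrak{i})^k(\mathfrak{i})=0$, and $\mathfrak{i}=\bigoplus_{j\ne0}(\mathfrak{i}\cap\mathfrak{g}_j)$. Its set of graded $\mathfrak{h}_0$-weights is $\operatorname{grwt}(\mathfrak{i})=\{(\mu,j)\in\mathcal{P}_0:\mu\text{ is an }\mathfrak{h}_0\text{-weight of }\mathfrak{i}\cap\mathfrak{g}_j\}$, and $\mathcal{A}_{\mathfrak{i}}$ is the set of $\preccurlyeq_0$-minimal elements of $\operatorname{grwt}(\mathfrak{i})$. An antichain $\mathcal{A}\subseteq\Sigma_+$ is a $k$-nilpotent positively-graded $\mathfrak{b}_0$-module subalgebra antichain if $\mathcal{A}=\mathcal{A}_{\mathfrak{i}}$ for some $k$-nilpotent positively-graded $\mathfrak{b}_0$-module subalgebra $\mathfrak{i}$ (necessarily with $\operatorname{grwt}(\mathfrak{i})\subseteq\Sigma_+$). Nonzero-weight spaces of each $\mathfrak{g}_j$, $j\ne0$, are one-dimensional. *)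

(* Defs.v *)
From HB Require Import structures.
From mathcomp Require Import all_boot all_order all_algebra.
From mathcomp Require Import reals complex.

Unset Printing Implicit Defensive.

Import GRing.Theory.
Local Open Scope ring_scope.

Section LieDefs.

Variables (F : fieldType) (L : vectType F) (br : L -> L -> L).

Definition is_lie_bracket : Prop :=
  [/\ (forall (a : F) (x y z : L), br (a *: x + y) z = a *: br x z + br y z),
      (forall (a : F) (x y z : L), br z (a *: x + y) = a *: br z x + br z y),
      (forall x : L, br x x = 0) &
      (forall x y z : L, br x (br y z) + br y (br z x) + br z (br x y) = 0)].

Definition subalg (U : {vspace L}) : Prop :=
  forall x y, x \in U -> y \in U -> br x y \in U.

Definition ad_stable (A U : {vspace L}) : Prop :=
  forall x y, x \in A -> y \in U -> br x y \in U.

Definition itbr (xs : seq L) (y : L) : L := foldr br y xs.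

Definition ad_nilpotent_of (m : nat) (U : {vspace L}) : Prop :=
  forall (xs : seq L) (y : L), size xs = m -> all (fun x => x \in U) xs ->
    y \in U -> itbr xs y = 0.

Definition nilpotent (U : {vspace L}) : Prop := exists m, ad_nilpotent_of m U.

(** [U,U], the span of all brackets of elements of U (by bilinearity, the
    span of brackets of basis vectors). *)
Definition derived (U : {vspace L}) : {vspace L} :=
  <<[seq br u v | u <- vbasis U, v <- vbasis U]>>%VS.

Definition solvable (U : {vspace L}) : Prop :=
  exists m, iter m derived U = 0%VS.

Definition cartan_in (A H : {vspace L}) : Prop :=
  [/\ (H <= A)%VS, subalg H, nilpotent H &
      forall x, x \in A -> (forall y, y \in H -> br x y \in H) -> x \in H].

Definition borel_in (A B : {vspace L}) : Prop :=
  [/\ (B <= A)%VS, subalg B, solvable B &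
      forall B' : {vspace L}, (B <= B')%VS -> (B' <= A)%VS -> subalg B' ->
        solvable B' -> B' = B].

Definition simple_lie (A : {vspace L}) : Prop :=
  [/\ subalg A,
      (exists x y, [/\ x \in A, y \in A & br x y != 0]) &
      forall J : {vspace L}, (J <= A)%VS -> ad_stable A J ->
        J = 0%VS \/ J = A].

(** Z_{n+1}-gradings, indexed by the cyclic group 'I_n.+1 *)
Definition is_grading (n : nat) (G : 'I_n.+1 -> {vspace L}) : Prop :=
  [/\ (\sum_(i < n.+1) G i)%VS = fullv,
      directv (\sum_(i < n.+1) G i) &
      forall (i j : 'I_n.+1) x y, x \in G i -> y \in G j -> br x y \in G (i + j)].

Definition wt (H0 : {vspace L}) := 'Hom(subvs_of H0, F^o).

Definition weight_vec (H0 : {vspace L}) (mu : wt H0) (x : L) : Prop :=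
  forall t : subvs_of H0, br (vsval t) x = (mu t : F) *: x.

Definition is_weight_of (H0 V : {vspace L}) (mu : wt H0) : Prop :=
  exists2 x, x \in V & x != 0 /\ weight_vec H0 mu x.

(** roots of A (= g_0) w.r.t. H0 (= h_0) *)
Definition is_root (H0 A : {vspace L}) (mu : wt H0) : Prop :=
  mu != 0 /\ is_weight_of H0 A mu.

Definition is_posroot (H0 A B : {vspace L}) (mu : wt H0) : Prop :=
  is_root H0 A mu /\ (forall x, x \in A -> weight_vec H0 mu x -> x \in B).

Definition is_simple_root (H0 A B : {vspace L}) (mu : wt H0) : Prop :=
  is_posroot H0 A B mu /\
  ~ (exists a b, [/\ is_posroot H0 A B a, is_posroot H0 A B b & mu = a + b]).

Definition inQplus (H0 A B : {vspace L}) (nu : wt H0) : Prop :=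
  exists s : seq (wt H0),
    (forall a, a \in s -> is_simple_root H0 A B a) /\ nu = \sum_(a <- s) a.

Definition gwt (H0 : {vspace L}) (n : nat) := (wt H0 * 'I_n.+1)%type.

Definition preceq (H0 A B : {vspace L}) (n : nat) (p q : gwt H0 n) : Prop :=
  p.2 = q.2 /\ inQplus H0 A B (q.1 - p.1).

Definition gsum (H0 : {vspace L}) (n : nat) (ps : seq (gwt H0 n)) : gwt H0 n :=
  (\sum_(p <- ps) p.1, \sum_(p <- ps) p.2).

Definition antichain (H0 A B : {vspace L}) (n : nat)
    (S : gwt H0 n -> Prop) : Prop :=
  forall p q, S p -> S q -> preceq H0 A B n p q -> p = q.

Definition SigmaP (H0 : {vspace L}) (n : nat) (G : 'I_n.+1 -> {vspace L})
    (p : gwt H0 n) : Prop :=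
  [/\ p.2 != 0, p.1 != 0 & is_weight_of H0 (G p.2) p.1].

Definition irred_submod (A W V : {vspace L}) : Prop :=
  [/\ (V <= W)%VS, V != 0%VS, ad_stable A V &
      forall U : {vspace L}, (U <= V)%VS -> ad_stable A U ->
        U = 0%VS \/ U = V].

(** lam is the highest weight (w.r.t. B, containing H0) of the module V:
    the H0-weight of a B-stable line (a highest weight vector). *)
Definition highest_weight_of (H0 B V : {vspace L}) (lam : wt H0) : Prop :=
  exists2 v, v \in V &
    [/\ v != 0, weight_vec H0 lam v & forall b, b \in B -> br b v \in <[v]>%VS].

Definition highest_weight_gj (H0 A B W : {vspace L}) (lam : wt H0) : Prop :=
  exists V : {vspace L}, irred_submod A W V /\ highest_weight_of H0 B V lam.

Definition highest_root (H0 A B : {vspace L}) (theta : wt H0) : Prop :=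
  exists I : {vspace L},
    [/\ (I <= A)%VS, ad_stable A I, simple_lie I & highest_weight_of H0 B I theta].

Definition gplus (n : nat) (G : 'I_n.+1 -> {vspace L}) : {vspace L} :=
  (\sum_(j < n.+1 | j != 0%R) G j)%VS.

Definition knil_pg_bmod_subalg (n k : nat) (G : 'I_n.+1 -> {vspace L})
    (B I : {vspace L}) : Prop :=
  [/\ (I <= gplus n G)%VS, subalg I, ad_stable B I, ad_nilpotent_of k I &
      I = (\sum_(j < n.+1 | j != 0%R) (I :&: G j))%VS].

Definition grwt (H0 : {vspace L}) (n : nat) (G : 'I_n.+1 -> {vspace L})
    (I : {vspace L}) (p : gwt H0 n) : Prop :=
  is_weight_of H0 (I :&: G p.2)%VS p.1.

Definition minimal_grwt (H0 A B : {vspace L}) (n : nat) (G : 'I_n.+1 -> {vspace L})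
    (I : {vspace L}) (p : gwt H0 n) : Prop :=
  grwt H0 n G I p /\ forall q, grwt H0 n G I q -> preceq H0 A B n q p -> q = p.

Definition knil_antichain (H0 B : {vspace L}) (n k : nat)
    (G : 'I_n.+1 -> {vspace L}) (S : gwt H0 n -> Prop) : Prop :=
  exists I : {vspace L}, knil_pg_bmod_subalg n k G B I /\
    forall p, S p <-> minimal_grwt H0 (G 0) B n G I p.

End LieDefs.

Arguments is_lie_bracket {F L}.
Arguments subalg {F L}.
Arguments ad_stable {F L}.
Arguments itbr {F L}.
Arguments ad_nilpotent_of {F L}.
Arguments nilpotent {F L}.
Arguments derived {F L}.
Arguments solvable {F L}.
Arguments cartan_in {F L}.
Arguments borel_in {F L}.
Arguments simple_lie {F L}.
Arguments is_grading {F L}.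
Arguments wt {F L}.
Arguments weight_vec {F L}.
Arguments is_weight_of {F L}.
Arguments is_root {F L}.
Arguments is_posroot {F L}.
Arguments is_simple_root {F L}.
Arguments inQplus {F L}.
Arguments gwt {F L}.
Arguments preceq {F L}.
Arguments gsum {F L}.
Arguments antichain {F L}.
Arguments SigmaP {F L}.
Arguments irred_submod {F L}.
Arguments highest_weight_of {F L}.
Arguments highest_weight_gj {F L}.
Arguments highest_root {F L}.
Arguments gplus {F L}.
Arguments knil_pg_bmod_subalg {F L}.
Arguments grwt {F L}.
Arguments minimal_grwt {F L}.
Arguments knil_antichain {F L}.

(* Main.v *)
(* A Cartan subalgebra h acts on g with generalized weights; the trace of [e, f]
   vanishes on every weight string, which yields Cartan's criterion, hence a
   nondegenerate Killing form, and then h acts diagonalizably.  So does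
   h_0 <= h, and the same string argument makes the form on h_0-weights real and
   positive definite.  An sl_2-type argument for a weight vector x of weight
   (mu, j), mu <> 0, shows that ad x is injective on weights nu with
   (nu, mu) < 0, and that (mu, j) has multiplicity one.

   If i is a subalgebra as in the theorem, then no weight of i is zero (otherwise
   i contains x and y of weights a and -a and (ad y)^2 (ad x)^2 (ad y)^2 ... never
   vanishes), and no nonempty sum of weights of i is zero.  If
   mu_1 + ... + mu_m + q = nu with q a sum of positive roots of g_0, then
   (q, q) > 0 lets us raise some mu_i or lower nu by a positive root occurring in
   q until q = 0; then (nu, nu) > 0 gives an i with (nu, mu_i) > 0, and peeling
   off mu_i repeatedly produces a nonzero iterated bracket of weight nu.  This
   gives (i), (ii) and (iii).

   Conversely the span of the weight spaces above the antichain is the required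
   subalgebra, once every weight of g_j lies below a highest weight.  The latter
   holds because a maximal vector generates an irreducible g_0-module, by
   comparing the eigenvalues of the Casimir operator of g_0. *)
Require Import Defs.
From HB Require Import structures.
From mathcomp Require Import all_boot all_order all_algebra.
From mathcomp Require Import reals complex.
From mathcomp Require Import boolp ring.

Set Implicit Arguments.
Unset Strict Implicit.
Unset Printing Implicit Defensive.

Import Order.TTheory GRing.Theory Num.Theory passmx.
Local Open Scope ring_scope.

(** * Generalized eigenspaces and traces *)

Section LinearAlgebra.

Variables (F : numClosedFieldType) (L : vectType F).
Implicit Types (f g : 'End(L)) (a b : F) (u v w : L) (U V : {vspace L}).

(** Cartan and Borel subalgebras enter only through self-normalization, nilpotency and maximal
    solvability, so the weights of [h] are at first generalized and not even known to be linear. Two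
    facts do most of the work: the form on weights is a sum of squares taken over all weights of g,
    and these weights are finite in number. If a list of weights sums to zero, its first member
    pairs negatively with another, the corresponding bracket is nonzero, and the list can be
    shortened; positive roots of g_0 and weights of i are both treated this way. The obstacle in (i)
    to (iii) is that nu = mu_i + rest does not by itself make a bracket of weight vectors for mu_i
    and rest nonzero, because these two may pair positively. The nonvanishing is obtained on the
    dual side, where mu_i pairs negatively with -nu. In the converse, (ii) is silent when g_0 has no
    roots, since there are then no highest roots; in that case the order is equality and opposite
    pairs have to be excluded by (i) alone. *)

Lemma vspace_of_pred (P : L -> Prop) :
  P 0 -> (forall a x y, P x -> P y -> P (a *: x + y)) ->
  exists U : {vspace L}, forall x, x \in U <-> P x.
Proof.
move=> P0 Plin.
(* Dimensions of subspaces inside [P] are bounded, and one of maximal dimension contains every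
   vector of [P], since adding a missing one would enlarge it. *)
pose Q m := `[< exists U : {vspace L}, (forall x, x \in U -> P x) /\ \dim U = m >].
have exQ : exists m, Q m.
  exists 0%N; apply/asboolP; exists 0%VS; split; last by rewrite dimv0.
  by move=> x; rewrite memv0 => /eqP->.
have ubQ m : Q m -> (m <= \dim {:L})%N.
  by move/asboolP=> [U [_ <-]]; rewrite dimvS ?subvf.
have [m /asboolP[U [UP dimU]] maxU] := ex_maxnP exQ ubQ.
exists U => x; split; first exact: UP.
move=> Px; apply/negPn/negP => xU.
have /maxU : Q (\dim (<[x]> + U)%VS).
  apply/asboolP; exists (<[x]> + U)%VS; split=> // y /memv_addP[_ /vlineP[k ->] [z zU ->]].
  by apply: Plin => //; apply: UP.
rewrite -dimU leqNgt => /negP; apply.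
rewrite ltnNge; apply/negP => dle.
have /eqP eqU : (U == <[x]> + U)%VS by rewrite eqEdim addvSr dle.
by move: xU; rewrite eqU memvE addvSl.
Qed.

(** Serves as membership in a span or in a sum of weight spaces, with neither a chosen family nor
    directness; when [P] is closed under scaling it describes a subspace. *)
Definition sumof (P : L -> Prop) v :=
  exists2 s : seq L, (forall w, w \in s -> P w) & v = \sum_(w <- s) w.

Lemma sumof_ind (P Q : L -> Prop) v : Q 0 -> (forall x y, Q x -> Q y -> Q (x + y)) ->
  (forall w, P w -> Q w) -> sumof P v -> Q v.
Proof.
move=> Q0 QD PQ [s sP ->]; elim: s sP => [|w s IHs] sP; first by rewrite big_nil.
rewrite big_cons; apply: QD; first by apply/PQ/sP; rewrite mem_head.
by apply: IHs => u us; apply: sP; rewrite in_cons us orbT.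
Qed.

Lemma sumof0 P : sumof P 0.
Proof. by exists [::] => //; rewrite big_nil. Qed.

Lemma sumofD P u v : sumof P u -> sumof P v -> sumof P (u + v).
Proof.
move=> [s sP ->] [t tP ->]; exists (s ++ t); last by rewrite big_cat.
by move=> w; rewrite mem_cat => /orP[/sP|/tP].
Qed.

Lemma sumof1 (P : L -> Prop) v : P v -> sumof P v.
Proof. by move=> Pv; exists [:: v] => [w|]; rewrite ?inE ?big_seq1 // => /eqP->. Qed.

Lemma sumof_bind (P Q : L -> Prop) v : (forall w, P w -> sumof Q w) -> sumof P v -> sumof Q v.
Proof. by move=> PQ; apply: sumof_ind => //; [apply: sumof0 | apply: sumofD]. Qed.

Lemma sumof_sum (P : L -> Prop) (I : Type) (r : seq I) (p : pred I) (E : I -> L) :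
  (forall i, p i -> sumof P (E i)) -> sumof P (\sum_(i <- r | p i) E i).
Proof. by move=> PE; apply: big_ind => //; [apply: sumof0 | apply: sumofD]. Qed.

Lemma sumofZ (P : L -> Prop) c v : (forall d w, P w -> P (d *: w)) -> sumof P v -> sumof P (c *: v).
Proof.
move=> PZ; apply: (@sumof_ind P (fun v => sumof P (c *: v))).
- by rewrite scaler0; apply: sumof0.
- by move=> x y hx hy; rewrite scalerDr; apply: sumofD.
- by move=> w Pw; apply/sumof1/PZ.
Qed.

Lemma sumof_vspace (P : L -> Prop) : (forall d w, P w -> P (d *: w)) ->
  exists U : {vspace L}, forall x, x \in U <-> sumof P x.
Proof.
move=> PZ; apply: vspace_of_pred; first exact: sumof0.
by move=> a x y hx hy; apply: sumofD => //; apply: sumofZ.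
Qed.

Lemma real_sum_neg (I : eqType) (s : seq I) (E : I -> F) :
  (forall i, i \in s -> E i \is Num.real) -> \sum_(i <- s) E i < 0 ->
  exists2 i, i \in s & E i < 0.
Proof.
move=> hr neg; apply: contrapT => nex.
have : 0 <= \sum_(i <- s) E i.
  rewrite big_seq; apply: sumr_ge0 => i is_.
  rewrite real_leNgt ?real0 ?hr //; apply/negP => lt0; apply: nex; by exists i.
by move=> h; move: (lt_le_trans neg h); rewrite ltxx.
Qed.

Lemma real_sum_pos (I : eqType) (s : seq I) (E : I -> F) :
  (forall i, i \in s -> E i \is Num.real) -> 0 < \sum_(i <- s) E i ->
  exists2 i, i \in s & 0 < E i.
Proof.
move=> hr pos0; have [||i is_ lt0] := @real_sum_neg _ s (fun i => - E i).
- by move=> i is_; rewrite rpredN hr.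
- by rewrite sumrN oppr_lt0.
- by exists i; rewrite // -oppr_lt0.
Qed.

Lemma free_subseq (s : seq L) : exists s' : seq L,
  [/\ free s', <<s'>>%VS = <<s>>%VS & {subset s' <= s}].
Proof.
elim: s => [|x s [s' [frs' spans' subs']]]; first by exists [::]; split; rewrite ?nil_free.
have [xs|xs] := boolP (x \in <<s'>>%VS).
  exists s'; split=> //; last by move=> y /subs'; rewrite in_cons orbC => ->.
  by rewrite span_cons -spans'; apply/esym/addv_idPr; rewrite -memvE.
exists (x :: s'); split; first by rewrite free_cons xs.
  by rewrite !span_cons spans'.
by move=> y; rewrite !in_cons => /orP[->//|/subs'->]; rewrite orbT.
Qed.

Lemma basis_of_sums (P : L -> Prop) : (forall v, sumof P v) ->
  exists N (X : N.-tuple L), basis_of fullv X /\ forall i, P (tnth X i).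
Proof.
move=> Psum.
have [s sP spans] : exists2 s : seq L, (forall w, w \in s -> P w) & <<s>>%VS = fullv.
  suff [s sP sub] : exists2 s : seq L, (forall w, w \in s -> P w)
      & (<<vbasis {:L}>> <= <<s>>)%VS.
    exists s => //; apply/eqP; rewrite eqEsubv subvf.
    by rewrite -(span_basis (vbasisP {:L})).
  elim: (tval (vbasis {:L})) => [|x t [s sP sub]]; first by exists [::]; rewrite // span_nil sub0v.
  have [s1 s1P ->] := Psum x.
  exists (s1 ++ s); first by move=> w; rewrite mem_cat => /orP[/s1P|/sP].
  rewrite span_cons span_cat addvS // -memvE.
  by rewrite big_seq; apply: memv_suml => w ws; apply: memv_span.
have [s' [frs' spans' subs']] := free_subseq s.
exists (size s'), (in_tuple s'); split; first by rewrite /basis_of spans' spans eqxx.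
by move=> i; apply/sP/subs'; rewrite (tnth_nth 0) mem_nth.
Qed.

Definition lpow f N : 'End(L) := iter N (comp_lfun f) \1%VF.

Lemma lpow0 f v : lpow f 0 v = v.
Proof. by rewrite /lpow /= id_lfunE. Qed.

Lemma lpowS f N v : lpow f N.+1 v = f (lpow f N v).
Proof. by rewrite /lpow /= comp_lfunE. Qed.

Lemma lpow_comm f g N v : (forall w, f (g w) = g (f w)) -> lpow f N (g v) = g (lpow f N v).
Proof. by move=> fg; elim: N => [|N IH]; rewrite ?lpow0 // !lpowS IH fg. Qed.

Lemma lpowSr f N v : lpow f N.+1 v = lpow f N (f v).
Proof. by rewrite lpowS lpow_comm. Qed.

Lemma lpow_add f M N v : lpow f (M + N) v = lpow f M (lpow f N v).
Proof. by elim: M => [|M IH]; rewrite ?lpow0 // addSn !lpowS IH. Qed.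

Lemma lpow_eq0 f M N v : (M <= N)%N -> lpow f M v = 0 -> lpow f N v = 0.
Proof. by move=> /subnK<- h; rewrite lpow_add h linear0. Qed.

Definition shift f a : 'End(L) := f - a *: \1%VF.

Lemma shiftE f a v : shift f a v = f v - a *: v.
Proof. by rewrite /shift add_lfunE opp_lfunE scale_lfunE id_lfunE. Qed.

Lemma shiftC f a b v : shift f a (shift f b v) = shift f b (shift f a v).
Proof.
rewrite !shiftE !linearB !linearZ /= !scalerA [b * a]mulrC.
by rewrite !addrA; congr (_ + _); rewrite addrAC.
Qed.

Definition geig f a v := exists N, lpow (shift f a) N v = 0.

Lemma geig_lin f a c x y : geig f a x -> geig f a y -> geig f a (c *: x + y).
Proof.
move=> [M hM] [N hN]; exists (M + N)%N.
by rewrite linearP /= (lpow_eq0 (leq_addr _ _) hM) (lpow_eq0 (leq_addl _ _) hN) scaler0 addr0.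
Qed.

Lemma geig0 f a : geig f a 0.
Proof. by exists 0%N; rewrite lpow0. Qed.

(** By induction on the exponent for [a], [v] is a true eigenvector, and there [shift f b] is
    multiplication by [a - b], which is never nilpotent. *)
Lemma geig_uniq f a b v : a != b -> geig f a v -> geig f b v -> v = 0.
Proof.
move=> neab [N]; elim: N v => [|N IH] v; first by rewrite lpow0.
rewrite lpowSr => hN hb.
have hw : shift f a v = 0.
  apply: IH => //; have [M hM] := hb; exists M.
  by rewrite lpow_comm ?hM ?linear0 // => w; apply: shiftC.
have fv : f v = a *: v by apply/eqP; rewrite -subr_eq0 -shiftE hw.
have [M] := hb; suff -> : lpow (shift f b) M v = (a - b) ^+ M *: v.
  by move/eqP; rewrite scaler_eq0 expf_eq0 subr_eq0 (negPf neab) andbF => /eqP.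
elim: M {hb} => [|M IHM]; first by rewrite lpow0 expr0 scale1r.
by rewrite lpowS IHM linearZ /= shiftE fv -scalerBl scalerA exprSr.
Qed.

Fixpoint kill f (s : seq F) v := if s is a :: s' then kill f s' (shift f a v) else v.

(** Cayley-Hamilton, with the characteristic polynomial split into linear factors over the closed
    field. *)
Lemma kill_all f : exists s, forall v, kill f s v = 0.
Proof.
pose e := vbasis {:L}; have eb : basis_of fullv e := vbasisP _.
pose M := mxof e e f.
have rVk s v : rVof e (kill f s v) = rVof e v *m \prod_(a <- s) (M - a%:M).
  elim: s v => [|a s IH] v /=; first by rewrite big_nil mulmx1.
  rewrite IH big_cons mulmxA; congr (_ *m _).
  rewrite mulmxBr mul_mx_scalar shiftE linearB linearZ /=; congr (_ - _).
  by rewrite /M mul_mxof // rVofK.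
suff [s hs] : exists s, \prod_(a <- s) (M - a%:M) = 0.
  by exists s => v; apply/eqP; rewrite -(rVof_eq0 eb) rVk hs mulmx0.
clear -M; clearbody M; case: (\dim fullv) M => [|n] M.
  by exists [::]; apply: flatmx0.
have [r Dr] := closed_field_poly_normal (char_poly M).
exists r; have := Cayley_Hamilton M; rewrite Dr (monicP (char_poly_monic M)) scale1r.
rewrite rmorph_prod => <-; apply: eq_bigr => a _.
by rewrite rmorphB /= horner_mx_X horner_mx_C.
Qed.

Definition stable f U := forall x, x \in U -> f x \in U.

Lemma stable_shift f a U : stable f U -> stable (shift f a) U.
Proof. by move=> fU x xU; rewrite shiftE memvB ?memvZ ?fU. Qed.

(** On generalized [b]-vectors [shift f a] is [b - a] plus a nilpotent map, hence invertible; the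
    induction on the exponent builds the preimage without leaving [U]. *)
Lemma geig_shift_onto f a b U v : stable f U -> a != b -> geig f b v -> v \in U ->
  exists u, [/\ u \in U, geig f b u & shift f a u = v].
Proof.
move=> fU neab [N]; elim: N v => [|N IH] v.
  by rewrite lpow0 => -> _; exists 0; rewrite mem0v linear0; split=> //; apply: geig0.
rewrite lpowSr => hN vU.
have [u' [u'U gu' Du']] := IH _ hN (stable_shift b fU vU).
have ba0 : b - a != 0 by rewrite subr_eq0 eq_sym.
exists ((b - a)^-1 *: (v - u')); split; first by rewrite memvZ ?memvB.
  rewrite -[_ *: _]addr0; apply: geig_lin; last exact: geig0.
  rewrite addrC -scaleN1r; apply: geig_lin => //.
  by exists N.+1; rewrite lpowSr.
apply: (scalerI ba0); rewrite linearZ /= scalerA divff // scale1r linearB /= Du'.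
by rewrite !shiftE opprB addrC addrA subrK scalerBl.
Qed.

(** Induction along a list of scalars that kills [v]. The components of [shift f a v] for
    eigenvalues other than [a] have preimages under [shift f a]; subtracting these from [v] leaves a
    generalized [a]-vector. *)
Lemma geig_decomp f U v : stable f U -> v \in U ->
  sumof (fun w => w \in U /\ exists a, geig f a w) v.
Proof.
move=> fU; have [s hs] := kill_all f; move: (hs v) => {hs}.
elim: s v => [|a s IH] v /= hv vU; first by rewrite hv; apply: sumof0.
have := IH _ hv (stable_shift a fU vU).
set w := shift f a v => hw.
suff [u1 [su1 u1U gu]] : exists u1, [/\ sumof (fun w => w \in U /\ exists a, geig f a w) u1,
    u1 \in U & geig f a (v - u1)].
  rewrite -(subrK u1 v); apply: sumofD => //; apply: sumof1.
  by rewrite memvB //; split=> //; exists a.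
suff [u1 [su1 u1U [N gu]]] : exists u1, [/\ sumof (fun w => w \in U /\ exists a, geig f a w) u1,
    u1 \in U & geig f a (w - shift f a u1)].
  exists u1; split=> //; exists N.+1; by rewrite lpowSr linearB.
clearbody w; pattern w; apply: sumof_ind hw => [|x y|x].
- by exists 0; rewrite mem0v linear0 subr0; split=> //; [apply: sumof0 | apply: geig0].
- move=> [u [su uU gu]] [u' [su' u'U gu']]; exists (u + u'); split.
  + exact: sumofD.
  + exact: memvD.
  by rewrite linearD /= opprD addrACA -[_ - shift f a u]scale1r; apply: geig_lin.
- move=> [xU [b gb]]; have [<-|neab] := eqVneq b a.
    by exists 0; rewrite mem0v linear0 subr0; split=> //; apply: sumof0.
  rewrite eq_sym in neab.
  have [u [uU gu Du]] := geig_shift_onto fU neab gb xU.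
  exists u; rewrite Du subrr; split=> //; last exact: geig0.
  by apply: sumof1; split=> //; exists b.
Qed.

Definition ltrace f : F := \tr (mxof (vbasis {:L}) (vbasis {:L}) f).

Lemma ltrace_basis N (X : N.-tuple L) f : basis_of fullv X ->
  ltrace f = \sum_i coord X i (f X`_i).
Proof.
move=> bX; pose e := vbasis {:L}; have be : basis_of fullv e := vbasisP _.
transitivity (\sum_i coord e i (f e`_i)).
  by apply: eq_bigr => i _; rewrite mxE /= mxE vecof_delta.
transitivity (\sum_(i < \dim {:L}) \sum_j coord X j (f e`_i) * coord e i X`_j).
  apply: eq_bigr => i _; rewrite {1}(coord_basis bX (memvf (f e`_i))) linear_sum /=.
  by apply: eq_bigr => j _; rewrite linearZ.
rewrite exchange_big /=; apply: eq_bigr => j _.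
rewrite [in RHS](coord_basis be (memvf X`_j)) !linear_sum /=.
by apply: eq_bigr => i _; rewrite !linearZ /= mulrC.
Qed.

Lemma ltraceC f g : ltrace (f \o g)%VF = ltrace (g \o f)%VF.
Proof.
rewrite /ltrace; have be := vbasisP {:L}; set e := vbasis _ in be *.
by rewrite (mxof_comp e e be) [in RHS](mxof_comp e e be) mxtrace_mulC.
Qed.

Lemma ltraceD f g : ltrace (f + g) = ltrace f + ltrace g.
Proof. by rewrite /ltrace !linearD. Qed.

Lemma ltraceZ a f : ltrace (a *: f) = a * ltrace f.
Proof. by rewrite /ltrace linearZ /= linearZ. Qed.

Lemma ltraceN f : ltrace (- f) = - ltrace f.
Proof. by rewrite -scaleN1r ltraceZ mulN1r. Qed.

(** Only 0 is an eigenvalue, so the characteristic polynomial is a power of X, and its second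
    coefficient, minus the trace, vanishes. *)
Lemma ltrace_nilp f : (forall v, geig f 0 v) -> ltrace f = 0.
Proof.
move=> nilf; pose e := vbasis {:L}; have be : basis_of fullv e := vbasisP _.
rewrite /ltrace; set M := mxof _ _ _.
have eigM a : eigenvalue M a -> a = 0.
  case/eigenvalueP=> u uM un0; pose v := vecof e u.
  have fv : f v = a *: v.
    apply: (can_inj (rVofK be)); rewrite linearZ /= vecofK // -uM.
    by rewrite /M mul_mxof.
  apply/eqP/negPn/negP => an0.
  have ga : geig f a v by exists 1%N; rewrite lpowS lpow0 shiftE fv subrr.
  have v0 := geig_uniq an0 ga (nilf v).
  by case/eqP: un0; rewrite -(vecofK be u) -/v v0 linear0.
clearbody M; case: (\dim fullv) M eigM => [|n] M eigM; first by rewrite flatmx0 mxtrace0.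
have [r Dr] := closed_field_poly_normal (char_poly M).
rewrite (monicP (char_poly_monic M)) scale1r in Dr.
have r0 : all (pred1 0) r.
  apply/allP => a ar; apply/eqP/eigM; rewrite eigenvalue_root_char Dr.
  by rewrite root_prod_XsubC.
have Dr' : char_poly M = 'X^(size r).
  rewrite Dr (all_pred1P _ _ r0) big_nseq subr0 size_nseq.
  by elim: (size r) => //= k ->; rewrite exprS.
have := char_poly_trace M isT; have := size_char_poly M.
rewrite Dr' size_polyXn => -[->]; rewrite coefXn /=.
by rewrite ltn_eqF // => /eqP; rewrite eq_sym oppr_eq0 => /eqP.
Qed.

Lemma geig_sqr f a v : geig f a v -> geig (f \o f)%VF (a ^+ 2) v.
Proof.
move=> [N hN]; exists N.
suff -> : lpow (shift (f \o f)%VF (a ^+ 2)) N v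
    = lpow (shift f (- a)) N (lpow (shift f a) N v) by rewrite hN linear0.
elim: N v {hN} => [|N IH] v; first by rewrite !lpow0.
rewrite !lpowSr -lpow_comm; last by move=> w; apply: shiftC.
rewrite IH; congr (lpow _ _ (lpow _ _ _)).
rewrite !shiftE comp_lfunE scaleNr opprK scalerBr scalerA expr2.
by rewrite [f (_ - _)]linearB /= [f (a *: v)]linearZ /= addrA subrK.
Qed.

Lemma big_filter_coord N (X : N.-tuple L) (P : pred 'I_N) v : basis_of fullv X ->
  (forall i, ~~ P i -> coord X i v = 0) -> \sum_(i | P i) coord X i v *: X`_i = v.
Proof.
move=> bX hv; rewrite [RHS](coord_basis bX (memvf v)) [RHS](bigID P) /=.
by rewrite [X in _ + X]big1 ?addr0 // => i nPi; rewrite hv // scale0r.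
Qed.

(** Both maps preserve the span of the basis vectors selected by [P], so these partial sums are
    traces of products of restrictions, where the order of the factors is irrelevant. *)
Lemma ptr_comm N (X : N.-tuple L) (P : pred 'I_N) f g : basis_of fullv X ->
  (forall i j, P i -> ~~ P j -> coord X j (f X`_i) = 0) ->
  (forall i j, P i -> ~~ P j -> coord X j (g X`_i) = 0) ->
  \sum_(i | P i) coord X i (f (g X`_i)) = \sum_(i | P i) coord X i (g (f X`_i)).
Proof.
move=> bX hf hg.
have expand (f1 g1 : 'End(L)) : (forall i j, P i -> ~~ P j -> coord X j (g1 X`_i) = 0) ->
    \sum_(i | P i) coord X i (f1 (g1 X`_i)) =
    \sum_(i | P i) \sum_(j | P j) coord X j (g1 X`_i) * coord X i (f1 X`_j).
  move=> h1; apply: eq_bigr => i Pi.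
  rewrite -{1}(big_filter_coord bX (fun j => h1 i j Pi)) !linear_sum /=.
  by apply: eq_bigr => j _; rewrite !linearZ.
rewrite !expand // exchange_big /=; apply: eq_bigr => i _; apply: eq_bigr => j _.
by rewrite mulrC.
Qed.

Definition ldiag N (X : N.-tuple L) (d : 'I_N -> F) : 'End(L) :=
  linfun (fun v => \sum_i (d i * coord X i v) *: X`_i).

Lemma ldiagE N (X : N.-tuple L) d v :
  ldiag X d v = \sum_i (d i * coord X i v) *: X`_i.
Proof.
have lin : linear (fun v => \sum_i (d i * coord X i v) *: X`_i).
  move=> a x y; rewrite scaler_sumr -big_split /=; apply: eq_bigr => i _.
  by rewrite linearP /= mulrDr scalerDl scalerA mulrCA.
pose h : {linear L -> L} :=
  HB.pack (fun v => \sum_i (d i * coord X i v) *: X`_i) (GRing.isLinear.Build _ _ _ _ _ lin).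
exact: (lfunE h).
Qed.

Lemma ldiag_basis N (X : N.-tuple L) d (i : 'I_N) : basis_of fullv X ->
  ldiag X d X`_i = d i *: X`_i.
Proof.
move=> bX; rewrite ldiagE (bigD1 i) //= coord_free ?(basis_free bX) // eqxx mulr1.
rewrite big1 ?addr0 // => j ji.
by rewrite coord_free ?(basis_free bX) // eq_sym (negPf ji) mulr0 scale0r.
Qed.

Section Weights.

Variables (K : Type) (T : K -> 'End(L)).
Implicit Types (al be : K -> F).

(** Weights are arbitrary functions on the index type here; their linearity is deduced from traces
    in [al_linear]. *)
Definition gw al v := forall k, geig (T k) (al k) v.

Hypothesis Tgw : forall k al v, gw al v -> gw al (T k v).

Lemma gw0 al : gw al 0. Proof. by move=> k; apply: geig0. Qed.

Lemma gw_lin al c x y : gw al x -> gw al y -> gw al (c *: x + y).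
Proof. by move=> hx hy k; apply: geig_lin. Qed.

Lemma gwD al x y : gw al x -> gw al y -> gw al (x + y).
Proof. by move=> hx hy; rewrite -[x]scale1r; apply: gw_lin. Qed.

Lemma gwZ al c x : gw al x -> gw al (c *: x).
Proof. by move=> hx; rewrite -[_ *: x]addr0; apply: gw_lin => //; apply: gw0. Qed.

Lemma gw_sum al (I : Type) (r : seq I) (P : pred I) (E : I -> L) :
  (forall i, P i -> gw al (E i)) -> gw al (\sum_(i <- r | P i) E i).
Proof. by move=> hE; apply: big_ind => //; [apply: gw0 | apply: gwD]. Qed.

Lemma gw_lpow al k b N v : gw al v -> gw al (lpow (shift (T k) b) N v).
Proof.
move=> hv; elim: N => [|N IH]; first by rewrite lpow0.
by rewrite lpowS shiftE -scaleNr addrC; apply: gw_lin => //; apply: Tgw.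
Qed.

(** A power of a shift at an index where the weights differ kills the first summand and is injective
    on weight [al]. It changes the other summands, so the induction runs over a list with a varying
    map [E]. *)
Lemma gw_indep al u (s : seq L) : gw al u -> u = \sum_(w <- s) w ->
  (forall w, w \in s -> exists2 be, gw be w & be <> al) -> u = 0.
Proof.
suff H (r : seq L) (E : L -> L) u0 : gw al u0 -> u0 = \sum_(w <- r) E w ->
   (forall w, w \in r -> exists2 be, gw be (E w) & be <> al) -> u0 = 0.
  by move=> h1 h2 h3; apply: (H s id).
elim: r E u0 => [|w r IH] E u0 hu; first by rewrite big_nil.
rewrite big_cons => Du hs.
have [be hbe nebe] := hs w (mem_head _ _).
have [k nek] : exists k, al k != be k.
  apply: contrapT => nex; apply: nebe; apply: funext => k; apply/eqP.
  by apply/negPn/negP => nk; apply: nex; exists k; rewrite eq_sym.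
have [N hN] := hbe k.
suff gu : lpow (shift (T k) (be k)) N u0 = 0 by apply: (geig_uniq nek (hu k)); exists N.
apply: (IH (fun w => lpow (shift (T k) (be k)) N (E w))).
- exact: gw_lpow.
- by rewrite Du linearD /= hN add0r linear_sum.
move=> w' w'r; have [|ga hga nega] := hs w'; first by rewrite in_cons w'r orbT.
by exists ga => //; apply: gw_lpow.
Qed.

Variables (N : nat) (X : N.-tuple L) (al : 'I_N -> K -> F).
Hypothesis bX : basis_of fullv X.
Hypothesis gwX : forall i, gw (al i) X`_i.

Lemma gw_coord be v i : gw be v -> coord X i v != 0 -> al i = be.
Proof.
move=> hv cn0; apply: contrapT => nei.
pose P j := `[< al j = be >].
have v1 : gw be (\sum_(j | P j) coord X j v *: X`_j).
  by apply: gw_sum => j /asboolP<-; apply: gwZ; apply: gwX.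
pose u := \sum_(j | ~~ P j) coord X j v *: X`_j.
have Du : u = v - \sum_(j | P j) coord X j v *: X`_j.
  apply/eqP; rewrite eq_sym subr_eq addrC [X in X == _](coord_basis bX (memvf v)).
  by rewrite (bigID P).
have gu : gw be u by rewrite Du -scaleN1r addrC; apply: gw_lin.
have u0 : u = 0.
  apply: (@gw_indep be u [seq coord X j v *: X`_j | j <- enum [pred j | ~~ P j]]) => //.
    by rewrite big_map big_enum.
  move=> w /mapP[j]; rewrite mem_enum inE => /asboolP nPj ->.
  by exists (al j) => //; apply: gwZ; apply: gwX.
have := congr1 (coord X i) u0; rewrite linear0 /u.
rewrite big_mkcond /= (eq_bigr (fun j => (if ~~ P j then coord X j v else 0) *: X`_j)); last first.
  by move=> j _; case: ifP => //; rewrite scale0r.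
rewrite coord_sum_free ?(basis_free bX) //; case: ifP => [_ /eqP|/negbFE/asboolP//].
by rewrite (negPf cn0).
Qed.

(** On each weight space [f] has the single generalized eigenvalue [c be], so [f] restricted to the
    selected weight spaces minus the corresponding diagonal map is nilpotent and has trace 0. The
    last hypothesis makes the selection a union of whole weight spaces. *)
Lemma ptr_geig (P : pred 'I_N) f (c : (K -> F) -> F) :
  (forall be v, gw be v -> gw be (f v)) ->
  (forall be v, gw be v -> geig f (c be) v) ->
  (forall i j, al i = al j -> P i -> P j) ->
  \sum_(i | P i) coord X i (f X`_i) = \sum_(i | P i) c (al i).
Proof.
move=> fgw fgeig Psat.
pose D := ldiag X.
have Deig d be v : gw be v -> (forall i j, al i = al j -> d i = d j) ->
    forall i, al i = be -> D d v = d i *: v.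
  move=> hv dsat i ali; rewrite /D ldiagE [in RHS](coord_basis bX (memvf v)) scaler_sumr.
  apply: eq_bigr => j _; rewrite scalerA.
  have [->|cn0] := eqVneq (coord X j v) 0; first by rewrite !mulr0.
  by rewrite (dsat j i) // (gw_coord hv cn0).
pose pi i : F := (P i)%:R.
have pisat i j : al i = al j -> pi i = pi j.
  move=> aij; rewrite /pi; suff -> : P i = P j by [].
  by apply/idP/idP; apply: Psat.
pose g := (f \o D pi)%VF - D (fun i => pi i * c (al i)).
have gE v : g v = f (D pi v) - D (fun i => pi i * c (al i)) v.
  by rewrite /g add_lfunE opp_lfunE comp_lfunE.
have gval i v : gw (al i) v -> g v = pi i *: shift f (c (al i)) v.
  move=> hv; rewrite gE (Deig _ _ _ hv pisat i) // (Deig _ _ _ hv _ i) //; last first.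
    by move=> j k ajk; rewrite (pisat _ _ ajk) ajk.
  by rewrite linearZ /= shiftE scalerBr scalerA.
have : ltrace g = 0.
  apply: ltrace_nilp => v; rewrite (coord_basis bX (memvf v)).
  apply: big_ind => [|x y hx hy|i _]; first exact: geig0.
    by rewrite -[x]scale1r; apply: geig_lin.
  rewrite -[_ *: _]addr0; apply: geig_lin; last exact: geig0.
  have sh0 w : shift g 0 w = g w by rewrite shiftE scale0r subr0.
  have [M hM] := fgeig _ _ (gwX i).
  have [Pi|nPi] := boolP (P i); last first.
    by exists 1%N; rewrite lpowS lpow0 sh0 (gval _ _ (gwX i)) /pi (negPf nPi) scale0r.
  exists M; suff -> : lpow (shift g 0) M X`_i = lpow (shift f (c (al i))) M X`_i by [].
  elim: M {hM} => [|M IH]; first by rewrite !lpow0.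
  rewrite !lpowS IH sh0 (gval i); first by rewrite /pi Pi scale1r.
  elim: M {IH} => [|M IH]; first by rewrite lpow0.
  by rewrite lpowS shiftE -scaleNr addrC; apply: gw_lin => //; apply: fgw.
rewrite (ltrace_basis _ bX) => /eqP.
rewrite (eq_bigr (fun i => pi i * coord X i (f X`_i) - pi i * c (al i))); last first.
  move=> i _; rewrite gE /D !ldiag_basis // linearB !linearZ /=.
  by rewrite coord_free ?(basis_free bX) // eqxx mulr1.
rewrite sumrB subr_eq0 => /eqP.
rewrite [LHS](bigID P) [in X in _ = X -> _](bigID P) /=.
rewrite !(big1 _ (fun i => ~~ P i)) ?addr0; last 2 first.
- by move=> i nPi; rewrite /pi (negPf nPi) mul0r.
- by move=> i nPi; rewrite /pi (negPf nPi) mul0r.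
have pi1 i : P i -> pi i = 1 by rewrite /pi => ->.
move=> h; transitivity (\sum_(i | P i) pi i * coord X i (f X`_i)).
  by apply: eq_bigr => i Pi; rewrite pi1 ?mul1r.
by rewrite h; apply: eq_bigr => i Pi; rewrite pi1 ?mul1r.
Qed.

End Weights.

End LinearAlgebra.

(** * The bracket, the Killing form and nilpotent subalgebras *)

Section LieBasics.

Variables (F : numClosedFieldType) (L : vectType F) (br : L -> L -> L).
Hypothesis lieP : is_lie_bracket br.
Implicit Types (x y z u v w : L) (U V : {vspace L}).

Lemma br_linl a x y z : br (a *: x + y) z = a *: br x z + br y z.
Proof. by case: lieP. Qed.

Lemma br_linr a x y z : br z (a *: x + y) = a *: br z x + br z y.
Proof. by case: lieP. Qed.

Lemma br_xx x : br x x = 0. Proof. by case: lieP. Qed.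

Lemma brDl x y z : br (x + y) z = br x z + br y z.
Proof. by have := br_linl 1 x y z; rewrite !scale1r. Qed.

Lemma brDr x y z : br z (x + y) = br z x + br z y.
Proof. by have := br_linr 1 x y z; rewrite !scale1r. Qed.

Lemma br0l z : br 0 z = 0.
Proof. by have := br_linl (-1) z z z; rewrite !scaleN1r !addNr. Qed.

Lemma br0r z : br z 0 = 0.
Proof. by have := br_linr (-1) z z z; rewrite !scaleN1r !addNr. Qed.

Lemma brZl a x z : br (a *: x) z = a *: br x z.
Proof. by have := br_linl a x 0 z; rewrite br0l !addr0. Qed.

Lemma brZr a x z : br z (a *: x) = a *: br z x.
Proof. by have := br_linr a x 0 z; rewrite br0r !addr0. Qed.

Lemma brNl x z : br (- x) z = - br x z.
Proof. by rewrite -scaleN1r brZl scaleN1r. Qed.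

Lemma brNr x z : br z (- x) = - br z x.
Proof. by rewrite -scaleN1r brZr scaleN1r. Qed.

Lemma brBl x y z : br (x - y) z = br x z - br y z.
Proof. by rewrite brDl brNl. Qed.

Lemma brBr x y z : br z (x - y) = br z x - br z y.
Proof. by rewrite brDr brNr. Qed.

Lemma br_suml (I : Type) (r : seq I) (P : pred I) (E : I -> L) z :
  br (\sum_(i <- r | P i) E i) z = \sum_(i <- r | P i) br (E i) z.
Proof. by apply: (big_morph (br^~ z)) => [x y|]; rewrite ?brDl ?br0l. Qed.

Lemma br_sumr (I : Type) (r : seq I) (P : pred I) (E : I -> L) z :
  br z (\sum_(i <- r | P i) E i) = \sum_(i <- r | P i) br z (E i).
Proof. by apply: (big_morph (br z)) => [x y|]; rewrite ?brDr ?br0r. Qed.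

Lemma brC x y : br x y = - br y x.
Proof.
apply/eqP; rewrite -addr_eq0; have := br_xx (x + y).
by rewrite brDl !brDr !br_xx add0r addr0 => ->.
Qed.

Lemma jacobi x y z : br x (br y z) = br (br x y) z + br y (br x z).
Proof.
case: lieP => _ _ _ /(_ x y z) /eqP.
rewrite -addrA addr_eq0 => /eqP->.
by rewrite [br z x]brC brNr opprD opprK [br z _]brC opprK addrC.
Qed.

Definition ad x : 'End(L) := linfun (br x).

Lemma adE x y : ad x y = br x y.
Proof.
pose h : {linear L -> L} :=
  HB.pack (br x) (GRing.isLinear.Build _ _ _ _ (br x) (fun a u v => br_linr a u v x)).
exact: (lfunE h).
Qed.

Lemma ad_br x y : ad (br x y) = (ad x \o ad y)%VF - (ad y \o ad x)%VF.
Proof.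
apply/lfunP => z; rewrite add_lfunE opp_lfunE !comp_lfunE !adE.
by rewrite jacobi addrK.
Qed.

Lemma ad_lin a x y : ad (a *: x + y) = a *: ad x + ad y.
Proof. by apply/lfunP => z; rewrite add_lfunE scale_lfunE !adE br_linl. Qed.

Definition killing x y := ltrace (ad x \o ad y)%VF.

Lemma killingC x y : killing x y = killing y x.
Proof. exact: ltraceC. Qed.

Lemma killing_linl a x y z : killing (a *: x + y) z = a * killing x z + killing y z.
Proof. by rewrite /killing ad_lin comp_lfunDl ltraceD -comp_lfunZl ltraceZ. Qed.

Lemma killing_linr a x y z : killing z (a *: x + y) = a * killing z x + killing z y.
Proof. by rewrite ![killing z _]killingC killing_linl. Qed.

Lemma killingDl x y z : killing (x + y) z = killing x z + killing y z.
Proof. by have := killing_linl 1 x y z; rewrite scale1r mul1r. Qed.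

Lemma killing0l z : killing 0 z = 0.
Proof. by have := killing_linl (-1) z z z; rewrite scaleN1r mulN1r !addNr. Qed.

Lemma killingZl a x z : killing (a *: x) z = a * killing x z.
Proof. by have := killing_linl a x 0 z; rewrite killing0l !addr0. Qed.

Lemma killingNl x z : killing (- x) z = - killing x z.
Proof. by rewrite -scaleN1r killingZl mulN1r. Qed.

Lemma killingBl x y z : killing (x - y) z = killing x z - killing y z.
Proof. by rewrite killingDl killingNl. Qed.

Lemma killingDr x y z : killing z (x + y) = killing z x + killing z y.
Proof. by rewrite ![killing z _]killingC killingDl. Qed.

Lemma killingZr a x z : killing z (a *: x) = a * killing z x.
Proof. by rewrite ![killing z _]killingC killingZl. Qed.

Lemma killing_suml (I : Type) (r : seq I) (P : pred I) (E : I -> L) z :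
  killing (\sum_(i <- r | P i) E i) z = \sum_(i <- r | P i) killing (E i) z.
Proof. by apply: (big_morph (killing^~ z)) => [x y|]; rewrite ?killingDl ?killing0l. Qed.

Lemma killing_sumr (I : Type) (r : seq I) (P : pred I) (E : I -> L) z :
  killing z (\sum_(i <- r | P i) E i) = \sum_(i <- r | P i) killing z (E i).
Proof. by rewrite killingC killing_suml; apply: eq_bigr => i _; rewrite killingC. Qed.

Lemma killing_inv x y z : killing (br x y) z = killing x (br y z).
Proof.
rewrite /killing !ad_br comp_lfunDl comp_lfunDr comp_lfunNl comp_lfunNr.
by rewrite !ltraceD !ltraceN -!comp_lfunA [ltrace (ad y \o _)%VF]ltraceC -!comp_lfunA.
Qed.

Lemma killing_central x : (forall y, br x y = 0) -> forall y, killing x y = 0.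
Proof.
move=> hx y; have -> : killing x y = killing (0 *: x) y; last by rewrite killingZl mul0r.
by rewrite /killing; congr (ltrace (_ \o _)%VF); apply/lfunP => z; rewrite !adE hx brZl hx scaler0.
Qed.

(** By the Leibniz rule the shift by [a + b] of a bracket spreads over the two factors; the
    induction is on a bound for the sum of both exponents. *)
Lemma geig_br x a b u v : geig (ad x) a u -> geig (ad x) b v -> geig (ad x) (a + b) (br u v).
Proof.
move=> [M hM] [N hN]; exists (M + N)%N; move: hM hN.
move: {2}(M + N)%N (leqnn (M + N)) => s; elim: s M N u v => [|s IH] M N u v.
  by rewrite leqn0 addn_eq0 => /andP[/eqP-> /eqP->]; rewrite !lpow0 => -> _; rewrite br0l.
have D w1 w2 : shift (ad x) (a + b) (br w1 w2)
    = br (shift (ad x) a w1) w2 + br w1 (shift (ad x) b w2).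
  rewrite !shiftE !adE brBl brBr brZl brZr scalerDl jacobi opprD addrACA.
  by [].
case: M => [|M]; first by move=> _; rewrite lpow0 => -> _; rewrite br0l linear0.
case: N => [|N]; first by move=> _ _; rewrite lpow0 => ->; rewrite br0r linear0.
rewrite addSn addnS ltnS => les hM hN.
have h1 := IH M N.+1 (shift (ad x) a u) v; rewrite addnS in h1.
have h2 := IH M.+1 N u (shift (ad x) b v).
rewrite addSn in h2; rewrite lpowSr D linearD /= h1 ?h2 ?addr0 // -?lpowSr //.
Qed.

Section Nilpotent.

Variables (H : {vspace L}) (m : nat).
Hypothesis nilH : ad_nilpotent_of br m H.
Hypothesis subH : subalg br H.

Local Notation K := (subvs_of H).
Definition adH (k : K) := ad (vsval k).
Local Notation gwH := (gw adH).
Implicit Types (al be : K -> F) (k : K).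

Lemma gwH_self y : y \in H -> gwH (fun=> 0) y.
Proof.
move=> yH k; exists m.
have -> : lpow (shift (adH k) 0) m y = itbr br (nseq m (vsval k)) y.
  elim: (m) => [|n IH]; first by rewrite lpow0.
  by rewrite lpowS IH shiftE scale0r subr0 /= adE.
by apply: nilH; rewrite ?size_nseq //; apply/allP => z /nseqP[-> _]; apply: subvsP.
Qed.

Lemma gwH_br al be u v : gwH al u -> gwH be v -> gwH (fun k => al k + be k) (br u v).
Proof. by move=> hu hv k; exact: geig_br (hu k) (hv k). Qed.

Lemma gwH_stable k al v : gwH al v -> gwH al (adH k v).
Proof.
move=> hv; rewrite /adH adE.
have := gwH_br (gwH_self (subvsP k)) hv.
by congr gw; apply: funext => k'; rewrite add0r.
Qed.

(** Induction on the dimension: unless every [adH k] has one eigenvalue on [V], some [k] splits [V]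
    properly. The pieces stay stable under all of [H], because nilpotency puts [H] itself in weight
    0. *)
Lemma gwH_decomp V v : (forall k, stable (adH k) V) -> v \in V ->
  sumof (fun w => w \in V /\ exists al, gwH al w) v.
Proof.
move: {2}(\dim V) (leqnn (\dim V)) => d; elim: d V v => [|d IH] V v.
  rewrite leqn0 dimv_eq0 => /eqP-> _; rewrite memv0 => /eqP->; exact: sumof0.
move=> dV stV vV.
have [[al hal]|nex] := pselect (exists al, forall k w, w \in V -> geig (adH k) (al k) w).
  by apply: sumof1; split=> //; exists al => k; apply: hal.
have [k hk] : exists k, forall a, exists2 w, w \in V & ~ geig (adH k) a w.
  apply: contrapT => nk; apply: nex.
  suff /choice[al hal] : forall k, exists a, forall w, w \in V -> geig (adH k) a w by exists al.
  move=> k; apply: contrapT => na; apply: nk; exists k => a.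
  apply: contrapT => nw; apply: na; exists a => w wV.
  by apply: contrapT => ng; apply: nw; exists w.
apply: sumof_bind (geig_decomp (stV k) vV) => w [wV [a ga]].
have [|b x y [xV hx] [yV hy]|U hU] := @vspace_of_pred _ _ (fun w => w \in V /\ geig (adH k) a w).
- by split; [apply: mem0v | apply: geig0].
- by split; [rewrite memvD ?memvZ | apply: geig_lin].
have sUV : (U <= V)%VS by apply/subvP => x /hU[].
have dU : (\dim U <= d)%N.
  rewrite -ltnS (leq_trans _ dV) // ltn_neqAle dimvS // andbT.
  apply/negP => /eqP dUV; have [z zV nz] := hk a; apply: nz.
  suff /hU[] : z \in U by [].
  by have /eqP-> : U == V by rewrite eqEdim sUV dUV leqnn.
have stU k' : stable (adH k') U.
  move=> x /hU[xV gx]; apply/hU; split; first exact: stV.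
  rewrite {1}/adH adE -[a]add0r.
  exact: geig_br (gwH_self (subvsP k') k) gx.
apply: sumof_bind (IH U w dU stU _) => [z [zU gz]|]; last exact/hU.
by apply: sumof1; split=> //; apply: (subvP sUV).
Qed.

Lemma gwH_basis : exists N (X : N.-tuple L) (al : 'I_N -> K -> F),
  basis_of fullv X /\ forall i, gwH (al i) X`_i.
Proof.
have [|N [X [bX hX]]] := @basis_of_sums _ _ (fun w => exists al, gwH al w).
  move=> v; apply: sumof_bind (gwH_decomp _ (memvf v)) => [w [_ hw]|k x _]; first exact: sumof1.
  exact: memvf.
have /choice[al hal] : forall i : 'I_N, exists al, gwH al X`_i.
  by move=> i; have := hX i; rewrite (tnth_nth 0).
by exists N, X, al.
Qed.

(* The ideals K of H for which some w outside H satisfies [K, w] <= H can be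
   enlarged one dimension at a time along the lower central series of H. *)
Lemma gwH_null : (forall x, (forall y, y \in H -> br x y \in H) -> x \in H) ->
  forall v, gwH (fun=> 0) v -> v \in H.
Proof.
move=> norm v hv; apply: contrapT => vnH.
pose W (K : {vspace L}) w := gwH (fun=> 0) w /\ forall x, x \in K -> br x w \in H.
pose good (K : {vspace L}) := [/\ (K <= H)%VS, ad_stable br H K & exists2 w, W K w & w \notin H].
pose Q d := `[< exists K, good K /\ \dim K = d >].
have exQ : exists d, Q d.
  exists 0%N; apply/asboolP; exists 0%VS; split; last exact: dimv0.
  split; first exact: sub0v.
    by move=> x y _; rewrite !memv0 => /eqP->; rewrite br0r.
  exists v; last exact/negP.
  by split=> // x; rewrite memv0 => /eqP->; rewrite br0l mem0v.
have ubQ d : Q d -> (d <= \dim H)%N by move/asboolP=> [K [[KH _ _] <-]]; apply: dimvS.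
have [d /asboolP[K [[KH stK [w [gw0w Kw] wnH]] dK]] maxK] := ex_maxnP exQ ubQ.
have [HK|/subvPn[y0 y0H y0K]] := boolP (H <= K)%VS.
  case/negP: wnH; apply: norm => y yH.
  by rewrite brC memvN; apply/Kw/(subvP HK).
(* Otherwise brackets with elements of [H] starting from [y0] could be continued outside [K] to any
   length, against nilpotency. *)
have [x [xH xK Hx]] : exists x, [/\ x \in H, x \notin K & forall y, y \in H -> br y x \in K].
  apply: contrapT => nx.
  have step z : z \in H -> z \notin K -> exists2 y, y \in H & br y z \notin K.
    move=> zH zK; apply: contrapT => ny; apply: nx; exists z; split=> // y yH.
    by apply/negPn/negP => h; apply: ny; exists y.
  have chain n : exists xs, [/\ size xs = n, all (fun x => x \in H) xs & itbr br xs y0 \notin K].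
    suff [xs [? ? ? _]] : exists xs, [/\ size xs = n, all (fun x => x \in H) xs,
        itbr br xs y0 \notin K & itbr br xs y0 \in H] by exists xs.
    elim: n => [|n [xs [sz xsH nK inH]]]; first by exists [::].
    have [y yH yK] := step _ inH nK.
    by exists (y :: xs); split=> //=; rewrite ?sz ?yH // subH.
  have [xs [sz xsH]] := chain m.
  by rewrite (nilH sz xsH y0H) mem0v.
(* push w with ad x until the next step falls into H *)
have gx : geig (ad x) 0 w by have := gw0w (vsproj H x); rewrite /adH vsprojK.
have WK_st u : W K u -> W K (br x u).
  move=> [gu Ku]; split.
    by have := gwH_stable (vsproj H x) gu; rewrite /adH vsprojK // adE.
  move=> z zK; rewrite jacobi memvD //.
    by apply: Ku; rewrite brC memvN; apply: stK.
  by apply: subH => //; apply: Ku.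
have [w' [Ww' w'nH xw']] : exists w', [/\ W K w', w' \notin H & br x w' \in H].
  have [n] := gx; have : W K w by [].
  elim: n w wnH {gw0w Kw gx} => [|n IH] u unH Wu; first by rewrite lpow0 => u0; rewrite u0 mem0v in unH.
  rewrite lpowSr shiftE scale0r subr0 adE => hu.
  have [xuH|xunH] := boolP (br x u \in H); first by exists u.
  by apply: IH xunH _ hu; apply: WK_st.
have /maxK : Q (\dim (<[x]> + K)%VS).
  apply/asboolP; exists (<[x]> + K)%VS; split=> //; split.
  - by rewrite subv_add -memvE xH KH.
  - move=> y z yH /memv_addP[_ /vlineP[c ->] [z' z'K ->]].
    rewrite brDr brZr; apply: (subvP (addvSr _ _)).
    by rewrite memvD ?memvZ ?Hx ?stK.
  exists w' => //; case: Ww' => g' K'; split=> // z /memv_addP[_ /vlineP[c ->] [z' z'K ->]].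
  by rewrite brDl brZl memvD ?memvZ // K'.
rewrite -dK leqNgt => /negP; apply.
rewrite ltnNge; apply/negP => dle.
have /eqP eqK : (K == <[x]> + K)%VS by rewrite eqEdim addvSr dle.
by move: xK; rewrite eqK memvE addvSl.
Qed.

Variables (N : nat) (X : N.-tuple L) (al : 'I_N -> K -> F).
Hypothesis bX : basis_of fullv X.
Hypothesis gwX : forall i, gwH (al i) X`_i.

Lemma gwH_coord be v i : gwH be v -> coord X i v != 0 -> al i = be.
Proof. exact: (gw_coord gwH_stable bX gwX). Qed.

Lemma gwH_coord0 be v i : gwH be v -> al i <> be -> coord X i v = 0.
Proof.
by move=> hv nei; apply/eqP/negPn/negP => cn0; apply: nei; apply: gwH_coord cn0.
Qed.

Lemma ptr_adH (P : pred 'I_N) k : (forall i j, al i = al j -> P i -> P j) ->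
  \sum_(i | P i) coord X i (br (vsval k) X`_i) = \sum_(i | P i) al i k.
Proof.
move=> Psat.
under eq_bigr => i _ do rewrite -adE.
apply: (ptr_geig gwH_stable bX gwX (f := ad (vsval k)) (c := fun be => be k)) => //.
  by move=> be v hv; apply: gwH_stable.
by move=> be v; apply.
Qed.

Lemma killing_gwH al' be u v : gwH al' u -> gwH be v ->
  (exists k, al' k + be k != 0) -> killing u v = 0.
Proof.
move=> hu hv [k kn0]; rewrite /killing (ltrace_basis _ bX) big1 // => i _.
rewrite comp_lfunE !adE (gwH_coord0 (gwH_br hu (gwH_br hv (gwX i)))) //.
move=> /(congr1 (fun g => g k)) /eqP; rewrite addrA -subr_eq0 opprD addrCA subrr addr0 oppr_eq0.
by rewrite (negPf kn0).
Qed.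

(** The trace of [ad k] on a weight space is the weight at [k] times the dimension, and the trace is
    linear in [k]. *)
Lemma al_linear i c k k' : al i (c *: k + k') = c * al i k + al i k'.
Proof.
pose P j := `[< al j = al i >].
have Psat j1 j2 : al j1 = al j2 -> P j1 -> P j2.
  by move=> e12 /asboolP e1; apply/asboolP; rewrite -e12.
have Psum k0 : \sum_(j | P j) coord X j (br (vsval k0) X`_j) = #|P|%:R * al i k0.
  rewrite ptr_adH // (eq_bigr (fun=> al i k0)) => [|j /asboolP->//].
  by rewrite big_const iter_addr_0 mulr_natl.
have cn0 : #|P|%:R != 0 :> F.
  by rewrite pnatr_eq0 -lt0n; apply/card_gt0P; exists i; apply/asboolP.
apply: (mulfI cn0); rewrite -Psum mulrDr mulrCA -!Psum big_distrr -big_split /=.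
by apply: eq_bigr => j _; rewrite br_linl linearP.
Qed.

(** While [H] is not known to be abelian only the squares of the [ad k] have evident generalized
    eigenvalues; polarization gives the mixed products. *)
Lemma killing_diag k k' : killing (vsval k) (vsval k') = \sum_i al i k * al i k'.
Proof.
have sq k0 : killing (vsval k0) (vsval k0) = \sum_i al i k0 ^+ 2.
  rewrite /killing (ltrace_basis _ bX).
  apply: (ptr_geig gwH_stable bX gwX (P := xpredT) (f := (ad (vsval k0) \o ad (vsval k0))%VF)
    (c := fun be => be k0 ^+ 2)) => //.
    by move=> be v hv; rewrite comp_lfunE; apply/(gwH_stable k0)/(gwH_stable k0).
  by move=> be v hv; apply/geig_sqr/hv.
have alD i : al i (k + k') = al i k + al i k'.
  by have := al_linear i 1 k k'; rewrite scale1r mul1r.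
have E : \sum_i al i (k + k') ^+ 2
    = \sum_i al i k ^+ 2 + (\sum_i al i k * al i k') *+ 2 + \sum_i al i k' ^+ 2.
  by rewrite -sumrMnl -!big_split /=; apply: eq_bigr => i _; rewrite alD sqrrD.
have := sq (k + k'); rewrite E.
rewrite linearD /= !killingDl !killingDr !sq [killing (vsval k') _]killingC.
set A := killing _ _; set S := \sum_i al i k * al i k' => h.
have two : 2%:R != 0 :> F by rewrite pnatr_eq0.
apply: (mulfI two); set a := \sum_i al i k ^+ 2 in h; set b := \sum_i al i k' ^+ 2 in h.
transitivity (a + A + (A + b) - a - b); first by ring.
by rewrite h; ring.
Qed.

(* The trace of [e,f] vanishes on each alpha-string, so every weight is a
   rational multiple of alpha at [e,f]. *)
Lemma string_real (a : K -> F) e f k : gwH a e -> gwH (fun k => - a k) f ->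
  br e f = vsval k -> forall i, exists2 r, r \is Num.real & al i k = r * a k.
Proof.
move=> ga gf Dk i.
pose S j (z : int) := al j = (fun k => al i k + z%:~R * a k).
pose P j := `[< exists z : int, S j z >].
have Psat j1 j2 : al j1 = al j2 -> P j1 -> P j2.
  by move=> e12 /asboolP[z e1]; apply/asboolP; exists z; rewrite /S -e12.
have Pe j1 j2 : P j1 -> ~~ P j2 -> coord X j2 (ad e X`_j1) = 0.
  move=> /asboolP[z Dz] /asboolP nP; rewrite adE; apply: (gwH_coord0 (gwH_br ga (gwX j1))) => Dj.
  apply: nP; exists (z + 1); rewrite /S Dj Dz; apply: funext => k'.
  by ring.
have Pf j1 j2 : P j1 -> ~~ P j2 -> coord X j2 (ad f X`_j1) = 0.
  move=> /asboolP[z Dz] /asboolP nP; rewrite adE; apply: (gwH_coord0 (gwH_br gf (gwX j1))) => Dj.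
  apply: nP; exists (z - 1); rewrite /S Dj Dz; apply: funext => k'.
  by ring.
have sum0 : \sum_(j | P j) al j k = 0.
  rewrite -ptr_adH // -Dk.
  under eq_bigr => j _ do rewrite -adE ad_br add_lfunE opp_lfunE !comp_lfunE linearB /=.
  by rewrite sumrB (ptr_comm bX Pe Pf) subrr.
have /choice[z hz] : forall j, exists z : int, P j -> S j z.
  by move=> j; case: (asboolP (exists z : int, S j z)) => [[z hz]|nP]; [exists z | exists 0 => /asboolP].
have Pi : P i by apply/asboolP; exists 0; apply: funext => k'; rewrite mul0r addr0.
have cn0 : #|P|%:R != 0 :> F.
  by rewrite pnatr_eq0 -lt0n; apply/card_gt0P; exists i.
(* The vanishing trace is solved for [al i k]: the ratio is minus the mean of the integers [z j]
   over the string. *)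
exists (- (\sum_(j | P j) (z j)%:~R) / #|P|%:R).
  rewrite rpredM ?rpredN ?rpred_sum //; first by move=> j _; rewrite realz.
  by rewrite rpredV realn.
apply: (mulfI cn0); rewrite mulrA mulrCA divff // mulr1 mulNr.
have : \sum_(j | P j) (al i k + (z j)%:~R * a k) = 0.
  by rewrite -[RHS]sum0; apply: eq_bigr => j /hz ->.
rewrite big_split /= big_const iter_addr_0 mulr_natl mulr_suml => /eqP.
by rewrite addr_eq0 => /eqP.
Qed.

End Nilpotent.

End LieBasics.

(** * Nondegeneracy of the Killing form and diagonalizability of h *)

Section KillingForm.

Variables (F : numClosedFieldType) (L : vectType F) (br : L -> L -> L).
Hypothesis lieP : is_lie_bracket br.
Hypothesis simpleL : simple_lie br fullv.
Variable h : {vspace L}.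
Hypothesis cartan_h : cartan_in br fullv h.
Implicit Types (x y z u v w : L) (U V : {vspace L}).

Lemma simple_perfect v : sumof (fun w => exists x y, w = br x y) v.
Proof.
have [|a x y sx sy|J hJ] := @vspace_of_pred _ _ (sumof (fun w => exists x y, w = br x y)).
- exact: sumof0.
- apply: sumofD => //; case: sx => s sP ->; rewrite scaler_sumr big_seq.
  apply: sumof_sum => w /sP[x1 [x2 ->]]; apply: sumof1.
  by exists (a *: x1), x2; rewrite brZl.
apply/hJ; case: simpleL => _ [x [y [_ _ xy0]]] /(_ J (subvf J))[x1 x2 _ _||->].
- by apply/hJ; apply: sumof1; exists x1, x2.
- move=> J0; case/eqP: xy0; apply/eqP; rewrite -memv0 -J0; apply/hJ.
  by apply: sumof1; exists x, y.
- exact: memvf.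
Qed.

Lemma normalizer_cartan x : (forall y, y \in h -> br x y \in h) -> x \in h.
Proof. by case: cartan_h => _ _ _; apply; rewrite memvf. Qed.

(** The radical is an ideal, so the case to refute is an identically zero form. On [e, f] with e, f
    of weights a, -a every weight is a real multiple of a, so the sum of squares in [killing_diag]
    makes all weights vanish there. By perfectness such brackets span [h]; hence all weights are 0,
    [h] is everything, and nilpotency contradicts perfectness. *)
Lemma killing_nondeg x : (forall y, killing br x y = 0) -> x = 0.
Proof.
have [||J hJ] := @vspace_of_pred _ _ (fun x => forall y, killing br x y = 0).
- by move=> y; rewrite killing0l.
- by move=> a x1 x2 h1 h2 y; rewrite killing_linl // h1 h2 mulr0 addr0.
case: (simpleL) => _ [x0 [y0 [_ _ xy0]]] /(_ J (subvf J))[x1 x2 _|J0|Jf].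
- move=> /hJ h2; apply/hJ => y; rewrite brC // killingNl // killing_inv //.
  by rewrite h2 oppr0.
- by move/hJ; rewrite J0 memv0 => /eqP.
have kill0 u v : killing br u v = 0 by move: v; apply/hJ; rewrite Jf memvf.
move: (cartan_h) => [_ subh [m nilh] _].
have [N [X [al [bX gwX]]]] := gwH_basis lieP nilh.
have alBr e f (a : subvs_of h -> F) k i : gw (adH br (H := h)) a e ->
    gw (adH br (H := h)) (fun k => - a k) f -> br e f = vsval k -> al i k = 0.
  move=> ga gf Dk.
  have /choice[r hr] : forall i, exists r, r \is Num.real /\ al i k = r * a k.
    move=> j; have [r ? ?] := string_real lieP nilh bX gwX ga gf Dk j.
    by exists r.
  have := killing_diag lieP nilh bX gwX k k; rewrite kill0 => /esym.
  rewrite (eq_bigr (fun i => r i ^+ 2 * a k ^+ 2)); last first.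
    by move=> j _; rewrite (hr j).2 mulrACA.
  rewrite -mulr_suml => /eqP; rewrite mulf_eq0 expf_eq0 /= => /orP[|/eqP ak0]; last first.
    by rewrite (hr i).2 ak0 mulr0.
  rewrite psumr_eq0; last by move=> j _; rewrite real_exprn_even_ge0 // (hr j).1.
  move/allP/(_ i); rewrite mem_index_enum => /(_ isT).
  by rewrite /= expf_eq0 /= (hr i).2 => /eqP->; rewrite mul0r.
have al0 i k : al i k = 0.
  pose Z w := exists e f a, [/\ gw (adH br (H := h)) a e,
    gw (adH br (H := h)) (fun k => - a k) f & w = br e f].
  suff : sumof Z (vsval k).
    move=> [s sZ Ds].
    have sh w : w \in s -> w \in h.
      move=> /sZ[e [f [a [ga gf ->]]]]; apply: (gwH_null lieP nilh subh normalizer_cartan).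
      have := gwH_br lieP ga gf; congr gw; apply: funext => k'; exact: subrr.
    have -> : k = \sum_(w <- s) vsproj h w.
      apply: val_inj; rewrite /= Ds linear_sum /=; rewrite !big_seq.
      by apply: eq_bigr => w /sh wh; rewrite vsprojK.
    rewrite big_seq; apply: (big_ind (fun k => al i k = 0)) => [|k1 k2 h1 h2|w ws].
    - have := al_linear lieP nilh bX gwX i (-1) 0 0.
      by rewrite scaler0 addr0 mulN1r addNr.
    - have := al_linear lieP nilh bX gwX i 1 k1 k2.
      by rewrite scale1r h1 h2 mulr0 addr0.
    have wh := sh w ws; move: (sZ w ws) => [e [f [a [ga gf Dw]]]].
    by apply: (alBr e f a) => //; rewrite vsprojK.
  pose Y w := exists e f a b, [/\ gw (adH br (H := h)) a e,
    gw (adH br (H := h)) b f & w = br e f].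
  have : sumof Y (vsval k).
    apply: sumof_bind (simple_perfect _) => w [x1 [x2 ->]].
    rewrite (coord_basis bX (memvf x1)) br_suml //; apply: sumof_sum => i1 _.
    rewrite (coord_basis bX (memvf x2)) br_sumr //; apply: sumof_sum => i2 _.
    rewrite brZl // brZr //; apply: sumof1.
    exists (coord X i1 x1 *: X`_i1), (coord X i2 x2 *: X`_i2), (al i1), (al i2).
    by split; [apply: gwZ | apply: gwZ | rewrite brZl // brZr].
  (* [vsval k] has weight 0, so by independence the brackets of nonzero total weight cancel and only
     those of opposite weights remain. *)
  move=> [s sY Ds]; exists [seq w <- s | `[< Z w >]].
    by move=> w; rewrite mem_filter => /andP[/asboolP].
  apply/eqP; rewrite -subr_eq0; apply/eqP.
  apply: (gw_indep (gwH_stable lieP nilh) (al := fun=> 0)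
    (s := [seq w <- s | ~~ `[< Z w >]])).
  - rewrite -scaleN1r addrC; apply: gw_lin; last exact: (gwH_self lieP nilh (subvsP k)).
    rewrite big_seq; apply: gw_sum => w; rewrite mem_filter => /andP[/asboolP[e [f [a [ga gf ->]]]] _].
    by have := gwH_br lieP ga gf; congr gw; apply: funext => k'; exact: subrr.
  - apply/eqP; rewrite subr_eq Ds !big_filter addrC.
    by rewrite [X in X == _](bigID (fun w => `[< Z w >])).
  move=> w; rewrite mem_filter => /andP[/asboolP nZ /sY[e [f [a [b [ga gb Dw]]]]]].
  exists (fun k => a k + b k); first by rewrite Dw; apply: gwH_br.
  move=> ab0; apply: nZ; exists e, f, a; split=> //.
  move: gb; congr gw; apply: funext => k'; apply/eqP; rewrite -addr_eq0 addrC.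
  by have := congr1 (fun g => g k') ab0 => /= ->.
have hfull : h = fullv.
  apply/eqP; rewrite eqEsubv subvf -(span_basis bX); apply/span_subvP => x1.
  move=> /(nthP 0)[i iN <-]; rewrite size_tuple in iN.
  apply: (gwH_null lieP nilh subh normalizer_cartan).
  have := gwX (Ordinal iN); congr gw; apply: funext => k; exact: al0.
have long n v : sumof (fun w => exists xs y, size xs = n /\ w = itbr br xs y) v.
  elim: n v => [|n IH] v; first by apply: sumof1; exists [::], v.
  apply: sumof_bind (IH v) => w [xs [y [sz ->]]].
  have [s sP ->] := simple_perfect y.
  have -> : itbr br xs (\sum_(w0 <- s) w0) = \sum_(w0 <- s) itbr br xs w0.
    elim: (xs) => [|x1 xs' IHx] //=.
    by rewrite IHx br_sumr.
  rewrite big_seq; apply: sumof_sum => w0 /sP[a [b ->]]; apply: sumof1.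
  by exists (rcons xs a), b; rewrite size_rcons sz /itbr foldr_rcons.
have zero v : v = 0.
  have [s sP ->] := long m v; rewrite big_seq big1 // => w /sP[xs [y [sz ->]]].
  by apply: nilh => //; rewrite hfull ?memvf //; apply/allP => ? _; rewrite memvf.
by move=> _; apply: zero.
Qed.

(** Pairing with a basis of [U] is injective on [U], hence onto by dimension. *)
Lemma killing_dual U (phi : L -> F) :
  (forall x, x \in U -> (forall y, y \in U -> killing br x y = 0) -> x = 0) ->
  (forall a x y, phi (a *: x + y) = a * phi x + phi y) ->
  exists2 z, z \in U & forall y, y \in U -> killing br z y = phi y.
Proof.
move=> nd philin; pose d := \dim U; pose X := vbasis U.
pose g z : 'rV[F]_d := \row_i killing br z X`_i.
have ging : linear g by move=> a x y; apply/rowP => i; rewrite !mxE killing_linl.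
pose G : 'Hom(L, 'rV[F]_d) :=
  linfun (HB.pack g (GRing.isLinear.Build _ _ _ _ g ging) : {linear L -> 'rV[F]_d}).
have GE z : G z = g z by rewrite /G lfunE.
have phiS (I : finType) (E : I -> L) : phi (\sum_i E i) = \sum_i phi (E i).
  apply: (big_morph phi) => [x y|].
    by have := philin 1 x y; rewrite scale1r mul1r.
  by have := philin (-1) 0 0; rewrite scaler0 addr0 mulN1r addNr.
have phiZ a x : phi (a *: x) = a * phi x.
  have := philin a x 0; rewrite addr0 => ->; suff -> : phi 0 = 0 by rewrite addr0.
  by have := philin (-1) 0 0; rewrite scaler0 addr0 mulN1r addNr.
have ker0 : (U :&: lker G = 0)%VS.
  apply/eqP; rewrite -subv0; apply/subvP => x; rewrite memv_cap memv_ker memv0 => /andP[xU /eqP Gx].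
  apply/eqP; apply: nd => // y yU; rewrite (coord_vbasis yU) killing_sumr // big1 // => i _.
  rewrite killingZr //; have := congr1 (fun M : 'rV[F]_d => M 0 i) Gx.
  by rewrite GE !mxE => ->; rewrite mulr0.
have img : (G @: U)%VS = fullv.
  apply/eqP; rewrite -(geq_leqif (dimv_leqif_eq (subvf _))) (limg_dim_eq ker0).
  by rewrite dimvf; change (1 * \dim U <= \dim U)%N; rewrite mul1n.
have /memv_imgP[z zU Dz] : (\row_i phi X`_i) \in (G @: U)%VS by rewrite img memvf.
exists z => // y yU; rewrite (coord_vbasis yU) killing_sumr // phiS.
apply: eq_bigr => i _; rewrite killingZr // phiZ; congr (_ * _).
by have := congr1 (fun M : 'rV[F]_d => M 0 i) Dz; rewrite GE !mxE.
Qed.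

(** Let [z] represent the functional tr(D ad y), and put E = D - ad z. Then E pairs to 0 with every
    ad w under the trace, and the Killing form of E x with y is tr([E, ad x] ad y) = tr(E ad [x, y])
    = 0. *)
Lemma derivation_inner (D : 'End(L)) :
  (forall x y, D (br x y) = br (D x) y + br x (D y)) ->
  exists z, forall x, D x = br z x.
Proof.
move=> derD.
have [x _|a x y|z _ hz] := @killing_dual fullv (fun y => ltrace (D \o ad br y)%VF).
- by move=> hx; apply: killing_nondeg => y; apply: hx; rewrite memvf.
- by rewrite ad_lin // comp_lfunDr ltraceD -comp_lfunZr ltraceZ.
exists z => x; apply/eqP; rewrite -subr_eq0; apply/eqP; apply: killing_nondeg => y.
pose E := D - ad br z.
have EE w : E w = D w - br z w by rewrite /E add_lfunE opp_lfunE adE.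
have trE w : ltrace (E \o ad br w)%VF = 0.
  rewrite /E comp_lfunDl comp_lfunNl ltraceD ltraceN.
  by rewrite -hz ?memvf // /killing subrr.
have adEx : ad br (E x) = (E \o ad br x)%VF - (ad br x \o E)%VF.
  apply/lfunP => w; rewrite add_lfunE opp_lfunE !comp_lfunE !adE // !EE.
  rewrite derD brBl // brBr // (jacobi lieP z).
  by rewrite opprB opprD !addrA subrK addrAC addrK.
rewrite -EE /killing adEx comp_lfunDl comp_lfunNl ltraceD ltraceN.
rewrite -[(ad br x \o E \o _)%VF]comp_lfunA [ltrace (ad br x \o _)%VF]ltraceC.
rewrite -!comp_lfunA -ltraceN -ltraceD -comp_lfunNr -comp_lfunDr.
by rewrite -ad_br.
Qed.

(** The operator scaling each weight space by its weight at [k] is a derivation, hence ad z; it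
    kills [h], so z lies in [h]. All weights vanish on k - z, which is therefore orthogonal to
    everything and equal to 0. *)
Theorem cartan_diag : exists N (X : N.-tuple L) (al : 'I_N -> subvs_of h -> F),
  basis_of fullv X /\ forall (i : 'I_N) k, br (vsval k) X`_i = al i k *: X`_i.
Proof.
move: (cartan_h) => [_ subh [m nilh] _].
have [N [X [al [bX gwX]]]] := gwH_basis lieP nilh.
exists N, X, al; split=> // i k.
have nd (u : subvs_of h) : (forall i, al i u = 0) -> u = 0.
  move=> alu; apply: val_inj; apply: killing_nondeg => y.
  rewrite (coord_basis bX (memvf y)) killing_sumr // big1 // => j _; rewrite killingZr //.
  have [[k' ak']|nk] := pselect (exists k', al j k' != 0).
    rewrite (killing_gwH lieP nilh bX gwX (gwH_self lieP nilh (subvsP u)) (gwX j)) ?mulr0 //.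
    by exists k'; rewrite add0r.
  have Xh : X`_j \in h.
    apply: (gwH_null lieP nilh subh normalizer_cartan).
    have := gwX j; congr gw; apply: funext => k'; apply/eqP/negPn/negP => h0.
    by apply: nk; exists k'.
  rewrite -(vsprojK Xh) (killing_diag lieP nilh bX gwX) big1 ?mulr0 // => j' _.
  by rewrite alu mul0r.
have [D Dgw] : exists D : 'End(L), forall be v,
    gw (adH br (H := h)) be v -> D v = be k *: v.
  exists (ldiag X (al^~ k)) => be v hv.
  rewrite ldiagE [in RHS](coord_basis bX (memvf v)) scaler_sumr.
  apply: eq_bigr => j _; rewrite scalerA.
  have [->|cn0] := eqVneq (coord X j v) 0; first by rewrite !mulr0.
  by rewrite (gwH_coord lieP nilh bX gwX hv cn0).
have [|z Dz] := @derivation_inner D.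
  pose Q x y := D (br x y) = br (D x) y + br x (D y).
  move=> x y; rewrite -/(Q x y) (coord_basis bX (memvf x)).
  apply: (big_ind (Q^~ y)) => [|x1 x2 h1 h2|i1 _].
  - by rewrite /Q !(br0l lieP, linear0) addr0.
  - rewrite /Q in h1 h2 *.
    have DD a b : D (a + b) = D a + D b by rewrite raddfD.
    rewrite DD.
    rewrite !(brDl lieP).
    rewrite DD.
    rewrite h1 h2.
    exact: addrACA.
  rewrite (coord_basis bX (memvf y)).
  apply: (big_ind (Q _)) => [|x1 x2 h1 h2|i2 _].
  - by rewrite /Q !(br0r lieP, linear0) addr0.
  - rewrite /Q in h1 h2 *.
    have DD a b : D (a + b) = D a + D b by rewrite raddfD.
    rewrite DD.
    rewrite !(brDr lieP).
    rewrite DD.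
    rewrite h1 h2.
    exact: addrACA.
  rewrite /Q !(Dgw _ _ (gwZ _ (gwX _))).
  rewrite (Dgw _ _ (gwH_br lieP (gwZ _ (gwX i1)) (gwZ _ (gwX i2)))).
  by rewrite [br (al i1 k *: _) _]brZl // [br _ (al i2 k *: _)]brZr // scalerDl.
have zh : z \in h.
  apply: normalizer_cartan => y yh; rewrite -Dz (Dgw _ _ (gwH_self lieP nilh yh)).
  by rewrite scale0r mem0v.
suff kz : k = vsproj h z by rewrite {1}kz vsprojK // -Dz (Dgw _ _ (gwX i)).
apply/eqP; rewrite -subr_eq0; apply/eqP/nd => j.
set u := k - _.
have uE v : gw (adH br (H := h)) (al j) v -> br (vsval u) v = shift (ad br (vsval k)) (al j k) v.
  move=> hv; rewrite /u linearB /= brBl // vsprojK // -Dz (Dgw _ _ hv) shiftE adE //.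
apply/eqP/negPn/negP => un0.
(* On this weight space [u] acts as [ad k] minus the scalar [al j k], hence nilpotently, so 0 is a
   generalized eigenvalue besides [al j u]. *)
have X0 : X`_j = 0.
  apply: (geig_uniq un0 (gwX j u)).
  have [M hM] := gwX j k; exists M; rewrite -[RHS]hM.
  elim: M {hM} => [|M IH]; first by rewrite !lpow0.
  rewrite !lpowS IH shiftE scale0r subr0 /adH adE // uE //.
  exact: (gw_lpow (gwH_stable lieP nilh)).
have : X`_j \in tval X by rewrite -tnth_nth mem_tnth.
by move=> /(basis_not0 bX); rewrite X0 eqxx.
Qed.

End KillingForm.

(** * Graded weights for h_0 *)

Section GradedWeights.

Variables (F : numClosedFieldType) (L : vectType F) (br : L -> L -> L).
Hypothesis lieP : is_lie_bracket br.
Variables (n : nat) (G : 'I_n.+1 -> {vspace L}).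
Hypothesis gradP : is_grading br n G.
Hypothesis ndK : forall x, (forall y, killing br x y = 0) -> x = 0.
Variable H0 : {vspace L}.
Hypothesis H0G : (H0 <= G 0%R)%VS.
Hypothesis H0ab : forall x y, x \in H0 -> y \in H0 -> br x y = 0.
Hypothesis H0c : forall x, x \in G 0 -> (forall t, t \in H0 -> br t x = 0) -> x \in H0.
Variables (N : nat) (Y : N.-tuple L) (mu : 'I_N -> wt H0) (gr : 'I_N -> 'I_n.+1).
Hypothesis bY : basis_of fullv Y.
Hypothesis Ygr : forall i : 'I_N, Y`_i \in G (gr i).
Hypothesis Ywt : forall i : 'I_N, weight_vec br H0 (mu i) Y`_i.

Implicit Types (x y z u v w e f : L) (a b q : wt H0) (l : 'I_N).

Local Notation kil := (killing br).

Lemma G_br i j x y : x \in G i -> y \in G j -> br x y \in G (i + j).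
Proof. by case: gradP => _ _; apply. Qed.

Lemma grade_uniq (us vs : 'I_n.+1 -> L) : (forall i, us i \in G i) -> (forall i, vs i \in G i) ->
  \sum_i us i = \sum_i vs i -> forall i, us i = vs i.
Proof.
case: gradP => _ dG _ hu hv /eqP; rewrite (directv_sum_unique dG) //.
by move=> /forallP h i; apply/eqP; have := h i.
Qed.

Definition wv a j x := x \in G j /\ weight_vec br H0 a x.

Lemma weight_vec_br a b x y : weight_vec br H0 a x -> weight_vec br H0 b y ->
  weight_vec br H0 (a + b) (br x y).
Proof.
move=> hx hy t; rewrite (jacobi lieP) hx hy (brZl lieP) (brZr lieP) -scalerDl.
by rewrite add_lfunE.
Qed.

Lemma weight_vec_lin a c x y : weight_vec br H0 a x -> weight_vec br H0 a y ->
  weight_vec br H0 a (c *: x + y).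
Proof. by move=> hx hy t; rewrite (br_linr lieP) hx hy scalerDr !scalerA mulrC. Qed.

Lemma weight_vec0 a : weight_vec br H0 a 0.
Proof. by move=> t; rewrite (br0r lieP) scaler0. Qed.

Lemma weight_vecZ a c x : weight_vec br H0 a x -> weight_vec br H0 a (c *: x).
Proof. by move=> hx; rewrite -[_ *: _]addr0; apply: weight_vec_lin (weight_vec0 a). Qed.

Lemma weight_vecT a x t : t \in H0 -> weight_vec br H0 a x -> br t x = (a (vsproj H0 t) : F) *: x.
Proof. by move=> tH hx; rewrite -hx vsprojK. Qed.

Lemma wv_br a b i j x y : wv a i x -> wv b j y -> wv (a + b) (i + j) (br x y).
Proof. by move=> [xG xw] [yG yw]; split; [apply: G_br | apply: weight_vec_br]. Qed.

Lemma wv_lin a j c x y : wv a j x -> wv a j y -> wv a j (c *: x + y).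
Proof. by move=> [xG xw] [yG yw]; split; [rewrite memvD ?memvZ | apply: weight_vec_lin]. Qed.

Lemma wv0 a j : wv a j 0.
Proof. by split; [apply: mem0v | apply: weight_vec0]. Qed.

Lemma wvZ a j c x : wv a j x -> wv a j (c *: x).
Proof. by move=> hx; rewrite -[_ *: _]addr0; apply: wv_lin (wv0 a j). Qed.

Lemma wvD a j x y : wv a j x -> wv a j y -> wv a j (x + y).
Proof. by move=> hx hy; rewrite -[x]scale1r; apply: wv_lin. Qed.

Lemma wvY l : wv (mu l) (gr l) Y`_l. Proof. by []. Qed.

Lemma wvH0 t : t \in H0 -> wv 0 0 t.
Proof.
move=> tH; split; first exact: (subvP H0G).
by move=> s; rewrite H0ab ?subvsP // zero_lfunE scale0r.
Qed.

Lemma wv00 x : wv 0 0 x -> x \in H0.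
Proof.
move=> [xG xw]; apply: H0c => // t tH.
by rewrite (weight_vecT tH xw) zero_lfunE scale0r.
Qed.

Lemma nilH0 : ad_nilpotent_of br 1 H0.
Proof. by move=> [|x [|? ?]] y //= _; rewrite andbT => xH yH; apply: H0ab. Qed.

Lemma gw_weight_vec a x : weight_vec br H0 a x -> gw (adH br (H := H0)) (fun k => a k) x.
Proof. by move=> hx k; exists 1%N; rewrite lpowS lpow0 shiftE /adH (adE lieP) hx subrr. Qed.

Definition alY l : subvs_of H0 -> F := fun k => mu l k.

Lemma gwY l : gw (adH br (H := H0)) (alY l) Y`_l.
Proof. exact: gw_weight_vec. Qed.

Lemma coord_wt a x l : weight_vec br H0 a x -> coord Y l x != 0 -> mu l = a.
Proof.
move=> hx cn0; have := gwH_coord lieP nilH0 bY gwY (gw_weight_vec hx) cn0.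
by move=> e; apply/lfunP => k; apply: (congr1 (fun g => g k) e).
Qed.

Lemma coord_gr j x l : x \in G j -> coord Y l x != 0 -> gr l = j.
Proof.
move=> xG cn0; apply/eqP/negPn/negP => ne.
pose us k := \sum_(i | gr i == k) coord Y i x *: Y`_i.
pose vs k : L := if k == j then x else 0.
have usG k : us k \in G k by apply: memv_suml => i /eqP<-; rewrite memvZ.
have vsG k : vs k \in G k by rewrite /vs; case: eqP => [->|_]; rewrite ?mem0v.
have : us (gr l) = vs (gr l).
  apply: grade_uniq => //; rewrite -big_mkcond /= big_pred1_eq.
  rewrite [RHS](coord_basis bY (memvf x)).
  by rewrite (partition_big gr xpredT).
rewrite /vs (negPf ne) => us0.
have := congr1 (coord Y l) us0; rewrite linear0 /us big_mkcond /=.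
rewrite (eq_bigr (fun i => (if gr i == gr l then coord Y i x else 0) *: Y`_i)); last first.
  by move=> i _; case: ifP => //; rewrite scale0r.
by rewrite coord_sum_free ?(basis_free bY) // eqxx => /eqP; rewrite (negPf cn0).
Qed.

Lemma coord_wv a j x l : wv a j x -> coord Y l x != 0 -> mu l = a /\ gr l = j.
Proof. by move=> [xG xw] cn0; rewrite (coord_wt xw cn0) (coord_gr xG cn0). Qed.

Lemma exists_coord x : x != 0 -> exists l, coord Y l x != 0.
Proof.
move=> xn0; apply: contrapT => nex; case/eqP: xn0.
rewrite (coord_basis bY (memvf x)) big1 // => l _.
have [->|c] := eqVneq (coord Y l x) 0; first by rewrite scale0r.
by case: nex; exists l.
Qed.

Lemma weight_mu a x : x != 0 -> weight_vec br H0 a x -> exists l, mu l = a.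
Proof. by move=> /exists_coord[l cn0] hx; exists l; apply: coord_wt cn0. Qed.

Lemma wv_mu a j x : x != 0 -> wv a j x -> exists l, mu l = a /\ gr l = j.
Proof. by move=> /exists_coord[l cn0] hx; exists l; apply: coord_wv cn0. Qed.

Lemma Y_neq0 l : Y`_l != 0.
Proof. by apply: (basis_not0 bY); rewrite -tnth_nth mem_tnth. Qed.

Lemma kil_orth a b i j x y : wv a i x -> wv b j y -> (a + b != 0) || (i + j != 0) -> kil x y = 0.
Proof.
move=> hx hy ne; rewrite /killing (ltrace_basis _ bY) big1 // => l _.
rewrite comp_lfunE !(adE lieP).
have hz := wv_br hx (wv_br hy (wvY l)).
apply/eqP/negPn/negP => cn0; have [e1 e2] := coord_wv hz cn0.
case/orP: ne => /negP; apply.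
  by apply/eqP/(addIr (mu l)); rewrite add0r -addrA -e1.
by apply/eqP/(addIr (gr l)); rewrite add0r -addrA -e2.
Qed.

Lemma kil_dual a j x : wv a j x -> x != 0 -> exists2 y, wv (- a) (- j) y & kil x y = 1.
Proof.
move=> hx xn0.
have [l kn0] : exists l : 'I_N, kil x Y`_l != 0.
  apply: contrapT => nex; case/eqP: xn0; apply: ndK => y.
  rewrite (coord_basis bY (memvf y)) (killing_sumr lieP) big1 // => l _.
  rewrite (killingZr lieP); have [->|c] := eqVneq (kil x Y`_l) 0; first by rewrite mulr0.
  by case: nex; exists l.
have [e1 e2] : a + mu l = 0 /\ j + gr l = 0.
  split; apply/eqP/negPn/negP => ne; case/eqP: kn0.
    by apply: (kil_orth hx (wvY l)); rewrite ne.
  by apply: (kil_orth hx (wvY l)); rewrite ne orbT.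
exists ((kil x Y`_l)^-1 *: Y`_l); last by rewrite (killingZr lieP) mulVf.
apply: wvZ; have -> : - a = mu l by apply/eqP; rewrite eq_sym -addr_eq0 addrC e1.
by have -> : - j = gr l by apply/eqP; rewrite eq_sym -addr_eq0 addrC e2.
Qed.

(** * The form on the weights of h_0 and nonvanishing brackets *)

Lemma ndH0 x : x \in H0 -> (forall y, y \in H0 -> kil x y = 0) -> x = 0.
Proof.
move=> xH hx; apply/eqP/negPn/negP => xn0.
have [y hy k1] := kil_dual (wvH0 xH) xn0; rewrite !oppr0 in hy.
by move/eqP: k1; rewrite hx ?(wv00 hy) // eq_sym oner_eq0.
Qed.

Lemma wdual_exists a : exists z, z \in H0 /\ forall t, t \in H0 -> kil z t = a (vsproj H0 t).
Proof.
have [|c x y|z zH hz] := @killing_dual _ _ _ lieP H0 (fun t => a (vsproj H0 t)).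
- exact: ndH0.
- by rewrite !linearP.
by exists z.
Qed.

(** The vector usually written t_a, which represents the weight [a] on [H0] through the Killing
    form. *)
Definition wdual a := sval (cid (wdual_exists a)).

Lemma wdual_H0 a : wdual a \in H0. Proof. by rewrite /wdual; case: cid => z []. Qed.

Lemma kil_wdual a t : t \in H0 -> kil (wdual a) t = a (vsproj H0 t).
Proof. by rewrite /wdual; case: cid => z [] /= _ h; apply: h. Qed.

Definition wform a b : F := a (vsproj H0 (wdual b)).

Lemma wform_kil a b : wform a b = kil (wdual a) (wdual b).
Proof. by rewrite kil_wdual ?wdual_H0. Qed.

Lemma wformC a b : wform a b = wform b a.
Proof. by rewrite !wform_kil killingC. Qed.

Lemma wformDl a b q : wform (a + b) q = wform a q + wform b q.
Proof. by rewrite /wform add_lfunE. Qed.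

Lemma wformNl a q : wform (- a) q = - wform a q.
Proof. by rewrite /wform opp_lfunE. Qed.

Lemma wform0l q : wform 0 q = 0.
Proof. by rewrite /wform zero_lfunE. Qed.

Lemma wformBl a b q : wform (a - b) q = wform a q - wform b q.
Proof. by rewrite wformDl wformNl. Qed.

Lemma wformMn a q k : wform (a *+ k) q = wform a q *+ k.
Proof. by elim: k => [|k IH]; rewrite ?mulr0n ?wform0l // !mulrS wformDl IH. Qed.

Lemma wformDr a b q : wform q (a + b) = wform q a + wform q b.
Proof. by rewrite !(wformC q) wformDl. Qed.

Lemma wformNr a q : wform q (- a) = - wform q a.
Proof. by rewrite !(wformC q) wformNl. Qed.

Lemma wform0r q : wform q 0 = 0.
Proof. by rewrite wformC wform0l. Qed.

Lemma wform_sumr (I : Type) (r : seq I) (P : pred I) (E : I -> wt H0) q :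
  wform q (\sum_(i <- r | P i) E i) = \sum_(i <- r | P i) wform q (E i).
Proof. by apply: (big_morph (wform q)) => [x y|]; rewrite ?wformDr ?wform0r. Qed.

Lemma wform_suml (I : Type) (r : seq I) (P : pred I) (E : I -> wt H0) q :
  wform (\sum_(i <- r | P i) E i) q = \sum_(i <- r | P i) wform (E i) q.
Proof. by apply: (big_morph (wform^~ q)) => [x y|]; rewrite ?wformDl ?wform0l. Qed.

Lemma wform_diag a b : wform a b = \sum_l wform (mu l) a * wform (mu l) b.
Proof.
rewrite wform_kil -(vsprojK (wdual_H0 a)) -(vsprojK (wdual_H0 b)).
by rewrite (killing_diag lieP nilH0 bY gwY).
Qed.

Lemma br_wdual a b x : weight_vec br H0 b x -> br (wdual a) x = wform b a *: x.
Proof. by move=> hx; rewrite (weight_vecT (wdual_H0 a) hx). Qed.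

Lemma central0 x : (forall y, br x y = 0) -> x = 0.
Proof.
by move=> hx; apply: ndK; apply: killing_central.
Qed.

Lemma wform_nondeg q : (forall l, wform (mu l) q = 0) -> q = 0.
Proof.
move=> hq.
have T0 : wdual q = 0.
  apply: central0 => y; rewrite (coord_basis bY (memvf y)) (br_sumr lieP) big1 // => l _.
  by rewrite (brZr lieP) (br_wdual _ (Ywt l)) hq scale0r scaler0.
apply/lfunP => t; rewrite zero_lfunE -(vsvalK t) -kil_wdual ?subvsP //.
by rewrite T0 killing0l.
Qed.

Definition isw a j := exists2 x, x != 0 & wv a j x.

Lemma isw_mu l : isw (mu l) (gr l). Proof. by exists Y`_l => //; apply: Y_neq0. Qed.

Lemma iswN a j : isw a j -> isw (- a) (- j).
Proof.
move=> [x xn0 hx]; have [y hy k1] := kil_dual hx xn0; exists y => //.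
apply/eqP => y0; move/eqP: k1; rewrite y0 killingC killing0l //.
by rewrite eq_sym oner_eq0.
Qed.

(** Reality is required exactly against the [mu l], the values whose squares add up to the norm in
    [wform_diag]. *)
Definition real_wt q := forall l, wform (mu l) q \is Num.real.

Lemma real_wtD a b : real_wt a -> real_wt b -> real_wt (a + b).
Proof. by move=> ha hb l; rewrite wformDr rpredD. Qed.

Lemma real_wt0 : real_wt 0. Proof. by move=> l; rewrite wform0r real0. Qed.

Lemma wform_gt0 q : real_wt q -> q != 0 -> 0 < wform q q.
Proof.
move=> hq qn0; rewrite lt_def; apply/andP; split; last first.
  by rewrite wform_diag sumr_ge0 // => l _; rewrite -expr2 real_exprn_even_ge0.
apply: contra qn0; rewrite wform_diag psumr_eq0; last first.
  by move=> l _; rewrite -expr2 real_exprn_even_ge0.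
move/allP => h; apply/eqP/wform_nondeg => l.
by have := h l (mem_index_enum l); rewrite /= mulf_eq0 orbb => /eqP.
Qed.

Lemma br_opposite a j e f : wv a j e -> wv (- a) (- j) f -> br e f = kil e f *: wdual a.
Proof.
move=> he hf; apply/eqP; rewrite -subr_eq0; apply/eqP.
have efH : br e f \in H0 by apply: wv00; have := wv_br he hf; rewrite !subrr.
apply: ndH0; first by rewrite memvB ?memvZ ?wdual_H0.
move=> t tH; rewrite (killingBl lieP) (killingZl lieP) (kil_wdual _ tH) (killing_inv lieP).
rewrite (brC lieP) (weight_vecT tH hf.2) opp_lfunE scaleNr opprK (killingZr lieP).
by rewrite mulrC subrr.
Qed.

(** The string argument gives (mu l, a) = r_l (a, a) with real r_l. Substituted into [wform_diag]
    this reads c = c^2 times the sum of the r_l^2 for c = (a, a), so c is the inverse of a real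
    number. *)
Lemma isw_real_wt a j : isw a j -> real_wt a.
Proof.
move=> [e en0 he]; have [f hf k1] := kil_dual he en0.
have [->|an0] := eqVneq a 0; first exact: real_wt0.
have Dk : br e f = vsval (vsproj H0 (wdual a)) by rewrite vsprojK ?wdual_H0 // (br_opposite he hf) k1 scale1r.
have gf : gw (adH br (H := H0)) (fun k => - (a k : F)) f.
  by have := gw_weight_vec hf.2; congr gw; apply: funext => k; rewrite opp_lfunE.
have str l := string_real lieP nilH0 bY gwY (gw_weight_vec he.2) gf Dk l.
have /choice[r hr] : forall l, exists r, r \is Num.real /\ wform (mu l) a = r * wform a a.
  by move=> l; have [r ? ?] := str l; exists r.
set c := wform a a in hr.
have cn0 : c != 0.
  apply: contra an0 => /eqP c0; apply/eqP/wform_nondeg => l.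
  by rewrite (hr l).2 c0 mulr0.
have : c = c ^+ 2 * \sum_l r l ^+ 2.
  rewrite {1}/c wform_diag mulr_sumr; apply: eq_bigr => l _; rewrite (hr l).2.
  by rewrite mulrACA -!expr2 mulrC.
rewrite expr2 -mulrA -{1}[c]mulr1 => /(mulfI cn0) c1.
have creal : c \is Num.real.
  have -> : c = (\sum_l r l ^+ 2)^-1.
    have sn0 : \sum_l r l ^+ 2 != 0.
      by apply/eqP => s0; move/eqP: c1; rewrite s0 mulr0 oner_eq0.
    by apply: (mulIf sn0); rewrite -c1 mulVf.
  by rewrite realV rpred_sum // => l _; rewrite rpredX // (hr l).1.
by move=> l; rewrite (hr l).2 rpredM // (hr l).1.
Qed.

Lemma isw_pos a j : isw a j -> a != 0 -> 0 < wform a a.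
Proof. by move=> /isw_real_wt ra; apply: wform_gt0. Qed.

Lemma isw_real a b i j : isw a i -> isw b j -> wform a b \is Num.real.
Proof. by move=> [x xn0 hx] /isw_real_wt rb; have [l [<- _]] := wv_mu xn0 hx; apply: rb. Qed.

(* Lowering repeatedly with f, the coefficients k_i in [e, f^(i+1) v] = k_i f^i v
   stay negative, so the f^i v would be weight vectors of infinitely many weights. *)
Lemma chain_false a b j e f v : wv a j e -> wv (- a) (- j) f -> kil e f = 1 -> a != 0 ->
  v != 0 -> weight_vec br H0 b v -> br f (br e v) = 0 -> wform b a < 0 -> False.
Proof.
move=> he hf k1 an0 vn0 hv fev neg.
have ef : br e f = wdual a by rewrite (br_opposite he hf) k1 scale1r.
have paa : 0 < wform a a.
  apply: (@isw_pos a j) => //; exists e => //; apply/eqP => e0.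
  by move/eqP: k1; rewrite e0 killing0l // eq_sym oner_eq0.
pose vs i := iter i (br f) v.
have wvs i : weight_vec br H0 (b - a *+ i) (vs i).
  elim: i => [|i IH]; first by rewrite mulr0n subr0.
  have := weight_vec_br hf.2 IH; rewrite mulrS opprD addrCA; exact.
have step i : exists2 k, 0 < - k & br e (vs i.+1) = k *: vs i.
  elim: i => [|i [k k0 IH]].
    exists (wform b a); first by rewrite oppr_gt0.
    by rewrite /= (jacobi lieP) ef fev addr0 (br_wdual _ hv).
  exists (wform (b - a *+ i.+1) a + k).
    rewrite wformBl opprD opprB addr_gt0 // subr_gt0.
    by apply: lt_trans neg _; rewrite wformMn pmulrn_lgt0.
  rewrite {1}/vs iterS -/(vs i.+1) (jacobi lieP) ef IH (br_wdual _ (wvs i.+1)) (brZr lieP).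
  by rewrite scalerDl.
have vsn0 i : vs i != 0.
  elim: i => [//|i IH]; have [k k0 Dk] := step i.
  apply/eqP => v0; move/eqP: Dk; rewrite v0 (br0r lieP) eq_sym scaler_eq0 (negPf IH) orbF.
  by move=> /eqP kz; rewrite kz oppr0 ltxx in k0.
have /choice[l hl] : forall i : 'I_N.+1, exists l, mu l = b - a *+ i.
  by move=> i; apply: weight_mu (vsn0 i) (wvs i).
have /leq_card : injective l.
  move=> i1 i2 e12; apply/val_inj => /=; have := hl i1; rewrite e12 hl => /addrI/oppr_inj.
  rewrite -!scaler_nat => /eqP; rewrite -subr_eq0 -scalerBl scaler_eq0 (negPf an0) orbF.
  by rewrite subr_eq0 eqr_nat => /eqP.
by rewrite !card_ord ltnn.
Qed.

Lemma raise_neq0 a b j x v : wv a j x -> x != 0 -> weight_vec br H0 b v -> v != 0 ->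
  wform b a < 0 -> br x v != 0.
Proof.
move=> hx xn0 hv vn0 neg; apply/eqP => xv0.
have an0 : a != 0 by apply/eqP => a0; rewrite a0 wform0r ltxx in neg.
have [f hf k1] := kil_dual hx xn0.
by apply: (chain_false hx hf k1 an0 vn0 hv) => //; rewrite xv0 (br0r lieP).
Qed.

(** The middle weight is 0, so [raise_neq0] does not apply twice. By the chain argument [f, [x, v]]
    is nonzero, and it has weight -a; raising it by [x] would give 0 if [x, [x, v]] were 0, because
    t_a kills [x, v]. *)
Lemma raise2_neq0 a j x v : wv a j x -> x != 0 -> a != 0 -> weight_vec br H0 (- a) v -> v != 0 ->
  br x (br x v) != 0.
Proof.
move=> hx xn0 an0 hv vn0; apply/eqP => xxv0.
have paa : 0 < wform a a by apply: (@isw_pos a j) => //; exists x.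
have neg : wform (- a) a < 0 by rewrite wformNl oppr_lt0.
have [f hf k1] := kil_dual hx xn0.
have ef : br x f = wdual a by rewrite (br_opposite hx hf) k1 scale1r.
apply: (chain_false hx hf k1 an0 vn0 hv) => //; apply/eqP/negPn/negP => fxv.
have wxv : weight_vec br H0 0 (br x v) by have := weight_vec_br hx.2 hv; rewrite subrr.
have wfxv : weight_vec br H0 (- a) (br f (br x v)).
  by have := weight_vec_br hf.2 wxv; rewrite addr0.
have := raise_neq0 hx xn0 wfxv fxv neg.
by rewrite (jacobi lieP) ef xxv0 (br0r lieP) addr0 (br_wdual _ wxv) wform0l scale0r eqxx.
Qed.

(** Subtract from [y] the multiple of [x] that makes it orthogonal to [f]: the difference commutes
    with [f] although its weight pairs negatively with -a, so it is 0. *)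
Lemma wv_line a j x y : a != 0 -> wv a j x -> x != 0 -> wv a j y -> y \in <[x]>%VS.
Proof.
move=> an0 hx xn0 hy; have [f hf k1] := kil_dual hx xn0.
have fn0 : f != 0.
  by apply/eqP => f0; move/eqP: k1; rewrite f0 killingC killing0l // eq_sym oner_eq0.
have paa : 0 < wform a a by apply: (@isw_pos a j) => //; exists x.
suff : y - kil y f *: x = 0.
  by move=> /eqP; rewrite subr_eq0 => /eqP->; apply/vlineP; exists (kil y f).
have hz : wv a j (y - kil y f *: x) by rewrite addrC -scaleNr; apply: wv_lin.
apply/eqP/negPn/negP => zn0.
have neg : wform a (- a) < 0 by rewrite wformNr oppr_lt0.
have := raise_neq0 hf fn0 hz.2 zn0 neg.
rewrite (brC lieP) (br_opposite hz hf) (killingBl lieP) (killingZl lieP) k1 mulr1 subrr.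
by rewrite scale0r oppr0 eqxx.
Qed.

Lemma isw_addneg a b i j x y : wv a i x -> x != 0 -> wv b j y -> y != 0 -> wform a b < 0 ->
  br x y != 0.
Proof. by move=> hx xn0 hy yn0 neg; apply: (raise_neq0 hx xn0 hy.2 yn0); rewrite wformC. Qed.

Lemma isw_subpos a b i j : isw a i -> isw b j -> 0 < wform b a -> isw (b - a) (j - i).
Proof.
move=> [x xn0 hx] [y yn0 hy] pos.
have [f fn0 hf] : isw (- a) (- i) by apply: iswN; exists x.
exists (br f y); last by rewrite addrC (addrC j); apply: wv_br.
by apply: (raise_neq0 hf fn0 hy.2 yn0); rewrite wformNr oppr_lt0.
Qed.

Lemma sumof_br (P1 P2 Q : L -> Prop) x y : sumof P1 x -> sumof P2 y ->
  (forall x y, P1 x -> P2 y -> sumof Q (br x y)) -> sumof Q (br x y).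
Proof.
move=> [s sP ->] [t tP ->] h; rewrite (br_suml lieP) big_seq; apply: sumof_sum => u us.
rewrite (br_sumr lieP) big_seq; apply: sumof_sum => v vt; apply: h; [exact: sP | exact: tP].
Qed.

Lemma stable_components (U : {vspace L}) (s : seq (wt H0)) (E : wt H0 -> L) :
  (forall t x, t \in H0 -> x \in U -> br t x \in U) -> uniq s ->
  (forall a, a \in s -> weight_vec br H0 a (E a)) ->
  \sum_(a <- s) E a \in U -> forall a, a \in s -> E a \in U.
Proof.
move=> stU; elim: s E => [//|a s IH] E /= /andP[ans us] hE.
rewrite big_cons => sU.
have hs b : b \in s -> E b \in U.
  move=> bs; have : b != a by apply: contraNneq ans => <-.
  move=> /lfunPn[t ne].
  (* Applying [t] minus the scalar [a t] removes the component of weight [a] and rescales that of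
     weight [b] by a nonzero number. *)
  have bat : (b t : F) - a t != 0 by rewrite subr_eq0.
  rewrite -(scale1r (E b)) -(mulVf bat) -scalerA memvZ //.
  apply: (IH (fun c => ((c t : F) - a t) *: E c)) bs => //.
    move=> c cs; apply: weight_vecZ; apply: hE; by rewrite in_cons cs orbT.
  have -> : \sum_(c <- s) ((c t : F) - a t) *: E c
     = br (vsval t) (E a + \sum_(c <- s) E c) - (a t : F) *: (E a + \sum_(c <- s) E c).
    rewrite (brDr lieP) hE ?mem_head // scalerDr opprD addrACA subrr add0r.
    rewrite (br_sumr lieP) scaler_sumr -sumrB big_seq [RHS]big_seq; apply: eq_bigr => c cs.
    by rewrite scalerBl hE // in_cons cs orbT.
  by rewrite memvB ?memvZ ?stU ?subvsP.
move=> b; rewrite in_cons => /orP[/eqP->|]; last exact: hs.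
have -> : E a = E a + \sum_(c <- s) E c - \sum_(c <- s) E c by rewrite addrK.
by rewrite memvB // big_seq memv_suml // => c /hs.
Qed.

Lemma stable_sumof (U : {vspace L}) x :
  (forall t x, t \in H0 -> x \in U -> br t x \in U) -> x \in U ->
  sumof (fun w => w \in U /\ exists a, weight_vec br H0 a w) x.
Proof.
move=> stU xU; pose s := undup [seq mu l | l <- enum 'I_N].
pose E a := \sum_(l | mu l == a) coord Y l x *: Y`_l.
have Ew a : weight_vec br H0 a (E a).
  rewrite /E; apply: big_ind => [|u v hu hv|l /eqP<-]; first exact: weight_vec0.
    by rewrite -[u]scale1r; apply: weight_vec_lin.
  exact: weight_vecZ.
have Dx : x = \sum_(a <- s) E a.
  rewrite /E (exchange_big_dep xpredT) //= {1}(coord_basis bY (memvf x)).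
  apply: eq_bigr => l _; rewrite -big_filter.
  have -> : [seq a <- s | mu l == a] = [:: mu l].
    rewrite -(@filter_pred1_uniq _ s) ?undup_uniq //.
      by apply: eq_filter => a; rewrite /= eq_sym.
    by rewrite mem_undup map_f // mem_enum.
  by rewrite big_seq1.
rewrite Dx big_seq; apply: sumof_sum => a as_; apply: sumof1; split; last by exists a.
apply: (stable_components stU (undup_uniq _)) (as_) => //.
by rewrite -/s -Dx.
Qed.

(** * Positive roots of g_0 and the order on weights *)

Variable b0 : {vspace L}.
Hypothesis borelP : borel_in br (G 0) b0.
Hypothesis H0b : (H0 <= b0)%VS.

Definition pos a := is_posroot br H0 (G 0) b0 a.

Lemma b0G x : x \in b0 -> x \in G 0.
Proof. by case: borelP => /subvP sub _ _ _; apply: sub. Qed.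

Lemma b0_br x y : x \in b0 -> y \in b0 -> br x y \in b0.
Proof. by case: borelP => _ h _ _; apply: h. Qed.

Lemma pos_neq0 a : pos a -> a != 0. Proof. by case=> [[]]. Qed.

Lemma pos_isw a : pos a -> isw a 0.
Proof. by case=> [[_ [x xG [xn0 xw]]] _]; exists x. Qed.

Lemma pos_b0 a x : pos a -> wv a 0 x -> x \in b0.
Proof. by case=> _ h [xG xw]; apply: h. Qed.

(** Positivity asks for the whole root space in [b0]; since that space is a line, one nonzero vector
    suffices. *)
Lemma posI a x : a != 0 -> wv a 0 x -> x != 0 -> x \in b0 -> pos a.
Proof.
move=> an0 hx xn0 xb; split; first by split=> //; case: hx => xG xw; exists x.
move=> y yG yw; have /vlineP[c ->] := wv_line an0 hx xn0 (conj yG yw).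
by rewrite memvZ.
Qed.

Lemma pos_real_wt a : pos a -> real_wt a. Proof. by move/pos_isw/isw_real_wt. Qed.

Lemma b0_sumof x : x \in b0 ->
  sumof (fun w => w \in H0 \/ exists a, pos a /\ wv a 0 w) x.
Proof.
move=> xb; apply: sumof_bind (stable_sumof _ xb) => [w [wb [a wa]]|t y tH yb]; last first.
  by apply: b0_br => //; apply: (subvP H0b).
have wv_w : wv a 0 w by split=> //; apply: b0G.
apply: sumof1; have [a0|an0] := eqVneq a 0.
  by left; apply: wv00; rewrite -a0.
have [->|wn0] := eqVneq w 0; first by left; apply: mem0v.
by right; exists a; split=> //; apply: (posI an0 wv_w).
Qed.

Lemma derived_mem (U : {vspace L}) x y : x \in U -> y \in U -> br x y \in derived br U.
Proof.
move=> xU yU; rewrite (coord_vbasis xU) (coord_vbasis yU) (br_suml lieP).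
apply: memv_suml => i _; rewrite (br_sumr lieP); apply: memv_suml => k _.
rewrite (brZl lieP) (brZr lieP) !memvZ // memv_span //.
by apply/allpairsP; exists ((vbasis U)`_i, (vbasis U)`_k); rewrite /= !mem_nth ?size_tuple.
Qed.

Lemma derived_sub (U V : {vspace L}) : (forall x y, x \in U -> y \in U -> br x y \in V) ->
  (derived br U <= V)%VS.
Proof.
move=> h; apply/span_subvP => z /allpairsP[[x y] /= [xU yU ->]].
by apply: h; apply: vbasis_mem.
Qed.

(** The vectors e, f and t_a reproduce one another under brackets up to nonzero scalars, so they
    would survive in every derived algebra of the solvable [b0]. *)
Lemma pos_opp a : pos a -> pos (- a) -> False.
Proof.
move=> pa pNa; have [e en0 he] := pos_isw pa; have [f hf k1] := kil_dual he en0.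
have paa : wform a a != 0 by rewrite gt_eqF // (isw_pos (pos_isw pa)) ?pos_neq0.
rewrite oppr0 in hf.
have ef : br e f = wdual a by rewrite (@br_opposite a 0) ?k1 ?scale1r // oppr0.
have [_ _ [m hm] _] := borelP.
suff : [/\ e \in iter m (derived br) b0, f \in iter m (derived br) b0
    & wdual a \in iter m (derived br) b0].
  by rewrite hm memv0 (negPf en0); case.
elim: m {hm} => [|m [IHe IHf IHt]].
  by split; [apply: (pos_b0 pa) | apply: (pos_b0 pNa) | apply/(subvP H0b)/wdual_H0].
have dmem := @derived_mem (iter m (derived br) b0).
split; rewrite iterS.
- rewrite -(scale1r e) -(mulVf paa) -scalerA -(br_wdual _ he.2) memvZ //; exact: dmem.
- rewrite -(scale1r f) -(mulVf paa) -scalerA -[wform a a *: f]opprK -scaleNr -wformNl -(br_wdual _ hf.2).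
  by rewrite memvZ // memvN; apply: dmem.
- by rewrite -ef; apply: dmem.
Qed.

Lemma pos_add a b : pos a -> pos b -> wform a b < 0 -> pos (a + b).
Proof.
move=> pa pb neg; have [x xn0 hx] := pos_isw pa; have [y yn0 hy] := pos_isw pb.
have xy := isw_addneg hx xn0 hy yn0 neg.
have hxy := wv_br hx hy; rewrite addr0 in hxy.
apply: (posI _ hxy xy); last by apply: b0_br; [apply: (pos_b0 pa) | apply: (pos_b0 pb)].
apply/eqP => ab0; apply: (pos_opp pa).
by have -> : - a = b by apply/eqP; rewrite eq_sym -addr_eq0 addrC ab0.
Qed.

Definition psum (s : seq (wt H0)) := forall a, a \in s -> pos a.

Lemma psum_real_wt s : psum s -> real_wt (\sum_(a <- s) a).
Proof.
move=> hs; rewrite big_seq; apply: big_ind => //; [exact: real_wt0 | exact: real_wtD |].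
by move=> a /hs; apply: pos_real_wt.
Qed.

(** If the sum were 0, the first root [a] would pair negatively with some [b] of the rest; replacing
    both by the positive root [a + b] shortens the list. *)
Lemma psum_neq0 s : psum s -> s != [::] -> \sum_(a <- s) a != 0.
Proof.
move: {2}(size s) (leqnn (size s)) => m; elim: m s => [|m IH] [|a s] //= sz hs _.
have pa : pos a by apply: hs; rewrite mem_head.
have hs' b : b \in s -> pos b by move=> bs; apply: hs; rewrite in_cons bs orbT.
apply/eqP => sum0; rewrite big_cons in sum0.
have paa : 0 < wform a a by apply: isw_pos (pos_isw pa) (pos_neq0 pa).
have [b bs neg] : exists2 b, b \in s & wform a b < 0.
  apply: real_sum_neg => [b bs|]; first exact: isw_real (pos_isw pa) (pos_isw (hs' b bs)).
  have -> : \sum_(b <- s) wform a b = - wform a a.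
    by rewrite -wform_sumr -wformNr; congr wform; apply/eqP; rewrite -addr_eq0 addrC sum0.
  by rewrite oppr_lt0.
have pab := pos_add pa (hs' b bs) neg.
rewrite (big_rem b bs) /= addrA in sum0.
have : \sum_(c <- a + b :: rem b s) c != 0.
  apply: IH => //=; first by rewrite size_rem //; case: (s) bs sz.
  move=> c; rewrite in_cons => /orP[/eqP->//|/mem_rem]; exact: hs'.
by rewrite big_cons sum0 eqxx.
Qed.

(** All positive roots are allowed as summands, so raising by any of them is directly visible;
    [inQplusE] identifies this monoid with the span of the simple roots. *)
Definition Qplus q := exists2 s, psum s & q = \sum_(a <- s) a.

Lemma Qplus0 : Qplus 0. Proof. by exists [::] => //; rewrite big_nil. Qed.

Lemma QplusD p q : Qplus p -> Qplus q -> Qplus (p + q).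
Proof.
move=> [s hs ->] [t ht ->]; exists (s ++ t); last by rewrite big_cat.
by move=> a; rewrite mem_cat => /orP[/hs|/ht].
Qed.

Lemma Qplus_pos a : pos a -> Qplus a.
Proof. by move=> pa; exists [:: a]; rewrite ?big_seq1 // => b; rewrite inE => /eqP->. Qed.

Lemma Qplus_anti q : Qplus q -> Qplus (- q) -> q = 0.
Proof.
move=> [s hs Dq] [t ht Dn]; apply/eqP/negPn/negP => qn0.
have : \sum_(a <- s ++ t) a != 0.
  apply: psum_neq0; first by move=> a; rewrite mem_cat => /orP[/hs|/ht].
  by case: (s) Dq => //; rewrite big_nil => q0; rewrite q0 eqxx in qn0.
by rewrite big_cat /= -Dq -Dn subrr eqxx.
Qed.

Lemma Qplus_real_wt q : Qplus q -> real_wt q. Proof. by move=> [s hs ->]; apply: psum_real_wt. Qed.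

(** Well-founded induction: [lt] is a strict order and only finitely many weights [mu l] occur. It
    is applied to [wlt] and to its converse. *)
Lemma finwt_ind (lt : wt H0 -> wt H0 -> Prop) (R : wt H0 -> Prop) :
  (forall a, ~ lt a a) -> (forall a b c, lt a b -> lt b c -> lt a c) ->
  (forall l, (forall l', lt (mu l') (mu l) -> R (mu l')) -> R (mu l)) -> forall l, R (mu l).
Proof.
move=> irr tr step l; pose D l := [set l' | `[< lt (mu l') (mu l) >]].
move: {2}(#|D l|) (leqnn #|D l|) => m; elim: m l => [|m IH] l cD; apply: step => l' lt'.
  by move: cD; rewrite leqn0 cards_eq0 => /eqP/setP/(_ l'); rewrite !inE => /asboolP.
apply: IH; rewrite -ltnS (leq_trans _ cD) //; apply: proper_card; apply/properP; split.
  by apply/subsetP => l2; rewrite !inE => /asboolP h; apply/asboolP/tr/lt'.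
exists l'; rewrite !inE; first exact/asboolP.
by apply/asboolP/irr.
Qed.

Definition wlt a b := b != a /\ Qplus (b - a).

Lemma wlt_irr a : ~ wlt a a. Proof. by case; rewrite eqxx. Qed.

Lemma wlt_tr a b c : wlt a b -> wlt b c -> wlt a c.
Proof.
move=> [ne1 q1] [ne2 q2]; have q : Qplus (c - a) by rewrite -[c](subrK b) -addrA; apply: QplusD.
split=> //; apply/eqP => ca; case/eqP: ne1; apply/eqP; rewrite -subr_eq0; apply/eqP.
by apply: Qplus_anti => //; rewrite opprB -ca.
Qed.

Lemma wlt_pos a b : pos b -> wlt a (a + b).
Proof.
move=> pb; split; last by rewrite addrC addKr; apply: Qplus_pos.
by rewrite -subr_eq0 addrC addKr pos_neq0.
Qed.

Lemma pos_inQplus a : pos a -> inQplus br H0 (G 0) b0 a.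
Proof.
move=> pa; have [x xn0 hx] := pos_isw pa; have [l [Dl _]] := wv_mu xn0 hx.
suff : pos (mu l) -> inQplus br H0 (G 0) b0 (mu l) by rewrite Dl; apply.
move: {a pa x xn0 hx Dl} l.
apply: (@finwt_ind wlt (fun a => pos a -> inQplus br H0 (G 0) b0 a)) => [||l IH pl].
- exact: wlt_irr.
- exact: wlt_tr.
have [sl|] := pselect (is_simple_root br H0 (G 0) b0 (mu l)).
  by exists [:: mu l]; rewrite big_seq1; split=> // a; rewrite inE => /eqP->.
move=> ns; have [b [c [pb pc Dl]]] : exists b c, [/\ pos b, pos c & mu l = b + c].
  by apply: contrapT => nex; apply: ns; split=> // -[b [c h]]; apply: nex; exists b, c.
have sub d d' : pos d -> pos d' -> mu l = d + d' -> inQplus br H0 (G 0) b0 d.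
  move=> pd pd' Dd; have [x xn0 hx] := pos_isw pd; have [l' [Dl' _]] := wv_mu xn0 hx.
  rewrite -Dl'; apply: IH; last by rewrite Dl'.
  by rewrite Dl' Dd; apply: wlt_pos.
have [s [hs Ds]] := sub b c pb pc Dl.
have [t [ht Dt]] := sub c b pc pb (etrans Dl (addrC b c)).
exists (s ++ t); split; last by rewrite big_cat /= -Ds -Dt.
by move=> d; rewrite mem_cat => /orP[/hs|/ht].
Qed.

Lemma inQplusE q : inQplus br H0 (G 0) b0 q <-> Qplus q.
Proof.
split=> [[s [hs ->]]|[s hs ->]]; first by exists s => // a /hs[].
elim: s hs => [|a s IH] hs; first by exists [::]; rewrite big_nil.
have [s1 [h1 D1]] := pos_inQplus (hs a (mem_head _ _)).
have [|s2 [h2 D2]] := IH; first by move=> b bs; apply: hs; rewrite in_cons bs orbT.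
exists (s1 ++ s2); split; last by rewrite big_cons big_cat /= -D1 -D2.
by move=> d; rewrite mem_cat => /orP[/h1|/h2].
Qed.

(** The clause [0 < m + size s] excludes the empty sum, so [cone c 0] says that a nontrivial sum of
    copies of [c] and positive roots vanishes. *)
Definition cone c q := exists m s, [/\ (0 < m + size s)%N, psum s & q = c *+ m + \sum_(a <- s) a].

Lemma coneD c p q : cone c p -> cone c q -> cone c (p + q).
Proof.
move=> [m [s [ms hs ->]]] [m' [s' [ms' hs' ->]]]; exists (m + m')%N, (s ++ s'); split.
- by rewrite size_cat addnACA (leq_trans ms) // leq_addr.
- by move=> a; rewrite mem_cat => /orP[/hs|/hs'].
- by rewrite mulrnDr big_cat /= addrACA.
Qed.

(** If both cones contained 0, then -m a and m' a would be sums of positive roots; m' times the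
    first plus m times the second is a vanishing sum of positive roots. *)
Lemma cone_choice a : a != 0 -> exists2 c, c = a \/ c = - a & ~ cone c 0.
Proof.
move=> an0; have [[m [s [ms hs D]]]|] := pselect (cone a 0); last by exists a => //; left.
have [[m' [s' [ms' hs' D']]]|] := pselect (cone (- a) 0); last by exists (- a) => //; right.
exfalso; pose rep k (t : seq (wt H0)) := flatten (nseq k t).
have repS k t : \sum_(b <- rep k t) b = (\sum_(b <- t) b) *+ k.
  by elim: k => [|k IH]; rewrite /rep /= ?big_nil // big_cat /= -/(rep k t) IH mulrS.
have repP k t : psum t -> psum (rep k t).
  by move=> ht b /flattenP[t' /nseqP[-> _]]; apply: ht.
have m'0 : (0 < m')%N.
  rewrite lt0n; apply/eqP => m0; rewrite m0 mulr0n add0r in D'.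
  have sn : s' != [::] by move: ms'; rewrite m0; case: (s').
  by have := psum_neq0 hs' sn; rewrite -D' eqxx.
have sn : s != [::].
  apply/eqP => s0; move: ms D; rewrite s0 addn0 big_nil addr0 => m0 /esym/eqP.
  by rewrite -scaler_nat scaler_eq0 (negPf an0) orbF pnatr_eq0 -leqn0 leqNgt m0.
have : \sum_(b <- rep m' s ++ rep m s') b != 0.
  apply: psum_neq0; first by move=> b; rewrite mem_cat => /orP[]; apply: repP.
  by case: (m') m'0 => // k _; case: (s) sn.
rewrite big_cat /= !repS.
have -> : \sum_(b <- s) b = - (a *+ m) by apply/eqP; rewrite -addr_eq0 addrC -D.
have -> : \sum_(b <- s') b = a *+ m'.
  by apply/eqP; rewrite -subr_eq0 addrC -mulNrn -D'.
by rewrite mulNrn -!mulrnA mulnC addNr eqxx.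
Qed.

(* A maximal solvable subalgebra is cut out by a full half of the roots: otherwise
   adjoin a missing root a or -a, whichever keeps the cone of sums pointed. *)
Lemma root_pos a : a != 0 -> isw a 0 -> pos a \/ pos (- a).
Proof.
move=> an0 wa; apply: contrapT => /not_orP[npa npNa].
have [c ca nc] := cone_choice an0.
have wc : isw c 0.
  by case: ca => ->; rewrite // -[0]oppr0; apply: iswN.
pose P' b := isw b 0 /\ cone c b.
have P'n0 b : P' b -> b != 0 by move=> [_ cb]; apply/eqP => b0_; apply: nc; rewrite -b0_.
pose S w := w \in H0 \/ exists2 b, P' b & wv b 0 w.
have SZ d w : S w -> S (d *: w).
  by case=> [wH|[b pb hw]]; [left; rewrite memvZ | right; exists b => //; apply: wvZ].
have [B' hB'] := sumof_vspace SZ.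
pose lt b b' := cone c (b' - b).
have lt_irr b : ~ lt b b by rewrite /lt subrr.
have lt_tr b1 b2 b3 : lt b1 b2 -> lt b2 b3 -> lt b1 b3.
  by rewrite /lt => h1 h2; rewrite -[b3](subrK b2) -addrA; apply: coneD.
(* The level of [b] counts the weights below it in the order given by the cone. Each further derived
   algebra raises the level by one, while it cannot exceed [N]. *)
pose lev m b := P' b /\ (m <= #|[set l | `[< lt (mu l) b >]]|)%N.
have brP b b' x y : wv b 0 x -> wv b' 0 y -> P' b -> P' b' -> br x y != 0 -> P' (b + b').
  move=> hx hy [_ cb] [_ cb'] xy; split; last exact: coneD.
  by exists (br x y) => //; have := wv_br hx hy; rewrite addr0.
have levS m b b' x y : wv b 0 x -> wv b' 0 y -> lev m b -> P' b' -> br x y != 0 ->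
    lev m.+1 (b + b').
  move=> hx hy [pb cb] pb' xy; split; first exact: (brP b b' x y).
  apply: leq_ltn_trans cb _; apply: proper_card; apply/properP; split.
    apply/subsetP => l; rewrite !inE => /asboolP h; apply/asboolP; apply: lt_tr h _.
    by rewrite /lt addrC addKr; case: pb'.
  have [xb xbn0 hxb] := pb.1; have [l [Dl _]] := wv_mu xbn0 hxb.
  exists l; rewrite !inE Dl; first by apply/asboolP; rewrite /lt addrC addKr; case: pb'.
  by apply/asboolP/lt_irr.
have subB' : subalg br B'.
  move=> x y /hB' hx /hB' hy; apply/hB'.
  apply: (sumof_br hx hy) => {hx hy} x1 y1 Sx Sy.
  apply: sumof1; case: Sx Sy => [xH|[b pb hx]] [yH|[b' pb' hy]].
  - by left; rewrite H0ab ?mem0v.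
  - by right; exists b' => //; rewrite (weight_vecT xH hy.2); apply: wvZ.
  - right; exists b => //; rewrite (brC lieP) (weight_vecT yH hx.2) -scaleNr; exact: wvZ.
  have [->|xy] := eqVneq (br x1 y1) 0; first by left; apply: mem0v.
  right; exists (b + b'); first exact: (brP b b' x1 y1).
  by have := wv_br hx hy; rewrite addr0.
have solB' : solvable br B'.
  have S_Z m d w : (exists2 b, lev m b & wv b 0 w) -> exists2 b, lev m b & wv b 0 (d *: w).
    by move=> [b lb hw]; exists b => //; apply: wvZ.
  have step m : forall x, x \in iter m.+1 (derived br) B' ->
      sumof (fun w => exists2 b, lev m b & wv b 0 w) x.
    elim: m => [|m IH] x.
      have [V hV] := sumof_vspace (S_Z 0%N).
      rewrite /= => xd; apply/hV; move: x xd; apply/subvP/derived_sub => x y /hB' hx /hB' hy; apply/hV.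
      apply: (sumof_br hx hy) => {hx hy} x1 y1 Sx Sy.
      case: Sx Sy => [xH|[b pb hx]] [yH|[b' pb' hy]].
      - by rewrite H0ab //; apply: sumof0.
      - by apply: sumof1; exists b' => //; rewrite (weight_vecT xH hy.2); apply: wvZ.
      - by apply: sumof1; exists b => //; rewrite (brC lieP) (weight_vecT yH hx.2) -scaleNr; exact: wvZ.
      have [->|xy] := eqVneq (br x1 y1) 0; first exact: sumof0.
      apply: sumof1; exists (b + b'); first by split=> //; apply: (brP b b' x1 y1).
      by have := wv_br hx hy; rewrite addr0.
    have [V hV] := sumof_vspace (S_Z m.+1).
    rewrite iterS => xd; apply/hV; move: x xd; apply/subvP/derived_sub => x y /IH hx /IH hy; apply/hV.
    apply: (sumof_br hx hy) => {hx hy} x1 y1 [b lb hx] [b' lb' hy].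
    have [->|xy] := eqVneq (br x1 y1) 0; first exact: sumof0.
    apply: sumof1; exists (b + b'); first by apply: (levS m b b' x1 y1) => //; case: lb'.
    by have := wv_br hx hy; rewrite addr0.
  (* The first derived algebra only removes [H0] and has level 0, so level N + 1, impossible with N
     indices, is reached after N + 2 steps. *)
  exists N.+2; apply/eqP; rewrite -subv0; apply/subvP => x /step[s sP ->].
  rewrite memv0 big_seq big1 // => w /sP[b [_ cb] _].
  by move: (leq_trans cb (max_card _)); rewrite card_ord ltnn.
have b0B' : (b0 <= B')%VS.
  apply/subvP => x /b0_sumof hx; apply/hB'; apply: sumof_bind hx => w [wH|[b [pb hw]]].
    by apply: sumof1; left.
  apply: sumof1; right; exists b => //; split; first exact: pos_isw.
  exists 0%N, [:: b]; split=> //; last by rewrite mulr0n add0r big_seq1.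
  by move=> b1; rewrite inE => /eqP->.
have B'G : (B' <= G 0%R)%VS.
  apply/subvP => x /hB'; apply: (@sumof_ind _ _ _ (fun x => x \in G 0));
    [exact: mem0v | by move=> *; rewrite memvD |].
  by move=> w [/(subvP H0G)//|[b _ []]].
have [_ _ _ /(_ B' b0B' B'G subB' solB') B'b] := borelP.
have [x xn0 hx] := wc.
have xb : x \in b0.
  rewrite -B'b; apply/hB'/sumof1; right; exists c => //; split=> //.
  by exists 1%N, [::]; split=> //; rewrite big_nil addr0.
have cn0 : c != 0 by case: ca => ->; rewrite ?oppr_eq0.
have pc := posI cn0 hx xn0 xb.
by case: ca => Dc; [apply: npa | apply: npNa]; rewrite -Dc.
Qed.

(** * The Casimir operator of g_0 and maximal vectors *)

Lemma Yd_exists l : exists2 z, wv (- mu l) (- gr l) z & forall y, kil z y = coord Y l y.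
Proof.
have [x _ hx|c x y|z _ hz] := @killing_dual _ _ _ lieP fullv (coord Y l).
- by apply: ndK => y; apply: hx; rewrite memvf.
- by rewrite linearP.
(* Only the component of weight [- mu l] and degree [- gr l] is kept; by orthogonality this does not
   change the pairing with the basis. *)
pose P m := (mu m == - mu l) && (gr m == - gr l).
pose z' := \sum_(m | P m) coord Y m z *: Y`_m.
exists z'.
  rewrite /z'; apply: big_ind => [|x y|m /andP[/eqP<- /eqP<-]]; [exact: wv0 | exact: wvD |].
  exact/wvZ/wvY.
move=> y; rewrite -hz ?memvf // (coord_basis bY (memvf y)) !(killing_sumr lieP).
apply: eq_bigr => k _; rewrite !(killingZr lieP); congr (_ * _).
have [/andP[/eqP e1 /eqP e2]|ne] := boolP ((mu k == mu l) && (gr k == gr l)).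
  rewrite [in RHS](coord_basis bY (memvf z)) /z' !(killing_suml lieP) [RHS](bigID P) /=.
  rewrite [X in _ + X]big1 ?addr0 // => m nP.
  rewrite (killingZl lieP) (kil_orth (wvY m) (wvY k)) ?mulr0 //.
  by rewrite e1 e2 !addr_eq0 -negb_and.
have -> : kil z Y`_k = 0.
  rewrite hz ?memvf // coord_free ?(basis_free bY) //.
  by have [kl|//] := eqVneq k l; rewrite kl !eqxx in ne.
rewrite /z' (killing_suml lieP) big1 // => m /andP[/eqP e1 /eqP e2].
rewrite (killingZl lieP) (kil_orth (wvY m) (wvY k)) ?mulr0 //.
by rewrite e1 e2 ![- _ + _]addrC !subr_eq0 -negb_and.
Qed.

Definition Yd l := s2val (cid2 (Yd_exists l)).

Lemma wvYd l : wv (- mu l) (- gr l) (Yd l). Proof. exact: s2valP (cid2 (Yd_exists l)). Qed.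

Lemma kilYd l y : kil (Yd l) y = coord Y l y. Proof. exact: (s2valP' (cid2 (Yd_exists l))). Qed.

Lemma kilYYd l : kil Y`_l (Yd l) = 1.
Proof. by rewrite killingC kilYd coord_free ?(basis_free bY) // eqxx. Qed.

Lemma Yd_expand y : y = \sum_(l < N) kil y Y`_l *: Yd l.
Proof.
apply/eqP; rewrite -subr_eq0; apply/eqP/ndK => z.
rewrite (coord_basis bY (memvf z)) (killing_sumr lieP) big1 // => m _.
rewrite (killingZr lieP) (killingBl lieP) (killing_suml lieP) (bigD1 m) //=.
rewrite (killingZl lieP) kilYd coord_free ?(basis_free bY) // eqxx mulr1 big1 => [|l lm].
  by rewrite addr0 subrr mulr0.
by rewrite (killingZl lieP) kilYd coord_free ?(basis_free bY) // eq_sym (negPf lm) mulr0.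
Qed.

(** The Casimir operator of g_0 for the restricted Killing form of g, acting on all of g;
    degree-zero basis vectors are paired with their duals. *)
Definition casimir v := \sum_(l < N | gr l == 0) br Y`_l (br (Yd l) v).

(** [ad x] acts on the degree-zero basis vectors and on their duals by negative transposed matrices,
    so the two double sums cancel. *)
Lemma casimir_comm x v : x \in G 0 -> br x (casimir v) = casimir (br x v).
Proof.
move=> xG; rewrite /casimir (br_sumr lieP).
pose A (l k : 'I_N) : F := coord Y k (br x Y`_l).
have A0 l k : gr l != gr k -> A l k = 0.
  move=> ne; apply/eqP/negPn/negP => cn0; case/eqP: ne.
  by rewrite (coord_gr (G_br xG (Ygr l)) cn0) add0r.
have D1 l : gr l == 0 -> br x Y`_l = \sum_(k | gr k == 0) A l k *: Y`_k.
  move=> /eqP gl; rewrite {1}(coord_basis bY (memvf (br x Y`_l))) (bigID (fun k => gr k == 0)) /=.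
  by rewrite [X in _ + X]big1 ?addr0 // => k gk; rewrite -/(A l k) A0 ?scale0r // gl eq_sym.
have D2 l : gr l == 0 -> br x (Yd l) = - \sum_(k | gr k == 0) A k l *: Yd k.
  move=> /eqP gl; rewrite {1}(Yd_expand (br x (Yd l))) -sumrN (bigID (fun k => gr k == 0)) /=.
  have E (k : 'I_N) : kil (br x (Yd l)) Y`_k = - A k l.
    by rewrite (brC lieP) (killingNl lieP) (killing_inv lieP) kilYd.
  rewrite [X in _ + X]big1 ?addr0 => [|k gk]; last by rewrite E A0 ?oppr0 ?scale0r // gl.
  by apply: eq_bigr => k _; rewrite E scaleNr.
have E l : gr l == 0 -> br x (br Y`_l (br (Yd l) v)) =
   \sum_(k | gr k == 0) A l k *: br Y`_k (br (Yd l) v)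
   - \sum_(k | gr k == 0) A k l *: br Y`_l (br (Yd k) v) + br Y`_l (br (Yd l) (br x v)).
  move=> gl; rewrite (jacobi lieP) D1 // [br x (br _ v)](jacobi lieP) D2 // (brDr lieP) addrA.
  congr (_ + _); rewrite (br_suml lieP) (brNl lieP) (brNr lieP); congr (_ - _).
    by apply: eq_bigr => k _; rewrite (brZl lieP).
  rewrite (br_suml lieP) (br_sumr lieP).
  by apply: eq_bigr => k _; rewrite (brZl lieP) (brZr lieP).
rewrite (eq_bigr _ E) big_split /= sumrB [X in X - _]exchange_big /= subrr add0r.
by [].
Qed.

Definition maxvec j lam v := [/\ v != 0, wv lam j v &
  forall b x, pos b -> wv b 0 x -> br x v = 0].

(** The sum of the positive roots of g_0, usually written 2 rho; each occurs once because root
    spaces are lines. *)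
Definition rho2 := \sum_(l | (gr l == 0) && `[< pos (mu l) >]) mu l.

(** The zero-weight terms give (lam, lam). A positive root [mu l] contributes (lam, mu l) through
    the commutator of [Yd l] with its partner, and a negative one contributes 0 because [Yd l]
    already kills [v]. *)
Lemma casimir_maxvec j lam v : maxvec j lam v -> casimir v = (wform lam lam + wform lam rho2) *: v.
Proof.
move=> [vn0 hv vmax].
pose Z l := (gr l == 0) && (mu l == 0).
have DT : wform lam lam = \sum_(l | Z l) (lam (vsproj H0 Y`_l) : F) * lam (vsproj H0 (Yd l)).
  rewrite /wform {1}(coord_basis bY (memvf (wdual lam))) !linear_sum (bigID Z) /=.
  rewrite [X in _ + X]big1 ?addr0 => [|l nZ].
    apply: eq_bigr => l /andP[/eqP gl /eqP ml]; rewrite !linearZ /= mulrC; congr (_ * _).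
    rewrite -kilYd killingC kil_wdual //; apply: wv00; have := wvYd l.
    by rewrite gl ml !oppr0.
  have [->|cn0] := eqVneq (coord Y l (wdual lam)) 0; first by rewrite scale0r !linear0.
  by have [e1 e2] := coord_wv (wvH0 (wdual_H0 lam)) cn0; rewrite /Z e1 e2 !eqxx in nZ.
rewrite /casimir DT scalerDl scaler_suml /rho2 wform_sumr scaler_suml.
rewrite (bigID (fun l => mu l == 0)) /=; congr (_ + _).
  apply: eq_bigr => l /andP[/eqP gl /eqP ml].
  have YH : Y`_l \in H0 by apply: wv00; rewrite -gl -ml.
  have YdH : Yd l \in H0 by apply: wv00; have := wvYd l; rewrite gl ml !oppr0.
  by rewrite (weight_vecT YdH hv.2) (brZr lieP) (weight_vecT YH hv.2) scalerA mulrC.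
rewrite (bigID (fun l => `[< pos (mu l) >])) /= [X in _ + X]big1 ?addr0; last first.
  move=> l /andP[/andP[/eqP gl ml] /asboolP npl].
  have wl : isw (mu l) 0 by rewrite -gl; apply: isw_mu.
  have [//|pN] := root_pos ml wl.
  rewrite [br (Yd l) v](vmax _ _ pN) ?(br0r lieP) //.
  by have := wvYd l; rewrite gl oppr0.
apply: eq_big => l; first by apply/idP/idP => [/andP[/andP[-> _] ->]//|/andP[-> pl]];
  rewrite pl /= andbT; apply: pos_neq0; apply/asboolP.
move=> /andP[/andP[/eqP gl ml] /asboolP pl].
rewrite (jacobi lieP) [br Y`_l v](vmax _ _ pl) ?(br0r lieP) ?addr0; last by rewrite -gl.
by rewrite (br_opposite (wvY l) (wvYd l)) kilYYd scale1r (br_wdual _ hv.2).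
Qed.

Lemma maxvec_above j (U : {vspace L}) a w : (forall x u, x \in b0 -> u \in U -> br x u \in U) ->
  w \in U -> w != 0 -> wv a j w ->
  exists lam v, [/\ v \in U, maxvec j lam v & Qplus (lam - a)].
Proof.
move=> stU wU wn0 hw; have [l [Dl _]] := wv_mu wn0 hw; rewrite -Dl in hw *.
move: {a Dl} l w wU wn0 hw.
apply: (@finwt_ind (fun a b => wlt b a) (fun a => forall w, w \in U -> w != 0 -> wv a j w ->
  exists lam v, [/\ v \in U, maxvec j lam v & Qplus (lam - a)])).
- exact: wlt_irr.
- by move=> a b c h1 h2; apply: wlt_tr h2 h1.
move=> l IH w wU wn0 hw.
have [[b [x [pb hx xw]]]|nex] := pselect (exists b x, [/\ pos b, wv b 0 x & br x w != 0]).
  have hxw : wv (mu l + b) j (br x w) by have := wv_br hx hw; rewrite add0r addrC.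
  have [l' [Dl' _]] := wv_mu xw hxw; rewrite -Dl' in hxw.
  have [||lam [v [vU mv q]]] := IH l' _ (br x w) _ xw hxw.
  - by rewrite Dl'; apply: wlt_pos.
  - by apply: stU => //; apply: (pos_b0 pb).
  exists lam, v; split=> //; rewrite -[lam](subrK (mu l')) -addrA; apply: QplusD => //.
  by rewrite Dl' addrC addKr; apply: Qplus_pos.
exists (mu l), w; split=> //; last by rewrite subrr; apply: Qplus0.
split=> // b x pb hx; apply/eqP/negPn/negP => h; apply: nex; by exists b, x.
Qed.

Lemma maxvec_dominant j lam v q : maxvec j lam v -> Qplus q -> 0 <= wform lam q.
Proof.
move=> [vn0 hv vmax] [s hs ->]; rewrite wform_sumr big_seq; apply: sumr_ge0 => b /hs pb.
have wl : isw lam j by exists v.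
rewrite real_leNgt ?real0 ?(isw_real wl (pos_isw pb)) //; apply/negP => neg.
have [x xn0 hx] := pos_isw pb.
by have := raise_neq0 hx xn0 hv.2 vn0 neg; rewrite (vmax _ _ pb hx) eqxx.
Qed.

(** Lowering [y] by [f] lands on the line of [x], which [x] kills; the chain argument then applies
    with [x] and [f] exchanged. *)
Lemma double_not_root a : pos a -> isw (a + a) 0 -> False.
Proof.
move=> pa [y yn0 hy]; have [x xn0 hx] := pos_isw pa.
have [f hf k1] := kil_dual hx xn0; rewrite oppr0 in hf.
have paa : 0 < wform a a by apply: isw_pos (pos_isw pa) (pos_neq0 pa).
have hx' : wv (- - a) (- 0) x by rewrite opprK oppr0.
apply: (chain_false hf hx' _ _ yn0 hy.2).
- by rewrite killingC.
- by rewrite oppr_eq0 pos_neq0.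
- have hfy : wv a 0 (br f y) by have := wv_br hf hy; rewrite addKr addr0.
  have /vlineP[c ->] := wv_line (pos_neq0 pa) hx xn0 hfy.
  by rewrite (brZr lieP) (br_xx lieP) scaler0.
by rewrite wformNr oppr_lt0 wformDl addr_gt0.
Qed.

(* For simple a, ad e_a and ad f_a preserve the span of the other positive root
   spaces, on which [e_a, f_a] therefore has trace 0. *)
Lemma rho2_simple a : is_simple_root br H0 (G 0) b0 a -> 0 <= wform rho2 a.
Proof.
move=> [pa nsum]; rewrite -/(pos a) in pa.
have [e en0 he] := pos_isw pa; have [f hf k1] := kil_dual he en0.
have ef : br e f = wdual a by rewrite (br_opposite he hf) k1 scale1r.
rewrite oppr0 in hf.
pose P l := (gr l == 0) && `[< pos (mu l) >].
pose P' l := P l && (mu l != a).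
have paa : 0 < wform a a by apply: isw_pos (pos_isw pa) (pos_neq0 pa).
rewrite /rho2 -/P wform_suml (bigID (fun l => mu l == a)) /=.
suff -> : \sum_(l | P l && (mu l != a)) wform (mu l) a = 0.
  by rewrite addr0; apply: sumr_ge0 => l /andP[_ /eqP->]; apply: ltW.
have -> : \sum_(l | P l && (mu l != a)) wform (mu l) a
    = \sum_(l | P' l) coord Y l (br (wdual a) Y`_l).
  apply: eq_bigr => l _; rewrite (br_wdual _ (Ywt l)) linearZ /= coord_free ?(basis_free bY) //.
  by rewrite eqxx mulr1.
have stab c x : wv c 0 x -> (forall b, pos b -> b != a -> isw (c + b) 0 -> pos (c + b) /\ c + b != a) ->
    forall l m, P' l -> ~~ P' m -> coord Y m (ad br x Y`_l) = 0.
  move=> hx hc l m /andP[/andP[/eqP gl /asboolP pl] la] nPm; rewrite (adE lieP).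
  apply/eqP/negPn/negP => cn0; have hxl := wv_br hx (wvY l).
  have [e1 e2] := coord_wv hxl cn0; rewrite gl addr0 in e2.
  case/negP: nPm; rewrite /P' /P e1 e2 eqxx /=.
  have [|p1 p2] := hc _ pl la; first by rewrite -e1 -e2; apply: isw_mu.
  by rewrite p2 andbT; apply/asboolP.
rewrite -ef.
under eq_bigr => l _ do rewrite -(adE lieP) (ad_br lieP) add_lfunE opp_lfunE !comp_lfunE linearB /=.
rewrite sumrB (ptr_comm bY (stab _ _ he _) (stab _ _ hf _)) ?subrr //.
- move=> b pb ba iw; split; last first.
    by rewrite -subr_eq0 addrC addKr pos_neq0.
  have abn0 : a + b != 0.
    have -> : a + b = \sum_(c <- [:: a; b]) c by rewrite big_cons big_seq1.
    by apply: psum_neq0 => // c; rewrite !inE => /orP[/eqP->|/eqP->].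
  have [//|pN] := root_pos abn0 iw.
  have : \sum_(c <- [:: a; b; - (a + b)]) c != 0.
    by apply: psum_neq0 => // c; rewrite !inE => /or3P[/eqP->|/eqP->|/eqP->].
  by rewrite !big_cons big_nil addr0 addrA subrr eqxx.
- move=> b pb ba iw; split; last first.
    apply/eqP => Da; apply: (double_not_root pa).
    have -> : a + a = b by rewrite -{2}Da addNKr.
    exact: pos_isw.
  have bn0 : - a + b != 0 by rewrite addrC subr_eq0.
  have [//|pN] := root_pos bn0 iw.
  case: nsum; exists b, (- (- a + b)); split=> //.
  by rewrite opprD opprK addrC addrNK.
Qed.

Lemma rho2_ge0 q : Qplus q -> 0 <= wform rho2 q.
Proof.
move/inQplusE => [s [hs ->]]; rewrite wform_sumr big_seq; apply: sumr_ge0 => a /hs.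
exact: rho2_simple.
Qed.

Lemma coord_sum_neq0 (s : seq L) l : coord Y l (\sum_(w <- s) w) != 0 ->
  exists2 w, w \in s & coord Y l w != 0.
Proof.
move=> h; apply: contrapT => nex; case/eqP: h; rewrite linear_sum big_seq big1 // => w ws.
by apply/eqP/negPn/negP => c; apply: nex; exists w.
Qed.

Lemma G0_sumof x : x \in G 0 -> sumof (fun w => exists2 a, wv a 0 w & a = 0 \/ pos a \/ pos (- a)) x.
Proof.
move=> xG; apply: sumof_bind (stable_sumof _ xG) => [w [wG [a wa]]|t y tH yG]; last first.
  by rewrite -[0]addr0; apply: G_br => //; apply: (subvP H0G).
have [->|wn0] := eqVneq w 0; first exact: sumof0.
have hw : wv a 0 w by [].
apply: sumof1; exists a => //; have [->|an0] := eqVneq a 0; first by left.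
by right; apply: root_pos => //; exists w.
Qed.

Lemma maxvec_irred j lam v : maxvec j lam v ->
  exists A : {vspace L}, [/\ irred_submod br (G 0) (G j) A, highest_weight_of br H0 b0 A lam & v \in A].
Proof.
move=> mv; have [vn0 hv vmax] := mv.
pose cl (U : {vspace L}) := v \in U /\
  forall b f u, pos b -> wv (- b) 0 f -> u \in U -> br f u \in U.
have [||A hA] := @vspace_of_pred _ _ (fun x => forall U, cl U -> x \in U).
- by move=> U _; apply: mem0v.
- by move=> c x y hx hy U hU; rewrite memvD ?memvZ ?hx ?hy.
have Amin U : cl U -> (A <= U)%VS by move=> cU; apply/subvP => x /hA; apply.
have clA : cl A.
  split=> [|b f u pb hf /hA hu]; first by apply/hA => U [].
  by apply/hA => U cU; apply: (cU.2 b) => //; apply: hu.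
have [vA fA] := clA.
have stA : ad_stable br (G 0) A.
  (* [A'] is the part of [A] that [G 0] maps into [A]. It contains [v] and is closed under lowering,
     so minimality of [A] gives equality. *)
  have [||A' hA'] := @vspace_of_pred _ _ (fun x => x \in A /\ forall y, y \in G 0 -> br y x \in A).
  - by split=> [|y _]; rewrite ?(br0r lieP) mem0v.
  - move=> c x y [xA hx] [yA hy]; split; first by rewrite memvD ?memvZ.
    by move=> z zG; rewrite (br_linr lieP) memvD ?memvZ ?hx ?hy.
  have /Amin/subvP sub : cl A'.
    split.
      apply/hA'; split=> // y /G0_sumof[s sP ->]; rewrite (br_suml lieP) big_seq memv_suml //.
      move=> w /sP[b hb [b0_|[pb|pNb]]].
      - have wH : w \in H0 by apply: wv00; rewrite -b0_.
        by rewrite (weight_vecT wH hv.2) memvZ.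
      - by rewrite (vmax _ _ pb hb) mem0v.
      - by apply: (fA (- b)) => //; rewrite opprK.
    move=> b f u pb hf /hA'[uA hu]; apply/hA'; split; first exact: (fA b).
    move=> y yG; rewrite (jacobi lieP) memvD //.
      by apply: hu; rewrite -[0]addr0; apply: G_br => //; case: hf.
    by apply: (fA b) => //; apply: hu.
  by move=> x y xG /sub/hA'[_]; apply.
have RZ d w : (exists2 a, wlt a lam & wv a j w) -> exists2 a, wlt a lam & wv a j (d *: w).
  by move=> [a la hw]; exists a => //; apply: wvZ.
have [R hR] := sumof_vspace RZ.
have down a b : pos b -> wlt (- b + a) a.
  by move=> pb; have := wlt_pos (- b + a) pb; rewrite addrAC addNr add0r.
have AR : (A <= <[v]> + R)%VS.
  apply: Amin; split; first by rewrite memvE addvSl.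
  move=> b f u pb hf /memv_addP[_ /vlineP[c ->] [r /hR[s sP ->] ->]].
  rewrite (brDr lieP) (brZr lieP); apply: (subvP (addvSr _ _)).
  rewrite memvD ?memvZ //.
    apply/hR/sumof1; exists (- b + lam); first exact: down.
    by have := wv_br hf hv; rewrite add0r.
  rewrite (br_sumr lieP) big_seq memv_suml // => w /sP[a la hw].
  apply/hR/sumof1; exists (- b + a); first by apply: wlt_tr la; apply: down.
  by have := wv_br hf hw; rewrite add0r.
(* The weight [lam] occurs in [A] only on the line of [v], so a maximal vector of a submodule is
   either a multiple of [v] or of strictly lower weight. *)
have wtA a x : x \in A -> x != 0 -> wv a j x -> (a = lam /\ x \in <[v]>%VS) \/ wlt a lam.
  move=> /(subvP AR)/memv_addP[_ /vlineP[c ->] [r /hR[s sP Dr] Dx]] xn0 hx.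
  have [al|anl] := eqVneq a lam.
    left; split=> //; have hr : wv lam j r.
      have -> : r = x - c *: v by rewrite Dx addrC addKr.
      by rewrite addrC -scaleNr; apply: wv_lin => //; rewrite -al.
    have [r0|rn0] := eqVneq r 0; first by rewrite Dx r0 addr0; apply/vlineP; exists c.
    have [l cl0] := exists_coord rn0; have [e1 _] := coord_wv hr cl0.
    rewrite Dr in cl0; have [w ws cw] := coord_sum_neq0 cl0.
    have [a' la' hw] := sP w ws; have [e2 _] := coord_wv hw cw.
    by move: la'; rewrite -e2 e1 => /wlt_irr.
  right; have [l cl0] := exists_coord xn0; have [e1 _] := coord_wv hx cl0.
  have cv0 : coord Y l v = 0.
    apply/eqP/negPn/negP => cn0; have [e2 _] := coord_wv hv cn0.
    by rewrite -e1 e2 eqxx in anl.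
  rewrite Dx linearD linearZ /= cv0 mulr0 add0r Dr in cl0.
  have [w ws cw] := coord_sum_neq0 cl0.
  have [a' la' hw] := sP w ws; have [e2 _] := coord_wv hw cw.
  by rewrite -e1 e2.
have AG : (A <= G j)%VS.
  apply: subv_trans AR _; rewrite subv_add -memvE; apply/andP; split; first by case: hv.
  by apply/subvP => r /hR[s sP ->]; rewrite big_seq memv_suml // => w /sP[a _ []].
exists A; split=> //; last first.
  exists v => //; split=> //; first by case: hv.
  move=> b /b0_sumof[s sP ->]; rewrite (br_suml lieP) big_seq memv_suml // => w /sP[wH|[a [pa ha]]].
    by rewrite (weight_vecT wH hv.2) memvZ ?memv_line.
  by rewrite (vmax _ _ pa ha) mem0v.
split=> //; first by apply/eqP => A0; rewrite A0 memv0 (negPf vn0) in vA.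
move=> U UA stU; have [->|Un0] := eqVneq U 0%VS; [by left | right].
suff vU : v \in U.
  apply/eqP; rewrite eqEsubv UA; apply: Amin; split=> // b f u pb hf uU.
  by apply: stU => //; case: hf.
have [w [a [wU wn0 hw]]] : exists w a, [/\ w \in U, w != 0 & wv a j w].
  apply: contrapT => nex; case/negP: Un0; rewrite -vpick0.
  have [t x tH xU|s sP ->] := stable_sumof _ (memv_pick U).
    by apply: stU => //; apply: (subvP H0G).
  apply/eqP; rewrite big_seq big1 // => w /sP[wU [a wa]].
  apply/eqP/negPn/negP => wn0; apply: nex; exists w, a; split=> //; split=> //.
  by apply/(subvP AG)/(subvP UA).
have [x u xb uU|lam' [v' [v'U mv' _]]] := maxvec_above _ wU wn0 hw.
  by apply: stU => //; apply: b0G.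
have [v'n0 hv' _] := mv'.
have [[_ /vlineP[c Dv']]|[ne q]] := wtA _ _ (subvP UA _ v'U) v'n0 hv'.
  have cn0 : c != 0 by apply/eqP => c0; rewrite Dv' c0 scale0r eqxx in v'n0.
  by rewrite -[v]scale1r -(mulVf cn0) -scalerA -Dv' memvZ.
exfalso.
have OmA x : x \in A -> casimir x = (wform lam lam + wform lam rho2) *: x.
  have OmS c u1 u2 : casimir (c *: u1 + u2) = c *: casimir u1 + casimir u2.
    rewrite /casimir scaler_sumr -big_split /=; apply: eq_bigr => l _.
    by rewrite !(br_linr lieP).
  have [||K hK] := @vspace_of_pred _ _ (fun x => casimir x = (wform lam lam + wform lam rho2) *: x).
  - by rewrite /casimir scaler0 big1 // => l _; rewrite !(br0r lieP).
  - by move=> c u1 u2 h1 h2; rewrite OmS h1 h2 scalerDr !scalerA mulrC.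
  suff /Amin/subvP sub : cl K by move=> /sub/hK.
  split; first by apply/hK; apply: (casimir_maxvec mv).
  move=> b f u pb [fG _] /hK hu; apply/hK; rewrite -casimir_comm // hu.
  by rewrite (brZr lieP).
have := OmA _ (subvP UA _ v'U); rewrite (casimir_maxvec mv') => /eqP.
rewrite -subr_eq0 -scalerBl scaler_eq0 (negPf v'n0) orbF subr_eq0 => /eqP.
set q0 := lam - lam' in q.
have q0n0 : q0 != 0 by rewrite subr_eq0.
have qpos : 0 < wform q0 q0 by apply: wform_gt0 => //; apply: Qplus_real_wt.
have Dlam : lam = lam' + q0 by rewrite /q0 addrC subrK.
clearbody q0; rewrite Dlam !wformDl !wformDr [wform q0 lam']wformC => eqn.
(* The eigenvalue for [lam = lam' + q0] exceeds that for [lam'] by 2 (lam', q0) + (q0, q0) + (q0, 2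
   rho), whose outer terms are nonnegative and whose middle term is positive. *)
have h1 := maxvec_dominant mv' q.
have h2 := rho2_ge0 q; rewrite wformC in h2.
have : 0 < wform lam' q0 + (wform lam' q0 + wform q0 q0) + wform q0 rho2.
  by rewrite ltr_wpDr // ltr_wpDl // ltr_wpDl.
suff -> : wform lam' q0 + (wform lam' q0 + wform q0 q0) + wform q0 rho2 = 0 by rewrite ltxx.
transitivity ((wform lam' lam' + wform lam' q0 + (wform lam' q0 + wform q0 q0) + (wform lam' rho2 + wform q0 rho2))
   - (wform lam' lam' + wform lam' rho2)); first by ring.
by rewrite -eqn subrr.
Qed.

(** * Every weight lies below a highest weight or a highest root *)

Lemma highest_above a j : isw a j ->
  exists2 lam, highest_weight_gj br H0 (G 0) b0 (G j) lam & Qplus (lam - a).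
Proof.
move=> [w wn0 hw].
have [x u xb uG|lam [v [_ mv q]]] := @maxvec_above j (G j) a w _ hw.1 wn0 hw.
  by rewrite -[j]add0r; apply: G_br => //; apply: b0G.
have [A [irr hA _]] := maxvec_irred mv; exists lam => //; by exists A.
Qed.

(** A maximal vector above a positive root generates an irreducible ideal of g_0. Its Killing
    radical is a proper submodule, hence 0, and this makes the ideal simple as a Lie algebra. The
    root [b] is the starting point when [a = 0]. *)
Lemma highest_root_above a b : isw a 0 -> pos b ->
  exists2 theta, highest_root br H0 (G 0) b0 theta & Qplus (theta - a).
Proof.
move=> wa pb.
have [b' pb' q'] : exists2 b', pos b' & Qplus (b' - a).
  have [->|an0] := eqVneq a 0; first by exists b => //; rewrite subr0; apply: Qplus_pos.
  have [pa|pNa] := root_pos an0 wa; first by exists a => //; rewrite subrr; apply: Qplus0.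
  by exists (- a) => //; apply: QplusD; apply: Qplus_pos.
have [w wn0 hw] := pos_isw pb'.
have [x u xb uG|lam [v [_ mv q]]] := @maxvec_above 0 (G 0) b' w _ hw.1 wn0 hw.
  by rewrite -[0]add0r; apply: G_br => //; apply: b0G.
have [A [irr hA vA]] := maxvec_irred mv.
exists lam; last by rewrite -[lam](subrK b') -addrA; apply: QplusD.
have [AG An0 stA irrA] := irr; have [vn0 hv _] := mv.
have lamn0 : lam != 0.
  apply/eqP => l0; rewrite l0 sub0r in q; case/eqP: (pos_neq0 pb').
  exact: Qplus_anti (Qplus_pos pb') q.
exists A; split=> //.
have subA x y : x \in A -> y \in A -> br x y \in A by move=> xA; apply: stA; apply: (subvP AG).
have [f hf k1] := kil_dual hv vn0; rewrite oppr0 in hf.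
have ppos : wform lam lam != 0 by rewrite gt_eqF // (@isw_pos lam 0) //; exists v.
have TA : wdual lam \in A.
  have <- : br v f = wdual lam by rewrite (@br_opposite lam 0) ?k1 ?scale1r // oppr0.
  by rewrite (brC lieP) memvN; apply: stA => //; case: hf.
have fA : f \in A.
  rewrite -[f]scale1r -(mulVf ppos) -scalerA memvZ // -[_ *: f]opprK -scaleNr -wformNl -(br_wdual _ hf.2).
  by rewrite memvN (brC lieP) memvN; apply: stA => //; case: hf.
have ndA x : x \in A -> (forall y, y \in A -> kil x y = 0) -> x = 0.
  have [||J hJ] := @vspace_of_pred _ _ (fun x => x \in A /\ forall y, y \in A -> kil x y = 0).
  - by split=> [|y _]; rewrite ?mem0v ?killing0l.
  - move=> c x1 x2 [h1 k1'] [h2 k2]; split; first by rewrite memvD ?memvZ.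
    by move=> y yA; rewrite (killing_linl lieP) k1' ?k2 // mulr0 addr0.
  have [|x1 y x1G /hJ[yA hy]|J0|JA] := irrA J.
  - by apply/subvP => x1 /hJ[].
  - apply/hJ; split; first exact: stA.
    move=> z zA; rewrite (brC lieP) (killingNl lieP) (killing_inv lieP) hy ?oppr0 //.
    exact: stA.
  - by move=> xA hx; apply/eqP; rewrite -memv0 -J0; apply/hJ.
  have /hJ[_ /(_ f fA)] : v \in J by rewrite JA.
  by rewrite k1 => /eqP; rewrite oner_eq0.
split=> //.
  exists (wdual lam), v; split=> //.
  by rewrite (br_wdual _ hv.2) scaler_eq0 negb_or ppos.
move=> J JA stJ; apply: irrA => // x y xG yJ.
(* The element of [A] representing [kil x] acts on [A] as [x] does, so an ideal of [A] is stable
   under [G 0] and irreducibility applies. *)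
have [|z zA hz] := @killing_dual _ _ _ lieP A (kil x) ndA.
  by move=> c x1 x2; rewrite (killing_linr lieP).
have -> : br x y = br z y; last exact: stJ.
have yA := subvP JA _ yJ.
apply/eqP; rewrite -subr_eq0 -(brBl lieP); apply/eqP; apply: ndA.
  by rewrite (brBl lieP); apply: memvB; [apply: stA | apply: subA].
move=> u uA; rewrite (killing_inv lieP) (killingBl lieP) hz ?subrr //.
exact: subA.
Qed.

Local Notation gwt0 := (gwt H0 n).
Implicit Types (p : gwt0) (ps : seq gwt0).

Lemma is_weight_isw (V : {vspace L}) a j : (V <= G j)%VS -> is_weight_of br H0 V a -> isw a j.
Proof. by move=> VG [x xV [xn0 xw]]; exists x => //; split=> //; apply: (subvP VG). Qed.

Lemma highest_gj_isw j lam : highest_weight_gj br H0 (G 0) b0 (G j) lam -> isw lam j.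
Proof.
move=> [V [[VG _ _ _] [v vV [vn0 vw _]]]]; exists v => //; split=> //.
exact: (subvP VG).
Qed.

Lemma highest_root_isw theta : highest_root br H0 (G 0) b0 theta -> isw theta 0.
Proof.
move=> [V [VG _ _ [v vV [vn0 vw _]]]]; exists v => //; split=> //.
exact: (subvP VG).
Qed.

Lemma preceqE p p' : preceq br H0 (G 0) b0 n p p' <-> p.2 = p'.2 /\ Qplus (p'.1 - p.1).
Proof. by split=> -[h1 h2]; split=> //; apply/inQplusE. Qed.

Lemma gplus_G0 x : x \in gplus n G -> x \in G 0 -> x = 0.
Proof.
move=> /memv_sumP[us hu Dx] x0.
pose vs (j : 'I_n.+1) : L := if j == 0 then x else 0.
pose us' (j : 'I_n.+1) : L := if j != 0 then us j else 0.
have : us' 0 = vs 0.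
  apply: grade_uniq => [j|j|].
  - by rewrite /us'; case: ifP => // h; [apply: hu | apply: mem0v].
  - by rewrite /vs; case: eqP => [->|_]; rewrite ?mem0v.
  - by rewrite /us' /vs -!big_mkcond /= big_pred1_eq -Dx.
by rewrite /us' /vs eqxx.
Qed.

(** * From the subalgebra to the three conditions *)

Section Forward.

Variables (k : nat) (I : {vspace L}) (S : gwt0 -> Prop).
Hypothesis knilI : knil_pg_bmod_subalg br n k G b0 I.
Hypothesis SE : forall p, S p <-> minimal_grwt br H0 (G 0) b0 n G I p.
Hypothesis SSig : forall p, S p -> SigmaP br H0 n G p.

Definition wtI a j := exists x, [/\ x \in I, x != 0 & wv a j x].

Lemma I_br x y : x \in I -> y \in I -> br x y \in I.
Proof. by case: knilI => _ h _ _ _; apply: h. Qed.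

Lemma I_b0 x y : x \in b0 -> y \in I -> br x y \in I.
Proof. by case: knilI => _ _ h _ _; apply: h. Qed.

Lemma I_G0 x : x \in I -> x \in G 0 -> x = 0.
Proof. by case: knilI => /subvP h _ _ _ _ /h; apply: gplus_G0. Qed.

Lemma itbr_I xs y : all (fun x => x \in I) xs -> y \in I -> itbr br xs y \in I.
Proof.
move=> hx hy; elim: xs hx => [//|x xs IH] /= /andP[xI /IH h]; exact: I_br.
Qed.

Lemma itbr_long xs y : (k <= size xs)%N -> all (fun x => x \in I) xs -> y \in I ->
  itbr br xs y = 0.
Proof.
move=> sz; rewrite -(cat_take_drop (size xs - k) xs) all_cat => /andP[h1 h2] yI.
rewrite /itbr foldr_cat -/(itbr br _ y).
case: knilI => _ _ _ nil _; rewrite (nil (drop _ _)) ?size_drop ?subKn //.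
by elim: (take _ _) => //= x s ->; rewrite (br0r lieP).
Qed.

Lemma grwt_wtI p : grwt br H0 n G I p <-> wtI p.1 p.2.
Proof.
split=> [[x]|[x [xI xn0 [xG xw]]]].
  by rewrite memv_cap => /andP[xI xG] [xn0 xw]; exists x.
by exists x; rewrite ?memv_cap ?xI.
Qed.

Lemma S_wtI p : S p -> wtI p.1 p.2.
Proof. by move/SE => [/grwt_wtI]. Qed.

Lemma wtI_isw a j : wtI a j -> isw a j.
Proof. by move=> [x [_ xn0 hx]]; exists x. Qed.

Lemma wtI_min a j : wtI a j -> exists2 a', S (a', j) & Qplus (a - a').
Proof.
move=> h; have [x [_ xn0 hx]] := h; have [l [Dl _]] := wv_mu xn0 hx.
move: h; rewrite -Dl; move: {a x xn0 hx Dl} l.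
apply: (@finwt_ind wlt (fun a => wtI a j -> exists2 a', S (a', j) & Qplus (a - a'))).
- exact: wlt_irr.
- exact: wlt_tr.
move=> l IH h.
have [[q [gq pq neq]]|nex] := pselect (exists q : gwt0,
    [/\ grwt br H0 n G I q, preceq br H0 (G 0) b0 n q (mu l, j) & q <> (mu l, j)]).
  have [/= q2 q1] := (preceqE q (mu l, j)).1 pq.
  have gq' : wtI q.1 j by rewrite -q2; apply/grwt_wtI.
  have [x [_ xn0 hx]] := gq'; have [l' [Dl' _]] := wv_mu xn0 hx; rewrite -Dl' in gq' q1.
  have [|a' Sa' qa'] := IH l' _ gq'.
    split=> //; apply/eqP => e; apply: neq.
    by rewrite (surjective_pairing q) q2 -Dl' -e.
  by exists a' => //; rewrite -[mu l](subrK (mu l')) -addrA; apply: QplusD.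
exists (mu l); last by rewrite subrr; apply: Qplus0.
apply/SE; split; first exact/grwt_wtI.
by move=> q gq pq; apply: contrapT => neq; apply: nex; exists q.
Qed.

(** Positivity yields a member [c] of the list pairing negatively with minus the sum; raising by [c]
    removes it from the list, until one root is left. *)
Lemma wtI_neg_root s y j : psum s -> s != [::] -> y \in I -> y != 0 ->
  wv (- \sum_(a <- s) a) j y ->
  exists a y', [/\ pos a, y' \in I, y' != 0 & wv (- a) j y'].
Proof.
move: {2}(size s) (leqnn (size s)) => m; elim: m s y => [|m IH] [|a [|b s]] //= y sz hs _ yI yn0 hy.
  exists a, y; split=> //; first by apply: hs; rewrite mem_head.
  by rewrite big_seq1 in hy.
set t := [:: a, b & s] in hs hy.
have tn0 : \sum_(a <- t) a != 0 by apply: psum_neq0.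
have [c ct neg] : exists2 c, c \in t & wform (- \sum_(a <- t) a) c < 0.
  apply: real_sum_neg => [c ct|].
    by apply: (@isw_real _ _ j 0); [exists y | apply: pos_isw; apply: hs].
  rewrite -wform_sumr wformNl oppr_lt0; apply: wform_gt0 => //; exact: psum_real_wt.
have pc := hs c ct; have [e en0 he] := pos_isw pc.
have ey := raise_neq0 he en0 hy.2 yn0 neg.
apply: (IH (rem c t) (br e y)) => //.
- by rewrite size_rem.
- by move=> d /mem_rem; apply: hs.
- by apply/eqP => r0; have := size_rem ct; rewrite r0.
- by apply: I_b0 => //; apply: (pos_b0 pc).
have := wv_br he hy; rewrite add0r (big_rem c ct) /= opprD addrA subrr add0r.
exact.
Qed.

Lemma wtI_neq0 a j : wtI a j -> a != 0.
Proof.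
move=> h; apply/eqP => a0; rewrite a0 in h.
have [a' Sa'] := wtI_min h; rewrite sub0r => -[s hs Ds].
have [_ /= a'n0 _] := SSig Sa'; have [y0 [y0I y0n0 hy0]] := S_wtI Sa'.
have [||b [y [pb yI yn0 hy]]] := @wtI_neg_root s y0 j hs _ y0I y0n0.
- by apply/eqP => s0; move/eqP: Ds; rewrite s0 big_nil oppr_eq0 (negPf a'n0).
- by rewrite -Ds opprK.
have bn0 := pos_neq0 pb; have [e en0 he] := pos_isw pb.
(* Acting twice with the root vector [e] of [b0] moves [y] from weight -b to weight b inside [I],
   which provides the opposite pair. *)
pose e' := br e (br e y).
have e'n0 : e' != 0 by apply: (raise2_neq0 he en0 bn0 hy.2 yn0).
have eb : e \in b0 by apply: (pos_b0 pb).
have e'I : e' \in I by do 2 apply: I_b0 => //.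
have he' : wv b j e'.
  by have := wv_br he (wv_br he hy); rewrite subrr !add0r addr0.
have [xs [sz xsI nz _]] : exists xs, [/\ (k <= size xs)%N, all (fun x => x \in I) xs,
    itbr br xs y != 0 & weight_vec br H0 (- b) (itbr br xs y)].
  elim: (k) => [|m [xs [sz xsI nz wz]]]; first by exists [::]; split=> //; case: hy.
  exists [:: y, y, e', e' & xs]; split=> /=.
  - by rewrite ltnS !leqW.
  - by rewrite yI e'I.
  - apply: (raise2_neq0 hy yn0); rewrite ?oppr_eq0 ?opprK //.
      have := weight_vec_br he'.2 (weight_vec_br he'.2 wz); rewrite subrr addr0; exact.
    exact: (raise2_neq0 he' e'n0 bn0 wz nz).
  have := weight_vec_br hy.2 (weight_vec_br hy.2
    (weight_vec_br he'.2 (weight_vec_br he'.2 wz))).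
  by rewrite subrr addr0 addNr addr0.
by rewrite itbr_long ?eqxx in nz.
Qed.

Definition wtsI ps := forall p, p \in ps -> wtI p.1 p.2.

(** As for positive roots: two weights with negative pairing merge into one, since the bracket of
    their vectors is nonzero and stays in [I]. *)
Lemma wtsI_neq0 ps : wtsI ps -> ps != [::] -> \sum_(p <- ps) p.1 != 0.
Proof.
move: {2}(size ps) (leqnn (size ps)) => m; elim: m ps => [|m IH] [|p ps] //= sz hs _.
have hp : wtI p.1 p.2 by apply: hs; rewrite mem_head.
have hs' p' : p' \in ps -> wtI p'.1 p'.2 by move=> p's; apply: hs; rewrite in_cons p's orbT.
apply/eqP => sum0; rewrite big_cons in sum0.
have paa : 0 < wform p.1 p.1 by apply: isw_pos (wtI_isw hp) (wtI_neq0 hp).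
have [p' p's neg] : exists2 p', p' \in ps & wform p.1 p'.1 < 0.
  apply: real_sum_neg => [p' p's|]; first exact: isw_real (wtI_isw hp) (wtI_isw (hs' p' p's)).
  have -> : \sum_(p' <- ps) wform p.1 p'.1 = - wform p.1 p.1.
    by rewrite -wform_sumr -wformNr; congr wform; apply/eqP; rewrite -addr_eq0 addrC sum0.
  by rewrite oppr_lt0.
have [x [xI xn0 hx]] := hp; have [y [yI yn0 hy]] := hs' p' p's.
pose pp : gwt0 := (p.1 + p'.1, p.2 + p'.2).
have hpp : wtI pp.1 pp.2.
  exists (br x y); split; [exact: I_br | exact: (isw_addneg hx xn0 hy yn0) | exact: wv_br].
rewrite (big_rem p' p's) /= addrA in sum0.
have : \sum_(c <- pp :: rem p' ps) c.1 != 0.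
  apply: IH => //=; first by rewrite size_rem //; case: (ps) p's sz.
  move=> c; rewrite in_cons => /orP[/eqP->//|/mem_rem]; exact: hs'.
by rewrite big_cons sum0 eqxx.
Qed.

Lemma raise_to_equality ps nu j t : wtsI ps -> isw nu j -> psum t ->
  nu = \sum_(p <- ps) p.1 + \sum_(a <- t) a ->
  exists ps' nu', [/\ wtsI ps', size ps' = size ps, \sum_(p <- ps') p.2 = \sum_(p <- ps) p.2,
    isw nu' j & nu' = \sum_(p <- ps') p.1 /\ Qplus (nu - nu')].
Proof.
move: {2}(size t) (leqnn (size t)) => m; elim: m ps nu t => [|m IH] ps nu t sz hs wnu ht Dnu.
  exists ps, nu; split=> //; split; last by rewrite subrr; apply: Qplus0.
  by rewrite Dnu; case: (t) sz => //; rewrite big_nil addr0.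
have [t0|tn] := eqVneq t [::].
  exists ps, nu; split=> //; split; last by rewrite subrr; apply: Qplus0.
  by rewrite Dnu t0 big_nil addr0.
set q := \sum_(a <- t) a in Dnu.
have qpos : 0 < wform q q by apply: wform_gt0 (psum_real_wt ht) (psum_neq0 ht tn).
have Dq : q = nu - \sum_(p <- ps) p.1 by rewrite Dnu addrC addKr.
have qreal a : pos a -> wform q a \is Num.real.
  move=> /pos_isw wa; rewrite Dq wformBl wform_suml rpredB ?(isw_real wnu wa) // big_seq rpred_sum //.
  by move=> p /hs/wtI_isw wp; apply: isw_real wp wa.
have [a at_ apos] : exists2 a, a \in t & 0 < wform q a.
  apply: real_sum_pos => [a /ht|]; first exact: qreal.
  by rewrite -wform_sumr.
have pa := ht a at_; have wa := pos_isw pa.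
have szr : (size (rem a t) <= m)%N by rewrite size_rem //; case: (t) tn sz.
have htr : psum (rem a t) by move=> b /mem_rem; apply: ht.
have Dq' : q = a + \sum_(b <- rem a t) b by rewrite /q (big_rem a at_).
(* Since [q] is [nu] minus the sum of the list, (q, a) > 0 leaves two cases: (nu, a) > 0, and
   [nu - a] is a weight; or some member pairs negatively with [a], and [b0] raises its vector inside
   [I]. *)
have [nupos|nunpos] := boolP (0 < wform nu a).
  have wnu' : isw (nu - a) j by have := isw_subpos wa wnu nupos; rewrite subr0.
  have [|ps' [nu' [h1 h2 h3 h4 [h5 h6]]]] := IH ps (nu - a) (rem a t) szr hs wnu' htr.
    by apply/eqP; rewrite subr_eq Dnu Dq' (addrC a) addrA.
  exists ps', nu'; split=> //; split=> //.
  have -> : nu - nu' = a + (nu - a - nu') by rewrite addrA [a + _]addrC subrK.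
  by apply: QplusD => //; apply: Qplus_pos.
have sneg : \sum_(p <- ps) wform p.1 a < 0.
  move: apos; rewrite Dq wformBl wform_suml subr_gt0 => h; apply: lt_le_trans h _.
  by rewrite real_leNgt ?real0 ?(isw_real wnu wa).
have [p pps neg] : exists2 p, p \in ps & wform p.1 a < 0.
  by apply: real_sum_neg sneg => p /hs/wtI_isw wp; apply: isw_real wp wa.
have [x [xI xn0 hx]] := hs p pps; have [e en0 he] := wa.
pose pp : gwt0 := (p.1 + a, p.2).
have hpp : wtI pp.1 pp.2.
  exists (br e x); split.
  - by apply: I_b0 => //; apply: (pos_b0 pa).
  - exact: (raise_neq0 he en0 hx.2 xn0).
  - by have := wv_br he hx; rewrite add0r addrC.
have hps1 : wtsI (pp :: rem p ps).
  move=> c; rewrite in_cons => /orP[/eqP->//|/mem_rem]; exact: hs.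
have [|ps' [nu' [h1 h2 h3 h4 h5]]] := IH (pp :: rem p ps) nu (rem a t) szr hps1 wnu htr.
  by rewrite Dnu Dq' big_cons (big_rem p pps) /= !addrA; congr (_ + _); rewrite addrAC.
exists ps', nu'; split=> //.
- by rewrite h2 /= size_rem // prednK //; case: (ps) pps.
- by rewrite h3 big_cons [in RHS](big_rem p pps).
Qed.

Lemma nested_bracket m ps nu : size ps = m.+1 -> wtsI ps -> nu = \sum_(p <- ps) p.1 ->
  isw nu (\sum_(p <- ps) p.2) ->
  exists xs y, [/\ size xs = m, all (fun x => x \in I) xs, y \in I, itbr br xs y != 0
    & wv nu (\sum_(p <- ps) p.2) (itbr br xs y)].
Proof.
elim: m ps nu => [|m IH] ps nu sz hs Dnu wnu.
  case: ps sz hs Dnu wnu => [|p [|]] // _ hs; rewrite !big_seq1 => -> _.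
  have [x [xI xn0 hx]] := hs p (mem_head _ _).
  by exists [::], x.
have nun0 : nu != 0 by rewrite Dnu; apply: wtsI_neq0 => //; case: (ps) sz.
have nupos := isw_pos wnu nun0.
have [p pps ppos] : exists2 p, p \in ps & 0 < wform nu p.1.
  apply: real_sum_pos => [p /hs/wtI_isw wp|]; first exact: isw_real wnu wp.
  by rewrite -wform_sumr -Dnu.
have hp := hs p pps; have wp := wtI_isw hp; have [x [xI xn0 hx]] := hp.
have hsr : wtsI (rem p ps) by move=> p' /mem_rem; apply: hs.
have szr : size (rem p ps) = m.+1 by rewrite size_rem // sz.
have D1 : nu - p.1 = \sum_(p <- rem p ps) p.1 by rewrite Dnu (big_rem p pps) /= addrAC subrr add0r.
have D2 : (\sum_(p <- ps) p.2) - p.2 = \sum_(p <- rem p ps) p.2.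
  by rewrite (big_rem p pps) /= addrAC subrr add0r.
have wnu' := isw_subpos wp wnu ppos; rewrite D2 in wnu'.
have [xs [y [h1 h2 h3 h4 h5]]] := IH _ _ szr hsr D1 wnu'.
set v1 := itbr br xs y in h4 h5.
have nu'n0 : nu - p.1 != 0 by rewrite D1; apply: wtsI_neq0 => //; rewrite -size_eq0 szr.
exists (x :: xs), y; split=> //=; rewrite ?h1 ?xI //; last first.
  rewrite -/v1; have := wv_br hx h5; rewrite addrC subrK -D2 addrC subrK; exact.
(* Here [nu - p.1] may pair positively with [p.1], so the argument is dual: [x] acts nontrivially on
   a vector [v'] of weight -nu, the result pairs nontrivially with the line of [v1], and invariance
   moves [x] over to [v1]. *)
rewrite -/v1; apply/eqP => xv0.
have [v' v'n0 hv'] := iswN wnu.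
have neg : wform (- nu) p.1 < 0 by rewrite wformNl oppr_lt0.
have un0 := raise_neq0 hx xn0 hv'.2 v'n0 neg.
have hu := wv_br hx hv'; rewrite -opprB -[p.2 - _]opprB D2 in hu.
have [y' hy' k1] := kil_dual hu un0; rewrite !opprK in hy'.
have /vlineP[c Dy'] := wv_line nu'n0 h5 h4 hy'.
move/eqP: k1; rewrite Dy' (killingZr lieP) killingC -(killing_inv lieP) (brC lieP) xv0 oppr0.
by rewrite killing0l // mulr0 eq_sym oner_eq0.
Qed.

Lemma bracket_below ps nu m : size ps = m.+1 -> (forall p, p \in ps -> S p) ->
  isw nu (\sum_(p <- ps) p.2) -> Qplus (nu - \sum_(p <- ps) p.1) ->
  exists nu' xs y, [/\ size xs = m, all (fun x => x \in I) xs, y \in I, itbr br xs y != 0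
    & wv nu' (\sum_(p <- ps) p.2) (itbr br xs y) /\ Qplus (nu - nu')].
Proof.
move=> sz hS wnu [t ht Dt].
have hs : wtsI ps by move=> p /hS/S_wtI.
have [|ps' [nu' [h1 h2 h3 h4 [h5 h6]]]] := raise_to_equality hs wnu ht.
  by rewrite -Dt addrC subrK.
rewrite -h3 in h4; have [xs [y [k1 k2 k3 k4 k5]]] := nested_bracket (etrans h2 sz) h1 h5 h4.
by exists nu', xs, y; rewrite -h3.
Qed.

(** One nonzero iterated bracket serves all three parts: in (i) it has k operators, against
    nilpotency; in (ii) it has degree 0, where [I] vanishes; in (iii) its weight is a weight of [I],
    hence above a minimal one. *)
Lemma forward :
  [/\ (forall ps, size ps = k.+1 -> (forall p, p \in ps -> S p) ->
        forall lam, highest_weight_gj br H0 (G 0) b0 (G (gsum H0 n ps).2) lam ->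
        ~ preceq br H0 (G 0) b0 n (gsum H0 n ps) (lam, (gsum H0 n ps).2)),
      (forall ps, (0 < size ps)%N -> (forall p, p \in ps -> S p) -> (gsum H0 n ps).2 = 0 ->
        forall theta, highest_root br H0 (G 0) b0 theta ->
        ~ preceq br H0 (G 0) b0 n (gsum H0 n ps) (theta, 0)) &
      (forall p1 p2, S p1 -> S p2 -> forall nu, SigmaP br H0 n G (nu, p1.2 + p2.2) ->
        preceq br H0 (G 0) b0 n (p1.1 + p2.1, p1.2 + p2.2) (nu, p1.2 + p2.2) ->
        exists alpha, S (alpha, p1.2 + p2.2) /\
          preceq br H0 (G 0) b0 n (alpha, p1.2 + p2.2) (nu, p1.2 + p2.2))].
Proof.
split.
- move=> ps sz hS lam /highest_gj_isw wl /preceqE[_ /= q].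
  have [nu' [xs [y [h1 h2 h3 h4 _]]]] := bracket_below sz hS wl q.
  by case/eqP: h4; apply: itbr_long; rewrite ?h1.
- move=> ps sz hS gs0 theta /highest_root_isw wt /preceqE[_ /= q].
  rewrite -gs0 in wt.
  have sz' : size ps = (size ps).-1.+1 by rewrite prednK.
  have [nu' [xs [y [h1 h2 h3 h4 [h5 _]]]]] := bracket_below sz' hS wt q.
  case/eqP: h4; apply: I_G0; first exact: itbr_I.
  by case: h5 => h5 _; rewrite -gs0.
move=> p1 p2 S1 S2 nu [/= _ _ wnu] /preceqE[_ /= q].
have hS p : p \in [:: p1; p2] -> S p by rewrite !inE => /orP[/eqP->|/eqP->].
have s1 : \sum_(p <- [:: p1; p2]) p.1 = p1.1 + p2.1 by rewrite big_cons big_seq1.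
have s2 : \sum_(p <- [:: p1; p2]) p.2 = p1.2 + p2.2 by rewrite big_cons big_seq1.
have wnu' := is_weight_isw (subvv _) wnu.
rewrite -s1 in q; rewrite -s2 in wnu' *.
have [nu' [xs [y [h1 h2 h3 h4 [h5 h6]]]]] := bracket_below (erefl : size [:: p1; p2] = 2%N) hS wnu' q.
have [|a' Sa' qa'] := @wtI_min nu' (\sum_(p <- [:: p1; p2]) p.2).
  by exists (itbr br xs y); split=> //; apply: itbr_I.
exists a'; split=> //; apply/preceqE; split=> //=.
by rewrite -[nu](subrK nu') -addrA; apply: QplusD.
Qed.

End Forward.

(** * From the three conditions to the subalgebra *)

Section Backward.

Variables (k : nat) (S : gwt0 -> Prop).

Hypothesis SSig : forall p, S p -> SigmaP br H0 n G p.
Hypothesis SA : antichain br H0 (G 0) b0 n S.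
Hypothesis S1 : forall ps, size ps = k.+1 -> (forall p, p \in ps -> S p) ->
  forall lam, highest_weight_gj br H0 (G 0) b0 (G (gsum H0 n ps).2) lam ->
  ~ preceq br H0 (G 0) b0 n (gsum H0 n ps) (lam, (gsum H0 n ps).2).
Hypothesis S2 : forall ps, (0 < size ps)%N -> (forall p, p \in ps -> S p) ->
  (gsum H0 n ps).2 = 0 -> forall theta, highest_root br H0 (G 0) b0 theta ->
  ~ preceq br H0 (G 0) b0 n (gsum H0 n ps) (theta, 0).
Hypothesis S3 : forall p1 p2, S p1 -> S p2 -> forall nu, SigmaP br H0 n G (nu, p1.2 + p2.2) ->
  preceq br H0 (G 0) b0 n (p1.1 + p2.1, p1.2 + p2.2) (nu, p1.2 + p2.2) ->
  exists alpha, S (alpha, p1.2 + p2.2) /\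
    preceq br H0 (G 0) b0 n (alpha, p1.2 + p2.2) (nu, p1.2 + p2.2).

(** The candidates for the graded weights of the subalgebra. The clauses [a != 0] and [j != 0] are
    not implied by lying above [S]; that brackets respect them is the point of [up_br]. *)
Definition up a j := [/\ a != 0, j != 0, isw a j & exists2 b, S (b, j) & Qplus (a - b)].

Lemma S1_isw ps nu : size ps = k.+1 -> (forall p, p \in ps -> S p) ->
  isw nu (\sum_(p <- ps) p.2) -> Qplus (nu - \sum_(p <- ps) p.1) -> False.
Proof.
move=> sz hS wnu q; have [lam hl ql] := highest_above wnu.
apply: (S1 sz hS hl); apply/preceqE; split=> //=.
by rewrite -[lam](subrK nu) -addrA; apply: QplusD.
Qed.

Lemma S2_root ps nu b : pos b -> (0 < size ps)%N -> (forall p, p \in ps -> S p) ->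
  \sum_(p <- ps) p.2 = 0 -> isw nu 0 -> Qplus (nu - \sum_(p <- ps) p.1) -> False.
Proof.
move=> pb sz hS gs wnu q; have [theta ht qt] := highest_root_above wnu pb.
apply: (S2 sz hS gs ht); apply/preceqE; split=> //=.
by rewrite -[theta](subrK nu) -addrA; apply: QplusD.
Qed.

Lemma mulrn_ord (d : 'I_n.+1) : d *+ n.+1 = 0.
Proof. by apply: val_inj; rewrite Zp_mulrn /= modnMl. Qed.

(** With n + 1 copies of the list the degree becomes 0 while the weight 0 still lies above the sum.
    It is a weight of g_0 because [wdual b] is a nonzero vector of [H0], so (ii) is violated. *)
Lemma S_not_neg ps b : pos b -> (0 < size ps)%N -> (forall p, p \in ps -> S p) ->
  Qplus (- \sum_(p <- ps) p.1) -> False.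
Proof.
move=> pb sz hS q; pose rep m := flatten (nseq m ps).
have rep1 m : \sum_(p <- rep m) p.1 = (\sum_(p <- ps) p.1) *+ m.
  by elim: m => [|m IH]; rewrite /rep /= ?big_nil // big_cat /= -/(rep m) IH mulrS.
have rep2 m : \sum_(p <- rep m) p.2 = (\sum_(p <- ps) p.2) *+ m.
  by elim: m => [|m IH]; rewrite /rep /= ?big_nil // big_cat /= -/(rep m) IH mulrS.
have qn m : Qplus (- (\sum_(p <- ps) p.1) *+ m).
  by elim: m => [|m IH]; rewrite ?mulr0n; [apply: Qplus0 | rewrite mulrS; apply: QplusD].
apply: (@S2_root (rep n.+1) 0 b pb).
- by rewrite /rep /= size_cat (leq_trans sz) // leq_addr.
- by move=> p /flattenP[t /nseqP[-> _]]; apply: hS.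
- by rewrite rep2 mulrn_ord.
- exists (wdual b); last exact/wvH0/wdual_H0.
  apply/eqP => T0; have := isw_pos (pos_isw pb) (pos_neq0 pb).
  by rewrite wform_kil T0 killing0l // ltxx.
- by rewrite rep1 sub0r -mulNrn; apply: qn.
Qed.

(* Without roots of g_0 the order is equality; an opposite pair (a,i), (-a,j) in S
   would give weights (a, i + m(i+j)) and (0, m(i+j)) for all m, contradicting (i). *)
Lemma no_opposite a i j : (forall b, ~ pos b) -> a != 0 -> isw a i -> isw (- a) j ->
  S (a, i) -> S (- a, j) -> False.
Proof.
move=> npos an0 [x xn0 hx] [y yn0 hy] Sa Sb.
have paa : 0 < wform a a by apply: (@isw_pos a i) => //; exists x.
pose d := i + j.
have W m : isw a (i + d *+ m).
  (* Bracketing twice with [y] and twice with [x] returns to weight [a] and adds [2d] to the degree,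
     so the induction carries two consecutive values. *)
  suff [] : isw a (i + d *+ m) /\ isw a (i + d *+ m.+1) by [].
  elim: m => [|m [IH1 IH2]].
    split; first by rewrite mulr0n addr0; exists x.
    exists (br x (br x y)); first exact: (raise2_neq0 hx xn0 an0 hy.2 yn0).
    by have := wv_br hx (wv_br hx hy); rewrite subrr addr0 mulr1n.
  split=> //; have [v vn0 hv] := IH1.
  have h2 := wv_br hy (wv_br hy hv); rewrite addNr addr0 in h2.
  have v2 : br y (br y v) != 0.
    by apply: (raise2_neq0 hy yn0 _ _ vn0); rewrite ?oppr_eq0 ?opprK //; case: hv.
  have [e1 e2] := wv_br hx (wv_br hx h2).
  exists (br x (br x (br y (br y v)))); first exact: (raise2_neq0 hx xn0 an0 h2.2 v2).
  split; last by rewrite subrr addr0 in e2.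
  suff <- : i + (i + (j + (j + (i + d *+ m)))) = i + d *+ m.+2 by [].
  by rewrite !mulrS -[in RHS](addrA i) -[in RHS](addrA i) [in LHS](addrCA j i).
have W0 m : isw 0 (d *+ m.+1).
  have [v vn0 hv] := W m; exists (br y v).
    by apply: (raise_neq0 hy yn0 hv.2 vn0); rewrite wformNr oppr_lt0.
  by have := wv_br hy hv; rewrite addNr addrA [j + i]addrC mulrS.
pose ps m1 m2 : seq gwt0 := nseq m1 (a, i) ++ nseq m2 (- a, j).
have psS m1 m2 p : p \in ps m1 m2 -> S p.
  by rewrite mem_cat => /orP[] /nseqP[->].
have sum1 m1 m2 : \sum_(p <- ps m1 m2) p.1 = a *+ m1 - a *+ m2.
  by rewrite big_cat /= !big_nseq !iter_addr_0 mulNrn.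
have sum2 m1 m2 : \sum_(p <- ps m1 m2) p.2 = i *+ m1 + j *+ m2.
  by rewrite big_cat /= !big_nseq !iter_addr_0.
have szps m1 m2 : size (ps m1 m2) = (m1 + m2)%N by rewrite size_cat !size_nseq.
(* By the parity of k + 1: one more copy of (a, i) than of (-a, j) gives weight a, equal numbers
   give weight 0, each in a degree where it occurs. *)
have := odd_double_half k.+1; move: (k.+1./2) (odd k.+1) => m [] Dk.
  rewrite -addnn add1n -addSn in Dk.
  apply: (@S1_isw (ps m.+1 m) a); [by rewrite szps | exact: psS | |].
    by rewrite sum2 mulrS -addrA -mulrnDl; apply: W.
  by rewrite sum1 mulrS addrK subrr; apply: Qplus0.
case: m Dk => [//|m]; rewrite add0n -addnn => Dk.
apply: (@S1_isw (ps m.+1 m.+1) 0); [by rewrite szps | exact: psS | |].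
  by rewrite sum2 -mulrnDl; apply: W0.
by rewrite sum1 subrr subr0; apply: Qplus0.
Qed.

(** The weight [a + b] is not 0, by (ii) if g_0 has a root and by [no_opposite] otherwise. The
    degree is not 0, since [a + b] would then be a root of g_0, against (ii). An element of [S]
    below comes from (iii). *)
Lemma up_br a b i j x y : up a i -> up b j -> wv a i x -> wv b j y -> br x y != 0 ->
  up (a + b) (i + j).
Proof.
move=> [an0 in0 wa [a' Sa qa]] [bn0 jn0 wb [b' Sb qb]] hx hy xy.
have wab : isw (a + b) (i + j) by exists (br x y) => //; apply: wv_br.
pose ps : seq gwt0 := [:: (a', i); (b', j)].
have hS p : p \in ps -> S p by rewrite !inE => /orP[/eqP->|/eqP->].
have s1 : \sum_(p <- ps) p.1 = a' + b' by rewrite big_cons big_seq1.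
have s2 : \sum_(p <- ps) p.2 = i + j by rewrite big_cons big_seq1.
have qab : Qplus ((a + b) - (a' + b')) by rewrite opprD addrACA; apply: QplusD.
have abn0 : a + b != 0.
  apply/eqP => ab0; rewrite ab0 sub0r in qab.
  have [[c pc]|nc] := pselect (exists c, pos c).
    by apply: (@S_not_neg ps c pc) => //; rewrite s1.
  have Q0 q : Qplus q -> q = 0.
    by move=> [[|c s] hs ->]; [rewrite big_nil | case: nc; exists c; apply: hs; rewrite mem_head].
  have Da : a' = a by apply/esym/eqP; rewrite -subr_eq0; apply/eqP/Q0.
  have Db' : b' = b by apply/esym/eqP; rewrite -subr_eq0; apply/eqP/Q0.
  have Db : b = - a by apply/eqP; rewrite -addr_eq0 addrC ab0.
  rewrite Da in Sa; rewrite Db' Db in Sb; rewrite Db in wb.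
  by apply: (no_opposite _ an0 wa wb Sa Sb) => c pc; apply: nc; exists c.
have ijn0 : i + j != 0.
  apply/eqP => ij0; rewrite ij0 in wab.
  have [c pc] : exists c, pos c.
    by have [pc|pc] := root_pos abn0 wab; [exists (a + b) | exists (- (a + b))].
  apply: (@S2_root ps (a + b) c pc) => //; first by rewrite s2.
  by rewrite s1.
split=> //; have [||al [Sal /preceqE[_ qal]]] := S3 Sa Sb (nu := a + b).
- by split=> //=; have [z zn0 [zG zw]] := wab; exists z.
- exact/preceqE.
by exists al.
Qed.

Lemma backward : knil_antichain br H0 b0 n k G S.
Proof.
pose W w := exists a j, up a j /\ wv a j w.
have WZ d w : W w -> W (d *: w) by move=> [a [j [u h]]]; exists a, j; split=> //; apply: wvZ.
have [I hI] := sumof_vspace WZ.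
have IG x a j : x \in I -> x != 0 -> wv a j x -> up a j.
  move=> /hI[s sW Dx] xn0 hx; have [l cl] := exists_coord xn0.
  have [e1 e2] := coord_wv hx cl; rewrite Dx in cl; have [w ws cw] := coord_sum_neq0 cl.
  have [a' [j' [u hw]]] := sW w ws; have [e1' e2'] := coord_wv hw cw.
  by rewrite -e1' -e2' e1 e2 in u.
have upI a j x : up a j -> wv a j x -> x \in I by move=> u h; apply/hI/sumof1; exists a, j.
have grwtI p : grwt br H0 n G I p <-> up p.1 p.2.
  split=> [[x]|u].
    by rewrite memv_cap => /andP[xI xG] [xn0 xw]; apply: (IG x).
  have [_ _ [x xn0 hx] _] := u; exists x; last by case: hx.
  by rewrite memv_cap (upI _ _ _ u hx); case: hx.
have Sup p : S p -> up p.1 p.2.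
  move=> Sp; have [p2 p1 wp] := SSig Sp; split=> //; first exact: is_weight_isw (subvv _) wp.
  by exists p.1; [rewrite -surjective_pairing | rewrite subrr; apply: Qplus0].
exists I; split; last first.
  move=> p; split=> [Sp|[/grwtI u hmin]].
    split; first exact/grwtI/Sup.
    move=> q /grwtI[_ _ _ [b Sb qb]] /preceqE[q2 q1].
    have Dp : (b, q.2) = p.
      apply: SA => //; apply/preceqE; split=> //=.
      by rewrite -[p.1](subrK q.1) -addrA; apply: QplusD.
    rewrite (surjective_pairing q) -Dp; congr (_, _); apply/eqP; rewrite -subr_eq0; apply/eqP.
    by apply: Qplus_anti qb _; rewrite opprB; rewrite -Dp in q1.
  have [_ _ _ [b Sb qb]] := u.
  have <- : (b, p.2) = p; last by [].
  by apply: hmin; [apply/grwtI; apply: (Sup (b, p.2)) | apply/preceqE].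
split.
- apply/subvP => x /hI[s sW ->]; rewrite big_seq memv_suml // => w /sW[a [j [[_ jn0 _ _] [wG _]]]].
  by apply: (subvP (sumv_sup j jn0 (subvv _))).
- move=> x y /hI hx /hI hy; apply/hI; apply: (sumof_br hx hy) => {hx hy} x1 y1.
  move=> [a [i [ua hx]]] [b [j [ub hy]]].
  have [->|xy] := eqVneq (br x1 y1) 0; first exact: sumof0.
  apply: sumof1; exists (a + b), (i + j); split; last exact: wv_br.
  exact: (up_br ua ub hx hy xy).
- move=> x y /b0_sumof hx /hI hy; apply/hI; apply: (sumof_br hx hy) => {hx hy} x1 y1.
  move=> hx [a [j [ua hy]]]; have [->|xy] := eqVneq (br x1 y1) 0; first exact: sumof0.
  apply: sumof1; case: hx => [xH|[c [pc hx]]].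
    by exists a, j; split=> //; rewrite (weight_vecT xH hy.2); apply: wvZ.
  have hxy := wv_br hx hy; rewrite add0r in hxy.
  have [an0 jn0 wa [a' Sa qa]] := ua.
  exists (c + a), j; split=> //; split=> //; [|by exists (br x1 y1)|].
    apply/eqP => ca0; apply: (@S_not_neg [:: (a', j)] c pc) => //.
      by move=> p; rewrite inE => /eqP->.
    rewrite big_seq1; have -> : - a' = c + (a - a') by rewrite addrA ca0 add0r.
    by apply: QplusD => //; apply: Qplus_pos.
  by exists a' => //; rewrite -addrA; apply: QplusD => //; apply: Qplus_pos.
- move=> xs y sz xsI yI.
  (* A bracket with m operators is a sum of vectors whose weights lie above sums of m + 1 members of
     [S]; for m = k these vectors vanish by (i). *)
  pose V m w := exists ps nu, [/\ size ps = m.+1, forall p, p \in ps -> S p,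
    wv nu (\sum_(p <- ps) p.2) w & Qplus (nu - \sum_(p <- ps) p.1)].
  have : sumof (V (size xs)) (itbr br xs y).
    elim: xs xsI {sz} => [|x xs IH] /=.
      move=> _; apply: sumof_bind ((hI y).1 yI) => w [a [j [[_ _ _ [b Sb qb]] hw]]].
      apply: sumof1; exists [:: (b, j)], a; rewrite !big_seq1; split=> //.
      by move=> p; rewrite inE => /eqP->.
    move=> /andP[/hI xI /IH hxs]; apply: (sumof_br xI hxs) => {xI hxs} x1 y1.
    move=> [a [j [[_ _ _ [b Sb qb]] hx]]] [ps [nu [sz hS hy q]]].
    apply: sumof1; exists ((b, j) :: ps), (a + nu); rewrite !big_cons /= sz; split=> //.
    + by move=> p; rewrite in_cons => /orP[/eqP->|/hS].
    + exact: wv_br.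
    + by rewrite opprD addrACA; apply: QplusD.
  move=> [s sV ->]; rewrite big_seq big1 // => w /sV[ps [nu [szp hS hw q]]].
  apply/eqP/negPn/negP => wn0; rewrite sz in szp.
  by apply: (S1_isw szp hS) q; exists w.
- apply/eqP; rewrite eqEsubv; apply/andP; split; last first.
    by apply/subv_sumP => j _; apply: capvSl.
  apply/subvP => x /hI[s sW ->]; rewrite big_seq memv_suml // => w /sW[a [j [u hw]]].
  have [_ jn0 _ _] := u.
  apply: (subvP (sumv_sup j jn0 (subvv _))); rewrite memv_cap (upI _ _ _ u hw).
  by case: hw.
Qed.

End Backward.

End GradedWeights.

(** * Homogeneous weight bases *)

Section GradedBasis.

Variables (F : numClosedFieldType) (L : vectType F) (br : L -> L -> L).
Hypothesis lieP : is_lie_bracket br.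
Hypothesis simpleL : simple_lie br fullv.
Variables (n : nat) (G : 'I_n.+1 -> {vspace L}).
Hypothesis gradP : is_grading br n G.
Variable h : {vspace L}.
Hypothesis cartan_h : cartan_in br fullv h.

(** Simultaneously diagonal operators commute, so [br x y] is central, and the center lies in the
    radical of the Killing form. *)
Lemma cartan_abelian x y : x \in h -> y \in h -> br x y = 0.
Proof.
move=> xh yh; have [N [X [al [bX hX]]]] := cartan_diag lieP simpleL cartan_h.
apply: (killing_nondeg lieP simpleL cartan_h); apply: killing_central => // z.
rewrite (coord_basis bX (memvf z)) br_sumr // big1 // => i _; rewrite brZr //.
have E u v : u \in h -> v \in h ->
    br u (br v X`_i) = (al i (vsproj h u) * al i (vsproj h v)) *: X`_i.
  move=> uh vh; rewrite -{1}(vsprojK uh) -{1}(vsprojK vh) hX brZr // hX scalerA.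
  by rewrite mulrC.
have := jacobi lieP x y X`_i; rewrite !E // mulrC => /eqP.
by rewrite -subr_eq0 opprD addrCA subrr addr0 oppr_eq0 => /eqP->; rewrite scaler0.
Qed.

(** Reading the eigenvalue off a coordinate at which [u] does not vanish exhibits it as a linear
    function of [t]. *)
Lemma eigen_weight (H0 : {vspace L}) u :
  (forall t : subvs_of H0, exists c, br (vsval t) u = c *: u) ->
  exists a : wt H0, weight_vec br H0 a u.
Proof.
move=> hu; have [->|un0] := eqVneq u 0; first by exists 0 => t; rewrite br0r // scaler0.
pose X := vbasis {:L}; have bX : basis_of fullv X := vbasisP _.
have [l cl] : exists l, coord X l u != 0.
  apply: contrapT => nex; case/eqP: un0; rewrite (coord_basis bX (memvf u)) big1 // => l _.
  have [->|c] := eqVneq (coord X l u) 0; first by rewrite scale0r.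
  by case: nex; exists l.
pose g (t : subvs_of H0) : F^o := coord X l (br (vsval t) u) / coord X l u.
have glin : linear g.
  move=> c t t'; rewrite /g linearP /= br_linl // linearP /= mulrDl.
  by rewrite -mulrA.
exists (linfun (HB.pack g (GRing.isLinear.Build _ _ _ _ g glin) : {linear subvs_of H0 -> F^o})).
move=> t; rewrite lfunE /= /g; have [c ->] := hu t.
by rewrite linearZ /= mulfK.
Qed.

(** [h] is not assumed to be graded, so its eigenvectors need not be homogeneous. But h_0 has degree
    0, and therefore acts on every homogeneous component of such an eigenvector by the same
    scalar. *)
Lemma graded_basis : exists N (Y : N.-tuple L) (mu : 'I_N -> wt (h :&: G 0%R)%VS)
    (gr : 'I_N -> 'I_n.+1), [/\ basis_of fullv Y, forall i : 'I_N, Y`_i \in G (gr i)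
    & forall i : 'I_N, weight_vec br (h :&: G 0%R)%VS (mu i) Y`_i].
Proof.
set H0 := (h :&: G 0%R)%VS.
have [N [X [al [bX hX]]]] := cartan_diag lieP simpleL cartan_h.
pose P w := exists j (a : wt H0), w \in G j /\ weight_vec br H0 a w.
have PZ c w : P w -> P (c *: w).
  move=> [j [a [wG ww]]]; exists j, a; split; first exact: memvZ.
  exact: weight_vecZ.
have [|M [Y [bY hY]]] := @basis_of_sums _ _ P.
  move=> v; rewrite (coord_basis bX (memvf v)); apply: sumof_sum => i _.
  apply: sumofZ => //.
  have [sumG _ _] := gradP.
  have /memv_sumP[us hus Dus] : X`_i \in (\sum_(i < n.+1) G i)%VS by rewrite sumG memvf.
  rewrite Dus; apply: sumof_sum => j _; apply: sumof1; exists j.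
  suff [a ha] : exists a : wt H0, weight_vec br H0 a (us j) by exists a; split=> //; apply: hus.
  apply: eigen_weight => t; have /andP[th tG] : (vsval t \in h) && (vsval t \in G 0).
    by rewrite -memv_cap subvsP.
  exists (al i (vsproj h (vsval t))).
  apply: (grade_uniq gradP (us := fun j => br (vsval t) (us j))
     (vs := fun j => al i (vsproj h (vsval t)) *: us j)).
  - by move=> k; rewrite -[k in G k]add0r; apply: (G_br gradP) => //; apply: hus.
  - by move=> k; rewrite memvZ ?hus.
  rewrite -br_sumr // -scaler_sumr -Dus -hX vsprojK //.
have /choice[gr hgr] : forall i : 'I_M, exists j, exists a : wt H0,
    Y`_i \in G j /\ weight_vec br H0 a Y`_i.
  by move=> i; have := hY i; rewrite (tnth_nth 0).
have /choice[mu hmu] := hgr.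
by exists M, Y, mu, gr; split=> // i; case: (hmu i).
Qed.

End GradedBasis.

Theorem theorem2p2 (R : realType) (n k : nat) (L : vectType R[i])
    (br : L -> L -> L) (G : 'I_n.+1 -> {vspace L}) (h b0 : {vspace L}) :
  is_lie_bracket br ->
  simple_lie br fullv ->
  is_grading br n G ->
  cartan_in br fullv h ->
  cartan_in br (G 0) (h :&: G 0%R)%VS ->
  borel_in br (G 0) b0 ->
  ((h :&: G 0%R) <= b0)%VS ->
  (0 < k)%N ->
  forall S : gwt (h :&: G 0%R)%VS n -> Prop,
    (forall p, S p -> SigmaP br (h :&: G 0%R)%VS n G p) ->
    antichain br (h :&: G 0%R)%VS (G 0) b0 n S ->
    knil_antichain br (h :&: G 0%R)%VS b0 n k G S <->
    [/\
      (* (i) *)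
      (forall ps : seq (gwt (h :&: G 0%R)%VS n),
         size ps = k.+1 -> (forall p, p \in ps -> S p) ->
         forall lam : wt (h :&: G 0%R)%VS,
           highest_weight_gj br (h :&: G 0%R)%VS (G 0) b0 (G (gsum _ _ ps).2) lam ->
           ~ preceq br (h :&: G 0%R)%VS (G 0) b0 n (gsum _ _ ps) (lam, (gsum _ _ ps).2)),
      (* (ii) *)
      (forall ps : seq (gwt (h :&: G 0%R)%VS n),
         (0 < size ps)%N -> (forall p, p \in ps -> S p) -> (gsum _ _ ps).2 = 0 ->
         forall theta : wt (h :&: G 0%R)%VS,
           highest_root br (h :&: G 0%R)%VS (G 0) b0 theta ->
           ~ preceq br (h :&: G 0%R)%VS (G 0) b0 n (gsum _ _ ps) (theta, 0)) &
      (* (iii) *)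
      (forall p1 p2 : gwt (h :&: G 0%R)%VS n, S p1 -> S p2 ->
         forall nu : wt (h :&: G 0%R)%VS,
           SigmaP br (h :&: G 0%R)%VS n G (nu, p1.2 + p2.2) ->
           preceq br (h :&: G 0%R)%VS (G 0) b0 n
             (p1.1 + p2.1, p1.2 + p2.2) (nu, p1.2 + p2.2) ->
           exists alpha : wt (h :&: G 0%R)%VS,
             S (alpha, p1.2 + p2.2) /\
             preceq br (h :&: G 0%R)%VS (G 0) b0 n
               (alpha, p1.2 + p2.2) (nu, p1.2 + p2.2))].
Proof.
move=> lieP simpleL gradP cartan_h cartan0 borelP H0b _ S SSig SA.
have ndK := killing_nondeg lieP simpleL cartan_h.
have H0G : (h :&: G 0%R <= G 0%R)%VS := capvSr h (G 0).
have H0ab x y : x \in (h :&: G 0%R)%VS -> y \in (h :&: G 0%R)%VS -> br x y = 0.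
  rewrite !memv_cap => /andP[xh _] /andP[yh _].
  exact: (cartan_abelian lieP simpleL cartan_h).
have H0c x : x \in G 0 -> (forall t, t \in (h :&: G 0%R)%VS -> br t x = 0) ->
    x \in (h :&: G 0%R)%VS.
  case: cartan0 => _ _ _ norm xG hx; apply: norm => // y yH.
  by rewrite (brC lieP) hx // oppr0 mem0v.
have [N [Y [mu [gr [bY Ygr Ywt]]]]] := graded_basis lieP simpleL gradP cartan_h.
split.
  move=> [I [knilI SE]].
  exact: (forward lieP gradP ndK H0G H0ab H0c bY Ygr Ywt borelP H0b knilI SE SSig).
move=> [S1 S2 S3].
exact: (backward lieP gradP ndK H0G H0ab H0c bY Ygr Ywt borelP H0b SSig SA S1 S2 S3).
Qed.
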